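(* Let $n\ge 2$, let $\Omega\subset\mathbb{R}^n$ be a bounded domain with Lipschitz continuous boundary $\Gamma$ and unit outward normal $\nu$, let $F\in L^2(\Omega)^n$, $p_b\in H^{1/2}(\Gamma)$, and $u_b\in H^{1/2}(\Gamma)^n$ with $\int_\Gamma u_b\cdot\nu=0$. Let $(u_S,p_S)$ be the solution of the Stokes problem (S), $(u_{PP},p_{PP})$ the solution of the pressure-Poisson problem (PP) and, for each $\varepsilon>0$, $(u_\varepsilon,p_\varepsilon)$ the solution of the $\varepsilon$-Stokes problem (ES). Suppose that $p_S\in H^1(\Omega)$. Then there exists a constant $c>0$ independent of $\varepsilon$ such that $$\|u_S-u_{PP}\|_{H^1(\Omega)^n}\le c\,\|\gamma_0p_S-p_b\|_{H^{1/2}(\Gamma)},\qquad \|u_S-u_\varepsilon\|_{H^1(\Omega)^n}\le c\,\|\gamma_0p_S-p_b\|_{H^{1/2}(\Gamma)}\quad\text{for all }\varepsilon>0.$$ In particular, if $\gamma_0p_S=p_b$, then $p_{PP}=p_\varepsilon=p_S$ for all $\varepsilon>0$.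
   Context: $L^2(\Omega)/\mathbb{R}:=\{q\in L^2(\Omega):\int_\Omega q=0\}$. $\gamma_0$ denotes the trace operator $H^1(\Omega)\to H^{1/2}(\Gamma)$ (applied componentwise to vector fields), and $H^{-1}(\Omega)=(H^1_0(\Omega))^*$. Problem (S): find $u_S\in H^1(\Omega)^n$, $p_S\in L^2(\Omega)/\mathbb{R}$ with $-\Delta u_S+\nabla p_S=F$ in $H^{-1}(\Omega)^n$, $\operatorname{div}u_S=0$ in $L^2(\Omega)$, $\gamma_0u_S=u_b$. In weak form, the first equation is $\int_\Omega\nabla u_S:\nabla\varphi-\int_\Omega p_S\operatorname{div}\varphi=\int_\Omega F\cdot\varphi$ for all $\varphi\in H^1_0(\Omega)^n$. Problem (PP): find $u_{PP}\in H^1(\Omega)^n$, $p_{PP}\in H^1(\Omega)$ with $-\Delta u_{PP}+\nabla p_{PP}=F$ in $H^{-1}(\Omega)^n$, $-\Delta p_{PP}=-\operatorname{div}F$ in $H^{-1}(\Omega)$, $\gamma_0u_{PP}=u_b$, $\gamma_0p_{PP}=p_b$. In weak form, the two equations are $\int_\Omega\nabla u_{PP}:\nabla\varphi+\int_\Omega\nabla p_{PP}\cdot\varphi=\int_\Omega F\cdot\varphi$ for all $\varphi\in H^1_0(\Omega)^n$ and $\int_\Omega\nabla p_{PP}\cdot\nabla\psi=\int_\Omega F\cdot\nabla\psi$ for all $\psi\in H^1_0(\Omega)$. Problem (ES), for $\varepsilon>0$: find $u_\varepsilon\in H^1(\Omega)^n$, $p_\varepsilon\in H^1(\Omega)$ with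 $-\Delta u_\varepsilon+\nabla p_\varepsilon=F$ in $H^{-1}(\Omega)^n$, $-\varepsilon\Delta p_\varepsilon+\operatorname{div}u_\varepsilon=-\varepsilon\operatorname{div}F$ in $H^{-1}(\Omega)$, $\gamma_0u_\varepsilon=u_b$, $\gamma_0p_\varepsilon=p_b$. In weak form, the two equations are $\int_\Omega\nabla u_\varepsilon:\nabla\varphi+\int_\Omega\nabla p_\varepsilon\cdot\varphi=\int_\Omega F\cdot\varphi$ for all $\varphi\in H^1_0(\Omega)^n$ and $\varepsilon\int_\Omega\nabla p_\varepsilon\cdot\nabla\psi+\int_\Omega(\operatorname{div}u_\varepsilon)\psi=\varepsilon\int_\Omega F\cdot\nabla\psi$ for all $\psi\in H^1_0(\Omega)$. Each of these problems has exactly one solution. *)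

(* Defs.v *)
From HB Require Import structures.
From mathcomp Require Import all_boot all_order all_algebra.
From mathcomp Require Import all_classical all_reals all_analysis.
Set Implicit Arguments.
Unset Strict Implicit.
Unset Printing Implicit Defensive.
Import Order.TTheory GRing.Theory Num.Theory.
Import numFieldNormedType.Exports.
Local Open Scope classical_set_scope.
Local Open Scope ring_scope.

(* The Borel sigma-algebra of R^n = 'rV[R]_n, presented, as the library does
   for tuples, as the sigma-algebra generated by the coordinates. *)
Fact rV_display : measure_display.
Proof. by constructor. Qed.

Section measurable_rV.
Context (R : realType) (n : nat).

Let coors : 'I_n -> 'rV[R]_n -> measurableTypeR R := fun i x => x ord0 i.

Let rV_set0 : g_sigma_preimage coors set0.
Proof. exact: sigma_algebra0. Qed.

Let rV_setC A : g_sigma_preimage coors A -> g_sigma_preimage coors (~` A).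
Proof. exact: sigma_algebraC. Qed.

Let rV_bigcup (F : _^nat) : (forall i, g_sigma_preimage coors (F i)) ->
  g_sigma_preimage coors (\bigcup_i (F i)).
Proof. exact: sigma_algebra_bigcup. Qed.

HB.instance Definition _ := @isMeasurable.Build rV_display
  'rV[R]_n (g_sigma_preimage coors) rV_set0 rV_setC rV_bigcup.

End measurable_rV.

Section lebesgue_rV.
Context (R : realType).

Lemma measurable_coord n (i : 'I_n) :
  measurable_fun setT (fun x : 'rV[R]_n => x ord0 i : measurableTypeR R).
Proof.
move=> _ Y mY; rewrite setTI; apply: sub_sigma_algebra => /=.
rewrite -bigcup_seq/=; exists i => /=; first by rewrite mem_index_enum.
by exists Y => //; rewrite setTI.
Qed.

Lemma measurable_fun_rVP d (T : measurableType d) n (f : T -> 'rV[R]_n) :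
  (forall i, measurable_fun setT (fun t => f t ord0 i : measurableTypeR R)) ->
  measurable_fun setT f.
Proof.
move=> mf; suff : g_sigma_preimage
    (fun i => (fun x : 'rV[R]_n => x ord0 i : measurableTypeR R) \o f)
    `<=` measurable.
  rewrite g_sigma_preimage_comp => prefS.
  by move=> _ A mA; apply: prefS; exists A.
apply: smallest_sub; first exact: sigma_algebra_measurable.
case: n => [|n] in f mf *; first by rewrite big_ord0.
rewrite -bigcup_mkord_ord; apply: bigcup_sub => i Ii.
by move=> A [B mB <-]; exact: mf.
Qed.

Definition rV_cons n (p : measurableTypeR R * 'rV[R]_n) : 'rV[R]_n.+1 :=
  row_mx (p.1)%:M p.2.

Definition rV_uncons n (x : 'rV[R]_n.+1) : measurableTypeR R * 'rV[R]_n :=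
  (x ord0 ord0, \row_i x ord0 (lift ord0 i)).

Lemma rV_consK n : cancel (@rV_cons n) (@rV_uncons n).
Proof.
move=> [t y]; rewrite /rV_cons /rV_uncons; congr pair => /=.
  transitivity (row_mx (t%:M : 'M[R]_1) y ord0 (lshift n ord0)).
    by congr (row_mx _ _ _ _); exact: val_inj.
  by rewrite row_mxEl mxE.
apply/rowP => i; rewrite mxE.
transitivity (row_mx (t%:M : 'M[R]_1) y ord0 (rshift 1 i)).
  by congr (row_mx _ _ _ _); exact: val_inj.
by rewrite row_mxEr.
Qed.

Lemma measurable_rV_cons n : measurable_fun setT (@rV_cons n).
Proof.
apply: measurable_fun_rVP => i; case: (@split_ordP 1 n i) => j ->.
  rewrite (_ : (fun _ => _) = fst); first exact: measurable_fst.
  apply/funext => p; apply: etrans (row_mxEl _ _ _ _) _.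
  by rewrite (ord1 j) mxE eqxx mulr1n.
rewrite (_ : (fun _ => _) = (fun x : 'rV[R]_n => x ord0 j) \o snd).
  2: by apply/funext => p; exact: row_mxEr.
by apply: measurableT_comp; [exact: measurable_coord|exact: measurable_snd].
Qed.

Lemma measurable_rV_uncons n : measurable_fun setT (@rV_uncons n).
Proof.
apply/measurable_fun_pairP; split; first exact: measurable_coord.
apply: measurable_fun_rVP => i.
by under eq_fun do rewrite mxE; exact: measurable_coord.
Qed.

Section step.
Context n (mu : {sigma_finite_measure set 'rV[R]_n -> \bar R}).

Definition lebesgue_rV_step : set 'rV[R]_n.+1 -> \bar R :=
  pushforward (lebesgue_measure \x mu)%E (@rV_cons n).

Let m0 : lebesgue_rV_step set0 = 0%E.
Proof. by rewrite /lebesgue_rV_step /pushforward preimage_set0 measure0. Qed.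

Let m_ge0 A : (0 <= lebesgue_rV_step A)%E.
Proof. by rewrite /lebesgue_rV_step /pushforward; exact: measure_ge0. Qed.

Let mpre A : measurable A -> measurable (@rV_cons n @^-1` A).
Proof. by move=> mA; rewrite -[X in measurable X]setTI; exact: measurable_rV_cons. Qed.

Let m_sigma : semi_sigma_additive lebesgue_rV_step.
Proof.
move=> F mF tF mUF; rewrite /lebesgue_rV_step /pushforward preimage_bigcup.
apply: measure_semi_sigma_additive.
- by move=> k; exact: mpre.
- apply/trivIsetP => /= i j _ _ ij; rewrite -preimage_setI.
  by move/trivIsetP : tF => /(_ _ _ _ _ ij) ->//; rewrite preimage_set0.
- by rewrite -preimage_bigcup; exact: mpre.
Qed.

HB.instance Definition _ := isMeasure.Build _ _ _ lebesgue_rV_step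
  m0 m_ge0 m_sigma.

Let sigma_finite_step : sigma_finite setT lebesgue_rV_step.
Proof.
have /sigma_finiteP[F [TF ndF Foo]] := sigma_finiteT (@lebesgue_measure R).
have /sigma_finiteP[G [TG ndG Goo]] := sigma_finiteT mu.
exists (fun k => @rV_uncons n @^-1` (F k `*` G k)).
  rewrite -preimage_bigcup (_ : \bigcup_i _ = setT) ?preimage_setT//.
  rewrite -subTset => -[x y] _.
  have [i _ Fix] : (\bigcup_i F i) x by rewrite -TF.
  have [j _ Gjy] : (\bigcup_i G i) y by rewrite -TG.
  exists (maxn i j) => //; split => /=.
    by move: x Fix; exact/subsetPset/ndF/leq_maxl.
  by move: y Gjy; exact/subsetPset/ndG/leq_maxr.
move=> k; have [mF Fk] := Foo k; have [mG Gk] := Goo k.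
have mFG : measurable (F k `*` G k : set (measurableTypeR R * 'rV[R]_n)).
  exact: measurableX.
split; first by rewrite -[X in measurable X]setTI; exact: measurable_rV_uncons.
rewrite /lebesgue_rV_step /pushforward -comp_preimage.
rewrite (_ : _ \o _ = id); last by apply/funext => p; exact: rV_consK.
by rewrite preimage_id product_measure1E// lte_mul_pinfty// ge0_fin_numE.
Qed.

HB.instance Definition _ := @Measure_isSigmaFinite.Build _ _ _
  lebesgue_rV_step sigma_finite_step.

End step.

Fixpoint lebesgue_rV n : {sigma_finite_measure set 'rV[R]_n -> \bar R} :=
  if n is m.+1 then lebesgue_rV_step (lebesgue_rV m)
  else \d_(0 : 'rV[R]_0).

End lebesgue_rV.

Section euclidean.
Context (R : realType) (n : nat).
Implicit Types (x y : 'rV[R]_n) (E : set 'rV[R]_n).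

(* The norm `|x| of the library on 'rV[R]_n is the sup norm. *)
Definition dotp x y : R := \sum_i x ord0 i * y ord0 i.
Definition enorm x : R := Num.sqrt (dotp x x).

Definition ediam E : R := sup [set enorm (x - y) | x in E & y in E].

End euclidean.

Section hausdorff_measure.
Context (R : realType) (n : nat).
Local Notation Rn := 'rV[R]_n.
Implicit Types (x y : Rn) (A E : set Rn) (s : nat) (d : R).

(* The normalization that makes the s-dimensional Hausdorff measure agree with
   the s-dimensional area of smooth or Lipschitz surfaces. *)
Definition unit_ball_volume s : R :=
  fine (lebesgue_rV R s [set x | enorm x <= 1]).

Definition hausdorff_gauge s E : \bar R :=
  if E == set0 then 0%E else (unit_ball_volume s * (ediam E / 2) ^+ s)%:E.

Definition hausdorff_cover d A : set ((set Rn)^nat) :=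
  [set F | A `<=` \bigcup_k F k /\
    forall k x y, F k x -> F k y -> enorm (x - y) <= d].

Definition hausdorff_pre s d A : \bar R :=
  ereal_inf [set \sum_(k <oo) hausdorff_gauge s (F k)
            | F in hausdorff_cover d A]%E.

Definition hausdorff s A : \bar R :=
  ereal_sup [set hausdorff_pre s d A | d in [set d | 0 < d]].

Lemma hausdorff_gauge_ge0 s E : (0 <= hausdorff_gauge s E)%E.
Proof.
rewrite /hausdorff_gauge; case: ifPn => // E0.
rewrite lee_fin mulr_ge0//; first by rewrite fine_ge0.
rewrite exprn_ge0// divr_ge0//.
rewrite /ediam; set D := (X in sup X).
have [supD|/sup_out ->//] := pselect (has_sup D).
have [[r Dr] _] := supD; apply: (@le_trans _ _ r); last first.
  by apply: ub_le_sup => //; exact: supD.2.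
by case: Dr => x _ [y _ <-]; exact: sqrtr_ge0.
Qed.

Lemma hausdorff_pre_ge0 s d A : (0 <= hausdorff_pre s d A)%E.
Proof.
apply: le_ereal_inf_tmp => _ [F _ <-].
by apply: nneseries_ge0 => k _ _; exact: hausdorff_gauge_ge0.
Qed.

Lemma le_hausdorff_pre s d A B :
  A `<=` B -> (hausdorff_pre s d A <= hausdorff_pre s d B)%E.
Proof.
move=> AB; apply: ereal_inf_le_tmp => _ [F [BF dF] <-].
by exists F => //; split => //; exact: subset_trans BF.
Qed.

Lemma hausdorff_pre_sigma_subadditive s d :
  sigma_subadditive (hausdorff_pre s d).
Proof.
move=> A; have [[i ioo]|] := pselect (exists i, hausdorff_pre s d (A i) = +oo%E).
  rewrite (eseries_pinfty _ _ ioo) ?leey// => k _.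
  by rewrite -ltNye (lt_le_trans _ (hausdorff_pre_ge0 _ _ _)).
rewrite -forallNE => Aoo.
suff add2e (e : {posnum R}) : (hausdorff_pre s d (\bigcup_k A k) <=
    \sum_(i <oo) hausdorff_pre s d (A i) + e%:num%:E)%E.
  by apply/lee_addgt0Pr => _/posnumP[].
rewrite (le_trans _ (epsilon_trick _ _ _))//; last first.
  by move=> k; exact: hausdorff_pre_ge0.
pose P k (B : (set Rn)^nat) := hausdorff_cover d (A k) B /\
  (\sum_(j <oo) hausdorff_gauge s (B j) <=
   hausdorff_pre s d (A k) + (e%:num / (2 ^ k.+1)%:R)%:E)%E.
have [G PG] : {G : ((set Rn)^nat)^nat & forall k, P k (G k)}.
  apply: (@choice _ _ P) => k; rewrite /P /hausdorff_pre.
  set S := (X in ereal_inf X); move infS : (ereal_inf S) => iS.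
  case: iS infS => [r Sr|Soo|Soo].
  - have en1 : (0 < e%:num / (2 ^ k.+1)%:R)%R by [].
    have /(lb_ereal_inf_adherent en1) : ereal_inf S \is a fin_num by rewrite Sr.
    move=> [x [B cB muBx] xS].
    by exists B; split => //; rewrite muBx -Sr; exact/ltW.
  - by have := Aoo k; rewrite /hausdorff_pre Soo.
  - suff : lbound S 0%E by move/le_ereal_inf_tmp; rewrite Soo.
    move=> /= _ [B _ <-].
    by apply: nneseries_ge0 => j _ _; exact: hausdorff_gauge_ge0.
have muG_ge0 p : (0 <= (hausdorff_gauge s \o uncurry G) p)%E.
  exact: hausdorff_gauge_ge0.
apply: (@le_trans _ _
    (\esum_(i in setT) (hausdorff_gauge s \o uncurry G) i)%E).
  apply: ereal_inf_lbound => /=.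
  have /card_esym/ppcard_eqP[f] := card_nat2.
  exists (uncurry G \o f).
    split => [|k x y]; last first.
      by rewrite /= /uncurry; case: (f k) => a b; exact: (PG a).1.2.
    apply: (@subset_trans _  (\bigcup_a \bigcup_b G a b)) => [t [i _]|].
      by move=> /((PG i).1.1) -[j _ ?]; exists i => //; exists j.
    move=> t [i _ [j _ Bijt]]; exists (f^-1%FUN (i, j)) => //=.
    by rewrite invK ?inE.
  rewrite -(esum_pred_image (hausdorff_gauge s \o uncurry G) _ xpredT)
    ?[fun=> _]set_true//.
  by rewrite image_eq.
rewrite (_ : esum _ _ =
    \sum_(i <oo) \sum_(j <oo) hausdorff_gauge s (G i j))%E; last first.
  pose J : nat -> set (nat * nat) := fun i => [set (i, j) | j in setT].
  rewrite (_ : setT = \bigcup_k J k); last first.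
    by rewrite predeqE => -[a b]; split => // _; exists a => //; exists b.
  rewrite esum_bigcupT /=; last 2 first.
    - apply/trivIsetP => i j _ _ ij.
      rewrite predeqE => -[a b] /=; split => //= -[] [_] _ [<-{a} _].
      by move=> [m' _] [] /esym/eqP; rewrite (negbTE ij).
    - by move=> /= [a b]; exact: (muG_ge0 (a, b)).
  rewrite -(image_id [set: nat]) -fun_true esum_pred_image//; last first.
    by move=> a _; apply: esum_ge0 => b _; exact: muG_ge0.
  apply: eq_eseriesr => /= j _.
  rewrite -(esum_pred_image (hausdorff_gauge s \o uncurry G) (pair j) predT)//=;
    last 2 first.
    by move=> b _; exact: (muG_ge0 (j, b)).
    by move=> ? ? _ _; exact: (@can_inj _ _ _ snd).
  by congr esum; rewrite predeqE => -[a b]; split; move=> [i _ <-]; exists i.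
apply: lee_nneseries.
- by move=> i _ _; apply: nneseries_ge0 => j _ _; exact: hausdorff_gauge_ge0.
- by move=> k _; exact: (PG k).2.
Qed.

Let hausdorff0 s : hausdorff s set0 = 0%E.
Proof.
have pre0 d : hausdorff_pre s d set0 = 0%E.
  apply/eqP; rewrite eq_le hausdorff_pre_ge0 andbT.
  apply: ereal_inf_lbound; exists (fun=> set0); first by split.
  by apply: eseries0 => k _ _; rewrite /hausdorff_gauge eqxx.
rewrite /hausdorff (_ : image _ _ = [set 0%E]) ?ereal_sup1//.
rewrite predeqE => x; split => [[d _ <-]|->]; first exact: pre0.
by exists 1 => //=; exact: ltr01.
Qed.

Let hausdorff_ge0 s A : (0 <= hausdorff s A)%E.
Proof.
apply: le_trans (hausdorff_pre_ge0 s 1 A) _.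
by apply: ereal_sup_ubound; exists 1 => //=; exact: ltr01.
Qed.

Let le_hausdorff s : {homo hausdorff s : A B / A `<=` B >-> (A <= B)%E}.
Proof.
move=> A B AB; apply: ge_ereal_sup => _ [d d0 <-].
apply: le_trans (le_hausdorff_pre s d AB) _.
by apply: ereal_sup_ubound; exists d.
Qed.

Let hausdorff_sigma_subadditive s : sigma_subadditive (hausdorff s).
Proof.
move=> F; apply: ge_ereal_sup => _ [d d0 <-].
apply: le_trans (hausdorff_pre_sigma_subadditive s d F) _.
apply: lee_nneseries => [i _ _|i _]; first exact: hausdorff_pre_ge0.
by apply: ereal_sup_ubound; exists d.
Qed.

HB.instance Definition _ s := isOuterMeasure.Build R Rn (hausdorff s)
  (hausdorff0 s) (hausdorff_ge0 s) (@le_hausdorff s)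
  (@hausdorff_sigma_subadditive s).

End hausdorff_measure.

Section domain.
Context (R : realType) (n : nat).
Local Notation Rn := 'rV[R]_n.
Implicit Types (Om : set Rn) (x y : Rn).

Definition boundary Om : set Rn := closure Om `\` interior Om.

(* Near each boundary point, Om is the part lying above the graph, in some
   unit direction e, of a Lipschitz function on the hyperplane orthogonal to e;
   y - (y . e) e is the projection of y on that hyperplane. *)
Definition lipschitz_boundary Om : Prop :=
  forall x, boundary Om x -> exists (e : Rn) (g : Rn -> R) (L r : R),
    [/\ enorm e = 1, 0 < r,
        forall y z, `|g y - g z| <= L * enorm (y - z) &
        forall y, enorm (y - x) < r ->
          (Om y <-> g (y - dotp y e *: e) < dotp y e)].

Definition lipschitz_domain Om : Prop :=
  [/\ open Om, connected Om, Om !=set0, bounded_set Om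
    & lipschitz_boundary Om].

Definition hausdorff_outer (s : nat) : {outer_measure set Rn -> \bar R} :=
  @hausdorff R n s.

Definition surface_type := caratheodory_type (hausdorff_outer n.-1).

Definition surface_measure : {measure set surface_type -> \bar R} :=
  hausdorff_outer n.-1.

(* v is the unit normal at x of a tangent hyperplane to the boundary of Om,
   and Om lies on the side of -v. On a Lipschitz boundary, such a v exists at
   almost every point. *)
Definition is_outward_normal Om x (v : Rn) : Prop :=
  enorm v = 1 /\
  forall eta : R, 0 < eta -> exists2 r : R, 0 < r &
    forall y, enorm (y - x) < r ->
      (dotp (y - x) v < - (eta * enorm (y - x)) -> Om y) /\
      (eta * enorm (y - x) < dotp (y - x) v -> ~ Om y).

Definition outward_normal Om x : Rn := xget 0 [set v | is_outward_normal Om x v].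

End domain.

Definition square_integrable d (T : measurableType d) (R : realType)
    (mu : {measure set T -> \bar R}) (D : set T) (f : T -> R) : Prop :=
  measurable_fun D f /\ mu.-integrable D (fun x => (f x ^+ 2)%:E).

Section sobolev.
Context (R : realType) (n : nat).
Local Notation Rn := 'rV[R]_n.
Local Notation leb := (lebesgue_rV R n).
Local Notation surf := (surface_measure R n).
Variable Om : set Rn.
Implicit Types (v w q : Rn -> R) (u : 'I_n -> Rn -> R).

Definition partial (i : 'I_n) (f : Rn -> R) : Rn -> R :=
  fun x => 'D_(delta_mx ord0 i) f x.

Fixpoint Ck (k : nat) (f : Rn -> R) : Prop :=
  if k is m.+1 then
    (forall i x, derivable f x (delta_mx ord0 i)) /\
    (forall i, Ck m (partial i f))
  else continuous f.

Definition smooth (f : Rn -> R) : Prop := forall k, Ck k f.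

Definition test_function (phi : Rn -> R) : Prop :=
  smooth phi /\ exists K : set Rn,
    [/\ compact K, K `<=` Om & forall x, ~ K x -> phi x = 0].

Definition L2 v : Prop := square_integrable leb Om v.

Definition is_weak_partial (i : 'I_n) v w : Prop :=
  forall phi, test_function phi ->
    \int[leb]_(x in Om) (v x * partial i phi x) =
    - \int[leb]_(x in Om) (w x * phi x).

Definition H1 v : Prop :=
  L2 v /\ forall i, exists2 w, L2 w & is_weak_partial i v w.

(* Only meaningful on H1, where it is determined almost everywhere. *)
Definition wpartial (i : 'I_n) v : Rn -> R :=
  xget (fun=> 0) [set w | L2 w /\ is_weak_partial i v w].

Definition H1norm v : R :=
  Num.sqrt (\int[leb]_(x in Om) (v x ^+ 2) +
            \sum_i \int[leb]_(x in Om) (wpartial i v x ^+ 2)).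

Definition H1norm_vec u : R := Num.sqrt (\sum_i H1norm (u i) ^+ 2).

Definition H10 v : Prop :=
  H1 v /\ forall e : R, 0 < e ->
    exists2 phi, test_function phi & H1norm (v \- phi) < e.

Definition L2_boundary (g : Rn -> R) : Prop :=
  square_integrable surf (boundary Om) (g : surface_type R n -> R).

(* The graph of the trace operator: the extension by continuity, from H1(Om)
   to L2 of the boundary, of the restriction to the boundary of the functions
   that are smooth up to the boundary. *)
Definition is_trace v (g : Rn -> R) : Prop :=
  [/\ H1 v, L2_boundary g & forall e : R, 0 < e -> exists phi,
    [/\ smooth phi, H1norm (v \- phi) < e &
      (\int[surf]_(x in boundary Om) (((phi x - g x) ^+ 2)%:E) < e%:E)%E]].

(* H^(1/2) of the boundary is the range of the trace operator, with the
   quotient norm. *)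
Definition H12 (g : Rn -> R) : Prop := exists v, is_trace v g.

Definition H12norm (g : Rn -> R) : R :=
  inf [set H1norm v | v in [set v | is_trace v g]].

Definition divergence u : Rn -> R := fun x => \sum_i wpartial i (u i) x.

Definition dirichlet v w : R :=
  \int[leb]_(x in Om) (\sum_j wpartial j v x * wpartial j w x).

Definition stokes_solution (F : 'I_n -> Rn -> R) (ub : 'I_n -> Rn -> R) u q :
    Prop :=
  [/\ (forall i, H1 (u i)) /\
      (L2 q /\ \int[leb]_(x in Om) q x = 0),
      forall phi : 'I_n -> Rn -> R, (forall i, H10 (phi i)) ->
        \sum_i dirichlet (u i) (phi i)
        - \int[leb]_(x in Om) (q x * divergence phi x)
        = \int[leb]_(x in Om) (\sum_i F i x * phi i x),
      {ae leb, forall x, Om x -> divergence u x = 0} &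
      forall i, is_trace (u i) (ub i)].

Definition pressure_poisson_solution (F : 'I_n -> Rn -> R)
    (ub : 'I_n -> Rn -> R) (pb : Rn -> R) u q : Prop :=
  [/\ (forall i, H1 (u i)) /\ H1 q,
      forall phi : 'I_n -> Rn -> R, (forall i, H10 (phi i)) ->
        \sum_i dirichlet (u i) (phi i)
        + \int[leb]_(x in Om) (\sum_i wpartial i q x * phi i x)
        = \int[leb]_(x in Om) (\sum_i F i x * phi i x),
      forall psi, H10 psi ->
        dirichlet q psi
        = \int[leb]_(x in Om) (\sum_i F i x * wpartial i psi x),
      forall i, is_trace (u i) (ub i) & is_trace q pb].

Definition eps_stokes_solution (eps : R) (F : 'I_n -> Rn -> R)
    (ub : 'I_n -> Rn -> R) (pb : Rn -> R) u q : Prop :=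
  [/\ (forall i, H1 (u i)) /\ H1 q,
      forall phi : 'I_n -> Rn -> R, (forall i, H10 (phi i)) ->
        \sum_i dirichlet (u i) (phi i)
        + \int[leb]_(x in Om) (\sum_i wpartial i q x * phi i x)
        = \int[leb]_(x in Om) (\sum_i F i x * phi i x),
      forall psi, H10 psi ->
        eps * dirichlet q psi + \int[leb]_(x in Om) (divergence u x * psi x)
        = eps * \int[leb]_(x in Om) (\sum_i F i x * wpartial i psi x),
      forall i, is_trace (u i) (ub i) & is_trace q pb].

End sobolev.

(* Main.v *)
Require Import Defs.
From HB Require Import structures.
From mathcomp Require Import all_boot all_order all_algebra.
From mathcomp Require Import all_classical all_reals all_analysis.
From mathcomp Require Import measurable_realfun.
From mathcomp Require Import zify ring lra.
Set Implicit Arguments.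
Unset Strict Implicit.
Unset Printing Implicit Defensive.
Import Order.TTheory GRing.Theory Num.Theory.
Import numFieldNormedType.Exports.
Local Open Scope classical_set_scope.
Local Open Scope ring_scope.

(* Testing the Stokes problem with gradients shows that pS solves the same
   Poisson equation as pPP, so q = pS - pPP is weakly harmonic, with trace
   gS - pb.  By Dirichlet's principle |grad q| <= |grad v| in L2 for every v with
   that trace, hence |grad q| <= H12norm (gS - pb).  The difference w = uS - uPP
   has trace zero and |grad w|^2 = - \int grad q . w, and Poincare's inequality
   concludes.  For the eps-problem, w = uS - ueps and z = (pS - peps) - q satisfy
   |grad w|^2 + eps |grad z|^2 = - \int grad q . w, whence the same constant.
   What the definition of the trace does not give for free is that a function
   with zero trace lies in H10: on the collar of width d of the boundary, every
   smooth f satisfies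
     \int f^2 <= C d \int_boundary f^2 + C d^2 \int |grad f|^2
   (integrate along the direction of a Lipschitz chart, and compare Lebesgue
   measure on tubes with the Hausdorff measure of their base), so cutting f off
   near the boundary costs little when its boundary values are small. *)

(** * Lebesgue measure on R^n *)

Section rV_measure.
Context {R : realType}.
Local Notation leb n := (lebesgue_rV R n).
Local Notation leb1 := (@lebesgue_measure R).

(** Uniformity in eps is a matter of sign. Here z = pPP - peps, and testing with z gives eps |grad
    z|^2 = \int grad z . w, because q is orthogonal to z and div uS = 0. For psi in H10 the field
    grad psi need not be an admissible test field, so the Poisson equation of pS is first obtained
    for test functions and then extended by density. Weak derivatives are chosen representatives,
    linear only almost everywhere. The fundamental lemma of the calculus of variations provides this
    linearity, after which all computations go through bilinear forms. For zero traces the powers of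
    d decide: a cutoff at scale d costs d^-2 times the mass of f^2 on the collar. The collar
    estimate returns d^2 in front of the gradient, whose integral over the shrinking collar tends to
    0, and d in front of the boundary integral, which is made small after d has been fixed. *)

Lemma rV_ballP n (x y : 'rV[R]_n) (e : R) :
  0 < e -> ball x e y <-> forall i, `|x ord0 i - y ord0 i| < e.
Proof.
move=> e0; split=> [[_ h] i|h]; first exact: h.
by split => // i j; rewrite (ord1 i); exact: h.
Qed.

Lemma coord_le_norm n (x : 'rV[R]_n) i : `|x ord0 i| <= `|x|.
Proof.
by rewrite [leRHS]/Num.Def.normr /= mx_normrE; apply/bigmax_geP; right => /=; exists (ord0, i).
Qed.

Lemma norm_le_coord n (x : 'rV[R]_n) (c : R) :
  0 <= c -> (forall i, `|x ord0 i| <= c) -> `|x| <= c.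
Proof.
move=> c0 h; rewrite [leLHS]/Num.Def.normr /= mx_normrE; apply/bigmax_leP; split => //.
by move=> [i j] _ /=; rewrite (ord1 i).
Qed.

Lemma measurable_rV_ball n (x : 'rV[R]_n) (e : R) : measurable (ball x e).
Proof.
have [e0|e0] := ltP 0 e; last first.
  rewrite (_ : ball x e = set0) ?measurable0// -subset0 => y [].
  by rewrite ltNge e0.
rewrite (_ : ball x e = \bigcap_(i in [set: 'I_n]) 
   ((fun y : 'rV[R]_n => y ord0 i : measurableTypeR R) @^-1` ball (x ord0 i) e)).
  apply: fin_bigcap_measurable => // i _.
  rewrite -[X in measurable X]setTI.
  by apply: measurable_coord => //; exact: measurable_ball.
apply/seteqP; split => y; first by move=> /rV_ballP h i _; exact: h.
by move=> h; apply/rV_ballP => // i; exact: h.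
Qed.

Lemma rV_rat_approx n (x : 'rV[R]_n) (e : R) : 0 < e ->
  exists q : 'rV[rat]_n, ball (map_mx (@ratr R) q : 'rV[R]_n) e x.
Proof.
move=> e0; have h i : exists q : rat, `|ratr q - x ord0 i| < e.
  have [q] := @rat_in_itvoo R (x ord0 i - e) (x ord0 i + e) ltac:(lra).
  by rewrite in_itv /= => /andP[h1 h2]; exists q; rewrite ltr_norml; lra.
have [q hq] := choice h.
exists (\row_i q i); apply/rV_ballP => // i.
by rewrite !mxE.
Qed.

(** The sigma-algebra is generated by the coordinates and sup-norm balls are boxes; U is the
    countable union of the balls with rational centre and radius 1/(k+1) that it contains. *)
Lemma open_measurable_rV n (U : set 'rV[R]_n) : open U -> measurable U.
Proof.
move=> oU.
rewrite (_ : U = \bigcup_(p : 'rV[rat]_n * nat)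
   (if `[< ball (map_mx (@ratr R) p.1 : 'rV[R]_n) (p.2.+1%:R^-1 : R) `<=` U >]
    then ball (map_mx (@ratr R) p.1 : 'rV[R]_n) (p.2.+1%:R^-1 : R) else set0)).
  apply: countable_bigcupT_measurable; first exact: countableP.
  by move=> p; case: ifP => // _; exact: measurable_rV_ball.
apply/seteqP; split => [x Ux|x [p _]]; last by case: asboolP => // h /h.
have /nbhs_ballP[e/= e0 he] : nbhs x U by exact: open_nbhs_nbhs.
(* With a radius below e / 2, a rational ball that contains x stays inside the e-ball of x. *)
have [k hk] : exists k : nat, (k.+1%:R^-1 : R) < e / 2.
  have [k _ hk] := near_infty_natSinv_lt (PosNum (divr_gt0 e0 (@ltr0Sn R 1))).
  by exists k; apply: (hk k); exact: leqnn.
have k0 : 0 < (k.+1%:R^-1 : R) by rewrite invr_gt0.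
have [q hq] := rV_rat_approx x k0.
exists (q, k) => //=; rewrite asboolT//.
move=> y /(rV_ballP _ _ k0) hy; apply: he; apply/rV_ballP => // i.
move/(rV_ballP _ _ k0): hq => /(_ i) hq; have := hy i => hy'.
move: hq hy'; rewrite !ltr_norml => /andP[h1 h2] /andP[h3 h4].
move: h1 h2 h3 h4 hk; move: (map_mx _ _ _ _) (x _ _) (y _ _) (_^-1) => a b c d.
by move=> h1 h2 h3 h4 hk; apply/andP; split; lra.
Qed.

Lemma continuous_measurable_rV n (f : 'rV[R]_n -> R) :
  continuous f -> measurable_fun setT (f : _ -> measurableTypeR R).
Proof.
move=> cf; apply: (measurability _ (RGenOInfty.measurableE R)).
move=> _ [_ [a ->] <-]; rewrite setTI; apply: open_measurable_rV.
by move/continuousP: cf; apply; exact: interval_open.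
Qed.

Lemma measurable_rV_shift n (c : 'rV[R]_n) :
  measurable_fun setT (fun x : 'rV[R]_n => x + c).
Proof.
apply: measurable_fun_rVP => i.
rewrite (_ : (fun _ => _) = (fun x : 'rV[R]_n => x ord0 i + c ord0 i)); last first.
  by apply/funext => x; rewrite mxE.
by apply: measurable_funD => //; exact: measurable_coord.
Qed.

(** Translation preserves the length of half-open intervals, and these determine the measure. *)
Lemma lebesgue_measure_shift (c : R) (A : set (measurableTypeR R)) : measurable A ->
  leb1 ((fun x => x + c) @^-1` A) = leb1 A.
Proof.
move=> mA; apply/esym.
have mf : measurable_fun setT (fun x : measurableTypeR R => x + c : measurableTypeR R).
  by apply: measurable_funD => //; exact: measurable_id.
pose f : {mfun _ >-> _} := HB.pack (fun x : measurableTypeR R => x + c : measurableTypeR R)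
  (isMeasurableFun.Build _ _ _ _ _ mf).
apply: (@lebesgue_measure_unique R (pushforward leb1 f)) => // X [[a b] _ <-].
transitivity (leb1 `](a : R) - c, (b : R) - c]%classic).
  by rewrite !lebesgue_measure_itv /= !lte_fin ltrD2r; case: ifP => // _; congr EFin; ring.
transitivity (leb1 ((fun x : R => x + c) @^-1` `]a, b]%classic)); last by [].
congr (leb1 _); apply/seteqP; split => x /=; rewrite !in_itv /= => /andP[h1 h2]; apply/andP; split; lra.
Qed.

Lemma rV_unconsK n : cancel (@rV_uncons R n) (@rV_cons R n).
Proof.
move=> x; apply/rowP => i; rewrite /rV_cons /rV_uncons /=.
case: (@split_ordP 1 n i) => j ->; first by
  apply: etrans (row_mxEl _ _ _ _) _; rewrite (ord1 j) mxE eqxx mulr1n; congr (x _ _); exact: val_inj.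
by apply: etrans (row_mxEr _ _ _ _) _; rewrite mxE; congr (x _ _); exact: val_inj.
Qed.

Lemma rV_cons0 n (s : R) (x : 'rV[R]_n) :
  rV_cons (s : measurableTypeR R, x) ord0 ord0 = s.
Proof. exact: (congr1 fst (rV_consK (s : measurableTypeR R, x))). Qed.

Lemma rV_cons_lift n (s : R) (x : 'rV[R]_n) i :
  rV_cons (s : measurableTypeR R, x) ord0 (lift ord0 i) = x ord0 i.
Proof.
have := congr1 snd (rV_consK (s : measurableTypeR R, x)).
by move=> /rowP/(_ i); rewrite mxE.
Qed.

Lemma rV_consD n (s t : R) (x y : 'rV[R]_n) :
  rV_cons (s : measurableTypeR R, x) + rV_cons (t : measurableTypeR R, y) =
  rV_cons (s + t : measurableTypeR R, x + y).
Proof.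
apply: (can_inj (@rV_unconsK n)); rewrite rV_consK /rV_uncons.
congr pair; first by rewrite mxE !rV_cons0.
by apply/rowP => i; rewrite mxE [LHS]mxE [RHS]mxE !rV_cons_lift.
Qed.

(** Induction on the dimension: the section at t of the shifted set is the shift by [c'] of the
    section of A at t plus the first coordinate of c. What remains is a one-dimensional shift of the
    outer integral. *)
Lemma lebesgue_rV_shift n (c : 'rV[R]_n) (A : set 'rV[R]_n) : measurable A ->
  leb n ((fun x => x + c) @^-1` A) = leb n A.
Proof.
elim: n c A => [|n IH] c A mA.
  by congr (leb 0 _); apply/seteqP; split => x /=; rewrite [x + c]thinmx0 [x]thinmx0.
rewrite /= /lebesgue_rV_step /pushforward.
have mpre B : measurable B -> measurable (@rV_cons R n @^-1` B).
  by move=> mB; rewrite -[X in measurable X]setTI; exact: measurable_rV_cons.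
set c' : 'rV[R]_n := \row_i c ord0 (lift ord0 i).
pose h (t : measurableTypeR R) := leb n (xsection (@rV_cons R n @^-1` A) t).
have mh : measurable_fun setT h.
  by apply: measurable_fun_xsection; exact: mpre.
have cE : c = rV_cons (c ord0 ord0 : measurableTypeR R, c').
  by rewrite -[LHS]rV_unconsK.
transitivity (\int[leb1]_t h ((t : R) + c ord0 ord0)%R)%E.
  apply: eq_integral => t _; rewrite /h /= -(IH c' (xsection _ (_ + _))); last first.
    by apply: measurable_xsection; exact: mpre.
  congr (leb n _); apply/seteqP; split => y /=; rewrite /xsection /= !inE /= => h1;
    have := rV_consD t (c ord0 ord0) y c'; rewrite -cE => E;
    by [rewrite /= -E|rewrite /= E].
have mf : measurable_fun setT (fun x : measurableTypeR R => x + c ord0 ord0 : measurableTypeR R).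
  by apply: measurable_funD => //; exact: measurable_id.
pose f : {mfun _ >-> _} := HB.pack (fun x : measurableTypeR R => x + c ord0 ord0 : measurableTypeR R)
  (isMeasurableFun.Build _ _ _ _ _ mf).
have := @ge0_integral_pushforward _ _ _ _ R f mf leb1 setT h measurableT mh.
rewrite preimage_setT /= => <-; last by move=> y _; exact: measure_ge0.
apply: eq_measure_integral => B mB _.
by apply/lebesgue_measure_shift.
Qed.

Lemma lebesgue_rV_ball n (x : 'rV[R]_n) (e : R) : 0 < e ->
  leb n (ball x e) = ((e *+ 2) ^+ n)%:E.
Proof.
move=> e0; elim: n x => [|n IH] x.
  rewrite expr0 /= /dirac indicE mem_set//.
  by apply/rV_ballP => // -[].
rewrite /= /lebesgue_rV_step /pushforward.
rewrite (_ : _ @^-1` _ = ball (x ord0 ord0) e `*` ball (\row_i x ord0 (lift ord0 i)) e).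
  rewrite product_measure1E; last 2 first.
    exact: measurable_ball.
    exact: measurable_rV_ball.
  rewrite exprS EFinM; congr (_ * _)%E; last exact: IH.
  exact: lebesgue_measure_ball (ltW e0).
apply/seteqP; split => -[t y] /=; rewrite rV_ballP//.
  move=> h; split; first by have := h ord0; rewrite rV_cons0.
  by apply/rV_ballP => // i; have := h (lift ord0 i); rewrite rV_cons_lift mxE.
move=> [h1 h2]; apply/rV_ballP => // i; have [j ->|->] := unliftP ord0 i.
  by rewrite rV_cons_lift; have := h2 j; rewrite mxE.
by rewrite rV_cons0.
Qed.

Lemma lebesgue_rV_bounded n (A : set 'rV[R]_n) : measurable A -> bounded_set A ->
  (leb n A < +oo)%E.
Proof.
move=> mA bA; have [M M0 hM] : exists2 M, 0 < M & forall x, A x -> `|x| <= M.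
  exact: (pinfty_ex_gt0 bA).
pose e := M + 1; have e0 : 0 < e by rewrite addr_gt0.
have Ae : A `<=` ball 0 e.
  by move=> x /hM xM; rewrite -ball_normE /= sub0r normrN (le_lt_trans xM)// ltrDl.
apply: (@le_lt_trans _ _ (leb n (ball 0 e))); last by rewrite lebesgue_rV_ball// ltry.
by apply: le_measure; rewrite ?inE//; exact: measurable_rV_ball.
Qed.

Lemma ge0_integral_shift n (c : 'rV[R]_n) (f : 'rV[R]_n -> \bar R) :
  measurable_fun setT f -> (forall x, 0 <= f x)%E ->
  (\int[leb n]_x f ((x : 'rV[R]_n) + c)%R = \int[leb n]_x f x)%E.
Proof.
move=> mf f0.
have := @ge0_integral_pushforward _ _ _ _ R _ (@measurable_rV_shift n c) (leb n) setT f measurableT mf.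
rewrite preimage_setT /= => <-; last by [].
by apply: eq_measure_integral => [|mS B mB _]; [exact: measurable_rV_shift|exact: (lebesgue_rV_shift c mB)].
Qed.

Lemma Rintegral_shift n (c : 'rV[R]_n) (f : 'rV[R]_n -> R) :
  measurable_fun setT f -> \int[leb n]_x f (x + c) = \int[leb n]_x f x.
Proof.
move=> mf; rewrite /Rintegral; congr fine.
rewrite integralE [RHS]integralE; congr (_ - _)%E.
- apply: (etrans _ (ge0_integral_shift c (f := (EFin \o f)^\+%E) _ _)) => //; last first.
  by apply: measurable_funepos; exact/measurable_EFinP.
  by apply: eq_integral => x _; rewrite !funeposE.
- apply: (etrans _ (ge0_integral_shift c (f := (EFin \o f)^\-%E) _ _)) => //; last first.
  by apply: measurable_funeneg; exact/measurable_EFinP.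
  by apply: eq_integral => x _; rewrite !funenegE.
Qed.
End rV_measure.

(** * Smooth functions *)

Section line_derivative.
Context {R : realType} {V : normedModType R}.
Implicit Types (f : V -> R) (x v : V).

Lemma derivable_shift f c x v :
  derivable (fun y => f (y + c)) x v <-> derivable f (x + c) v.
Proof.
rewrite /derivable (_ : (fun h : R => _) =
  (fun h : R => h^-1 *: ((f \o shift (x + c)) (h *: v) - f (x + c))))//.
by apply/funext => h /=; rewrite addrA.
Qed.

Lemma derive_shift f c x v : 'D_v (fun y => f (y + c)) x = 'D_v f (x + c).
Proof.
rewrite /derive (_ : (fun h : R => _) =
  (fun h : R => h^-1 *: ((f \o shift (x + c)) (h *: v) - f (x + c))))//.
by apply/funext => h /=; rewrite addrA.
Qed.

Lemma is_derive_line f x v (u : R) : derivable f (x + u *: v) v ->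
  is_derive u 1 (fun u : R => f (x + u *: v)) ('D_v f (x + u *: v)).
Proof.
move=> df.
have E : (fun h : R => h^-1 *: (((fun u : R => f (x + u *: v)) \o shift u) (h *: 1) -
    f (x + u *: v))) =
  (fun h : R => h^-1 *: ((f \o shift (x + u *: v)) (h *: v) - f (x + u *: v))).
  apply/funext => h /=; congr (_ *: (f _ - _)).
  by rewrite [h *: 1]mulr1 scalerDl addrCA addrC -addrA.
by split; rewrite /derivable /derive E.
Qed.

Lemma mvt_line f x v (t : R) : (forall y, derivable f y v) ->
  exists2 s : R, `|s| <= `|t| & f (x + t *: v) - f x = t * 'D_v f (x + s *: v).
Proof.
move=> df; pose g (u : R) := f (x + u *: v).
have dg (u : R) : is_derive u 1 g ('D_v f (x + u *: v)) by exact: is_derive_line.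
have cg (a b : R) : {within `[a, b], continuous g}.
  by apply: derivable_within_continuous => u _; exact: ex_derive.
have g0 : g 0 = f x by rewrite /g scale0r addr0.
have [t0|t0] := leP 0 t.
  have [s] := MVT_segment t0 (fun u _ => dg u) (cg _ _).
  rewrite g0 subr0 in_itv /= => /andP[s0 st] E; exists s; last by rewrite mulrC.
  by rewrite !ger0_norm.
have [s] := MVT_segment (ltW t0) (fun u _ => dg u) (cg _ _).
rewrite g0 sub0r in_itv /= => /andP[st s0] E; exists s.
  by rewrite (ler0_norm s0) (ler0_norm (ltW t0)) lerN2.
by rewrite -[LHS]opprB E mulrN opprK mulrC.
Qed.

Lemma is_derive_epsP f x v (d : R) :
  (forall e : R, 0 < e -> exists2 r : R, 0 < r & forall h : R, h != 0 -> `|h| < r ->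
     `|h^-1 * (f (x + h *: v) - f x) - d| < e) -> is_derive x v f d.
Proof.
move=> H.
have C : h^-1 *: ((f \o shift x) (h *: v) - f x) @[h --> 0^'] --> d.
  apply/cvgrPdist_lt => e e0; have [r r0 hr] := H e e0.
  exists r => //= h /=; rewrite sub0r normrN => hlt hn0.
  by rewrite distrC [_ + x]addrC; exact: hr.
split; first by apply/cvg_ex; exists d.
by apply: cvg_lim.
Qed.

End line_derivative.

Lemma continuous_epsP {R : realType} {V : normedModType R} (f : V -> R) :
  continuous f <-> forall x (e : R), 0 < e ->
   exists2 r : R, 0 < r & forall y, `|y - x| < r -> `|f y - f x| < e.
Proof.
split=> [cf x e e0|H x].
  have /cvgrPdist_lt/(_ _ e0)/nbhs_ballP[r /= r0 hr] := cf x.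
  exists r => // y yx; rewrite distrC; apply: hr.
  by rewrite -ball_normE /= distrC.
apply/cvgrPdist_lt => e e0; have [r r0 hr] := H x e e0.
apply/nbhs_ballP; exists r => //= y; rewrite -ball_normE /= => yx.
by rewrite distrC; apply: hr; rewrite distrC.
Qed.

Lemma subr_interchange {V : zmodType} (a b c d : V) : a - b - (c - d) = a - c - (b - d).
Proof. by rewrite !opprB addrACA [RHS]addrACA [- b + _]addrC [- c + _]addrC. Qed.

Lemma dist_half {R : realFieldType} (a b c e : R) :
  `|a - b| < e / 2 -> `|a - c| < e / 2 -> `|b - c| <= e.
Proof. by rewrite !ltr_norml ler_norml => /andP[? ?] /andP[? ?]; apply/andP; split; lra. Qed.

Section smooth_functions.
Context {R : realType} {n : nat}.
Local Notation Rn := 'rV[R]_n.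
Local Notation leb := (lebesgue_rV R n).
Implicit Types (f g : Rn -> R) (x e : Rn).

Lemma smooth_continuous f : smooth f -> continuous f.
Proof. by move=> /(_ 0%N). Qed.

Lemma smooth_derivable f i x : smooth f -> derivable f x (delta_mx ord0 i).
Proof. by move=> /(_ 1%N)[h _]; exact: h. Qed.

Lemma smooth_partial f i : smooth f -> smooth (partial i f).
Proof. by move=> sf k; have [_] := sf k.+1; exact. Qed.

(** [Ck] recurses through the partial derivatives, so an induction on k must run over a whole family
    of functions; the closure of [P] under [partial] packages that induction. *)
Lemma smooth_family (P : (Rn -> R) -> Prop) :
  (forall f, P f -> continuous f) ->
  (forall f i x, P f -> derivable f x (delta_mx ord0 i)) ->
  (forall f i, P f -> P (partial i f)) ->
  forall f, P f -> smooth f.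
Proof.
move=> Pc Pd Pp f Pf k; elim: k f Pf => [|k IH] f Pf /=; first exact: Pc.
by split => [i x|i]; [exact: Pd|exact/IH/Pp].
Qed.

Lemma partialD f g i : smooth f -> smooth g ->
  partial i (fun x => f x + g x) = (fun x => partial i f x + partial i g x).
Proof.
move=> sf sg; apply/funext => x; rewrite /partial (_ : (fun _ => _) = f + g)//.
by rewrite deriveD//; exact: smooth_derivable.
Qed.

Lemma partialM f g i : smooth f -> smooth g ->
  partial i (fun x => f x * g x) = (fun x => f x * partial i g x + g x * partial i f x).
Proof.
move=> sf sg; apply/funext => x; rewrite /partial (_ : (fun _ => _) = f * g)//.
by rewrite deriveM//; exact: smooth_derivable.
Qed.

Lemma partial_cst (c : R) i : partial i (fun=> c) = (fun=> 0) :> (Rn -> R).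
Proof. by apply/funext => x; rewrite /partial derive_cst. Qed.

Lemma smooth_cst (c : R) : smooth (fun=> c : R) (n := n).
Proof.
apply: (@smooth_family (fun f => exists c, f = fun=> c)); last by exists c.
- by move=> _ [d ->] x; exact: cst_continuous.
- by move=> _ i x [d ->]; exact: derivable_cst.
- by move=> _ i [d ->]; exists 0; exact: partial_cst.
Qed.

Lemma smoothD f g : smooth f -> smooth g -> smooth (fun x => f x + g x).
Proof.
move=> sf sg; apply: (@smooth_family (fun h => exists f g, [/\ smooth f, smooth g &
  h = (fun x => f x + g x)])); last by exists f, g.
- move=> _ [{}f [{}g [{}sf {}sg ->]]] x.
  by apply: continuousD; exact: smooth_continuous.
- move=> _ i x [{}f [{}g [{}sf {}sg ->]]].
  by apply: derivableD; exact: smooth_derivable.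
- move=> _ i [{}f [{}g [{}sf {}sg ->]]]; rewrite partialD//.
  by exists (partial i f), (partial i g); split => //; exact: smooth_partial.
Qed.

(** The order k is kept because in [smoothM] the two terms of the product rule are known to be
    [Ck k] only, by the induction hypothesis. *)
Lemma CkD k f g : Ck k f -> Ck k g -> Ck k (fun x => f x + g x).
Proof.
elim: k f g => [|k IH] f g /=.
  by move=> cf cg x; apply: continuousD; [exact: cf|exact: cg].
move=> [df cf] [dg cg]; split => [i x|i].
  by apply: derivableD; [exact: df|exact: dg].
rewrite (_ : partial i _ = (fun x => partial i f x + partial i g x)); first exact: IH.
by apply/funext => x; rewrite /partial (_ : (fun _ => _) = f + g)// deriveD.
Qed.

Lemma smoothM f g : smooth f -> smooth g -> smooth (fun x => f x * g x).
Proof.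
move=> sf sg k; elim: k f g sf sg => [|k IH] f g sf sg /=.
  by move=> x; apply: continuousM; exact: smooth_continuous.
split=> [i x|i]; first by apply: derivableM; exact: smooth_derivable.
by rewrite partialM//; apply: CkD; apply: IH => //; exact: smooth_partial.
Qed.

Lemma smoothZ (c : R) f : smooth f -> smooth (fun x => c * f x).
Proof. by apply: smoothM; exact: smooth_cst. Qed.

Lemma partialZ (c : R) f i : smooth f ->
  partial i (fun x => c * f x) = (fun x => c * partial i f x).
Proof.
move=> sf; rewrite partialM//; last exact: smooth_cst.
by apply/funext => x; rewrite partial_cst mulr0 addr0.
Qed.

Lemma smoothB f g : smooth f -> smooth g -> smooth (fun x => f x - g x).
Proof.
move=> sf sg; rewrite (_ : (fun _ => _) = (fun x => f x + (-1) * g x)).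
  by apply: smoothD => //; exact: smoothZ.
by apply/funext => x; rewrite mulN1r.
Qed.

Lemma partialB f g i : smooth f -> smooth g ->
  partial i (fun x => f x - g x) = (fun x => partial i f x - partial i g x).
Proof.
move=> sf sg; rewrite (_ : (fun _ => _) = (fun x => f x + (-1) * g x)); last first.
  by apply/funext => x; rewrite mulN1r.
rewrite partialD//; last exact: smoothZ.
by rewrite partialZ//; apply/funext => x; rewrite mulN1r.
Qed.

Lemma smooth_sum (I : Type) (r : seq I) (P : pred I) (F : I -> Rn -> R) :
  (forall i, smooth (F i)) -> smooth (fun x => \sum_(i <- r | P i) F i x).
Proof.
move=> sF; elim: r => [|j r IH].
  by under eq_fun do rewrite big_nil; exact: smooth_cst.
under eq_fun do rewrite big_cons; case: (P j) => //.
exact: smoothD.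
Qed.

Lemma partial_sum (I : Type) (r : seq I) (P : pred I) (F : I -> Rn -> R) j :
  (forall i, smooth (F i)) ->
  partial j (fun x => \sum_(i <- r | P i) F i x) =
  (fun x => \sum_(i <- r | P i) partial j (F i) x).
Proof.
move=> sF; elim: r => [|k r IH].
  under eq_fun do rewrite big_nil.
  by rewrite partial_cst; apply/funext => x; rewrite big_nil.
under eq_fun do rewrite big_cons; under [RHS]eq_fun do rewrite big_cons.
case: (P k) => //; rewrite partialD//; last exact: smooth_sum.
by rewrite IH.
Qed.

Lemma smooth_prod (I : Type) (r : seq I) (P : pred I) (F : I -> Rn -> R) :
  (forall i, smooth (F i)) -> smooth (fun x => \prod_(i <- r | P i) F i x).
Proof.
move=> sF; elim: r => [|j r IH].
  by under eq_fun do rewrite big_nil; exact: smooth_cst.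
under eq_fun do rewrite big_cons; case: (P j) => //.
exact: smoothM.
Qed.

Lemma mvt_partial f i x (t : R) : smooth f ->
  exists2 s : R, `|s| <= `|t| &
  f (x + t *: delta_mx ord0 i) - f x = t * partial i f (x + s *: delta_mx ord0 i).
Proof. by move=> sf; apply: mvt_line => y; exact: smooth_derivable. Qed.

Lemma norm_delta_mx i : `|(delta_mx ord0 i : Rn)| <= 1.
Proof.
apply: norm_le_coord => // j; rewrite mxE eqxx /=.
by case: eqP; rewrite ?normr1 ?normr0.
Qed.

Lemma norm_scale_delta_mx (t : R) i : `|t *: (delta_mx ord0 i : Rn)| <= `|t|.
Proof. by rewrite normrZ ler_piMr// norm_delta_mx. Qed.

(** The second difference of f over a square of side t, read in either order, is t^2 times a mixed
    partial derivative at a point within 2t of x. Continuity of both mixed derivatives lets t tend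
    to 0. *)
Lemma partialC f i j x : smooth f ->
  partial i (partial j f) x = partial j (partial i f) x.
Proof.
move=> sf.
pose di : Rn := delta_mx ord0 i; pose dj : Rn := delta_mx ord0 j.
have key (i' j' : 'I_n) (t : R) : t != 0 -> exists2 y : Rn,
    `|y - x| <= 2 * `|t| &
    f (x + t *: delta_mx ord0 i' + t *: delta_mx ord0 j')
     - f (x + t *: delta_mx ord0 j') - (f (x + t *: delta_mx ord0 i') - f x)
    = t ^+ 2 * partial j' (partial i' f) y.
  move=> t0; set ei := delta_mx ord0 i'; set ej := delta_mx ord0 j'.
  pose g y := f (y + t *: ej) - f y.
  have sfs : smooth (fun y => f (y + t *: ej)).
    apply: (@smooth_family (fun h => exists2 f, smooth f & h = fun y => f (y + t *: ej)));
      last by exists f.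
    - move=> _ [h sh ->] y; apply: continuous_comp; last exact: smooth_continuous.
      by apply: continuousD; [exact: cvg_id|exact: cst_continuous].
    - move=> _ k y [h sh ->].
      by apply/derivable_shift; exact: smooth_derivable.
    - move=> _ k [h sh ->]; exists (partial k h); first exact: smooth_partial.
      by apply/funext => y; rewrite /partial derive_shift.
  have sg : smooth g by exact: (smoothB sfs sf).
  have [s st Es] := mvt_partial i' x t sg.
  have E2 y : partial i' g y = partial i' f (y + t *: ej) - partial i' f y.
    by rewrite (partialB i' sfs sf) /partial derive_shift.
  have [s' st' Es'] := mvt_partial j' (x + s *: ei) t (smooth_partial i' sf).
  exists (x + s *: ei + s' *: ej).
    rewrite -[x + _ + _]addrA [x + (_ + _)]addrC addrK (le_trans (ler_normD _ _))// mulr2n mulrDl mul1r.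
    by rewrite lerD// (le_trans (norm_scale_delta_mx _ _)).
  rewrite expr2 -mulrA -Es' -/ei -E2 -/ei -Es /g.
  by ring.
have close (F : Rn -> R) : continuous F -> forall e : R, 0 < e -> exists2 r : R, 0 < r &
    forall y : Rn, `|y - x| < r -> `|F y - F x| < e.
  by move=> /continuous_epsP h; exact: h.
apply/eqP; rewrite -subr_eq0 -normr_le0; apply/ler_addgt0Pl => e e0; rewrite addr0.
have [r r0 hr] := close _ (smooth_continuous (smooth_partial i (smooth_partial j sf))) _ (divr_gt0 e0 (ltr0Sn R 1)).
have [r' r'0 hr'] := close _ (smooth_continuous (smooth_partial j (smooth_partial i sf))) _ (divr_gt0 e0 (ltr0Sn R 1)).
have [t t0 [lr lr']] : exists2 t, 0 < t & 2 * t < r /\ 2 * t < r'.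
  exists (Num.min r r' / 4); first by rewrite divr_gt0// lt_min r0.
  by split; rewrite mulrA ltr_pdivrMr// mulrC [ltLHS]mulrC; case: (leP r r') => rr; lra.
have [y yx Ey] := key i j t (lt0r_neq0 t0).
have [z zx Ez] := key j i t (lt0r_neq0 t0).
have E : partial j (partial i f) y = partial i (partial j f) z.
  apply: (@mulfI _ (t ^+ 2)); first by rewrite expf_neq0// lt0r_neq0.
  rewrite -Ey -Ez (addrAC x (t *: delta_mx ord0 j) (t *: delta_mx ord0 i)).
  exact: subr_interchange.
rewrite gtr0_norm// in yx zx.
move: {Ey Ez} (hr _ (le_lt_trans zx lr)) (hr' _ (le_lt_trans yx lr')).
rewrite E; apply: dist_half.
Qed.

(** [smooth] speaks of derivatives along the axes only. The increment along [e] is split into n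
    increments parallel to the axes, each handled by the mean value theorem; continuity of the
    partial derivatives brings the evaluation points back to y. *)
Lemma smooth_is_derive_line f x e (t : R) : smooth f ->
  is_derive t 1 (fun t : R => f (x + t *: e))
    (\sum_i e ord0 i * partial i f (x + t *: e)).
Proof.
move=> sf.
suff H y : is_derive y e f (\sum_i e ord0 i * partial i f y).
  by rewrite -[X in is_derive _ _ _ X](@derive_val _ _ _ _ _ _ _ (H (x + t *: e)));
    apply: is_derive_line; exact: ex_derive.
apply: is_derive_epsP => eps eps0.
(* Corners of the staircase from 0 to h e: the first k coordinates have already moved. *)
pose p (h : R) (k : nat) : Rn := \row_j (if (j < k)%N then h * e ord0 j else 0).
have pn h : p h n = h *: e by apply/rowP => j; rewrite !mxE ltn_ord.
have p0 h : p h 0%N = 0 by apply/rowP => j; rewrite !mxE.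
have pS h (k : 'I_n) : p h k.+1 = p h k + (h * e ord0 k) *: delta_mx ord0 k.
  apply/rowP => j; rewrite !mxE eqxx /= ltnS leq_eqVlt; case: eqP => [jk|jk].
    by rewrite (val_inj jk) ltnn eqxx add0r mulr1.
  rewrite (_ : (j == k) = false) ?mulr0 ?addr0//.
  by apply/eqP => jk'; apply: jk; rewrite jk'.
have ple h k : `|p h k| <= `|h| * `|e|.
  apply: norm_le_coord => [|j]; first by rewrite mulr_ge0.
  rewrite mxE; case: ifP => _; last by rewrite normr0 mulr_ge0.
  by rewrite normrM ler_wpM2l// coord_le_norm.
have e1 : 0 < `|e| + 1 by rewrite ltr_wpDl.
(* Each of the n edges costs at most eps' (|e| + 1); dividing by n + 1 keeps the total strictly
   below eps, also when n = 0. *)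
pose eps' := eps / (n.+1%:R * (`|e| + 1)).
have eps'0 : 0 < eps' by rewrite divr_gt0// mulr_gt0.
have /choice[r hr] : forall i, exists ri : R, 0 < ri /\ forall z, `|z - y| < ri ->
    `|partial i f z - partial i f y| < eps'.
  move=> i; have /continuous_epsP/(_ y _ eps'0)[ri ri0 hri] :=
    smooth_continuous (smooth_partial i sf).
  by exists ri.
pose rm := \big[Num.min/1]_i r i.
have rm0 : 0 < rm by apply: lt_bigmin => // i _; have [] := hr i.
exists (rm / (2 * (`|e| + 1))); first by rewrite divr_gt0// mulr_gt0.
move=> h h0 hlt.
have tele : f (y + h *: e) - f y = \sum_(k < n) (f (y + p h k.+1) - f (y + p h k)).
  rewrite -(big_mkord xpredT (fun k => f (y + p h k.+1) - f (y + p h k))).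
  by rewrite telescope_sumr// pn p0 addr0.
rewrite tele mulr_sumr -sumrB.
apply: (@le_lt_trans _ _ (\sum_(k < n) (eps' * (`|e| + 1)))); last first.
  rewrite sumr_const card_ord -mulr_natl /eps'.
  have -> : n%:R * (eps / (n.+1%:R * (`|e| + 1)) * (`|e| + 1)) = eps * (n%:R / n.+1%:R).
    have aux (a b c d : R) : c != 0 -> d != 0 -> a * (b / (c * d) * d) = b * (a / c).
      by move=> c0 d0; field; rewrite ?c0 ?d0.
    by rewrite aux// ?pnatr_eq0// lt0r_neq0.
  by rewrite gtr_pMr// ltr_pdivrMr// mul1r ltr_nat.
apply: (le_trans (ler_norm_sum _ _ _)); apply: ler_sum => k _.
rewrite pS addrA.
have [s sh ->] := mvt_partial k (y + p h k) (h * e ord0 k) sf.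
rewrite mulrA mulrA mulVf// mul1r -mulrBr normrM mulrC.
apply: ler_pM => //; last first.
  by rewrite (le_trans (coord_le_norm _ _))// lerDl.
apply: ltW; apply: (hr k).2.
rewrite -[y + p h k + _]addrA [y + (_ + _)]addrC addrK.
apply: (@le_lt_trans _ _ (`|h| * `|e| + `|h| * `|e|)).
  rewrite (le_trans (ler_normD _ _))// lerD ?ple//.
  rewrite (le_trans (norm_scale_delta_mx _ _))// (le_trans sh)// normrM.
  by rewrite ler_wpM2l// coord_le_norm.
apply: (@lt_le_trans _ _ rm); last exact: bigmin_le.
move: hlt; rewrite ltr_pdivlMr ?mulr_gt0//.
by have := normr_ge0 h; move: (`|h|) (`|e|) => a b; lra.
Qed.

End smooth_functions.

(** * Cutoff functions *)

Section smooth1.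
Context {R : realType}.
Implicit Types f g : R -> R.

(** Level 0 is [True], as derivability at level 1 already brings continuity. *)
Fixpoint D1 (k : nat) f : Prop :=
  if k is m.+1 then (forall x, derivable f x 1) /\ D1 m f^`()%classic else True.

Definition smooth1 f := forall k, D1 k f.

Lemma D1SP k f : D1 k.+1 f <-> (forall x, derivable f x 1) /\ D1 k f^`()%classic.
Proof. by []. Qed.

Lemma D1S k f : D1 k.+1 f -> D1 k f.
Proof. by elim: k f => [//|k IH] f [df /IH]. Qed.

Lemma D1_cst k (c : R) : D1 k (cst c).
Proof.
elim: k c => [//|k IH] c; split=> [x|]; first exact: derivable_cst.
rewrite (_ : _^`()%classic = cst 0)//.
by apply/funext => x; rewrite derive1_cst.
Qed.

Lemma D1D k f g : D1 k f -> D1 k g -> D1 k (f + g).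
Proof.
elim: k f g => [//|k IH] f g [df Df] [dg Dg]; split => [x|]; first exact: derivableD.
rewrite (_ : _^`()%classic = f^`()%classic + g^`()%classic); first exact: IH.
by apply/funext => x; rewrite derive1E (deriveD (df x) (dg x)) -(derive1E f) -(derive1E g).
Qed.

Lemma D1M k f g : D1 k f -> D1 k g -> D1 k (f * g).
Proof.
elim: k f g => [//|k IH] f g Hf Hg.
have /D1SP[df Df] := Hf; have /D1SP[dg Dg] := Hg.
apply/D1SP; split => [x|]; first exact: derivableM.
rewrite (_ : _^`()%classic = f * g^`()%classic + g * f^`()%classic).
  by apply: D1D; apply: IH => //; [exact: (D1S Hf)|exact: (D1S Hg)].
by apply/funext => x; rewrite derive1E (deriveM (df x) (dg x)) -(derive1E f) -(derive1E g).
Qed.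

Lemma D1V k f : (forall x, f x != 0) -> D1 k f -> D1 k (fun x => (f x)^-1).
Proof.
move=> f0; elim: k => [//|k IH] Hf; have /D1SP[df Df] := Hf.
apply/D1SP; split => [x|]; first exact: derivableV.
rewrite (_ : _^`()%classic = cst (-1) * ((fun x => (f x)^-1) * (fun x => (f x)^-1)) * f^`()%classic).
  apply: D1M => //; apply: D1M; first exact: D1_cst.
  by apply: D1M; exact: (IH (D1S Hf)).
apply/funext => x; rewrite derive1E (deriveV (f0 x) (df x)) -(derive1E f).
rewrite -[LHS]/(- (f x ^- 2) * f^`()%classic x).
by rewrite -[RHS]/(-1 * ((f x)^-1 * (f x)^-1) * f^`()%classic x) -exprVn expr2 mulN1r.
Qed.

Lemma D1_affine k f (a b : R) : D1 k f -> D1 k (fun t => f (a * t + b)).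
Proof.
elim: k f => [//|k IH] f /D1SP[df Df].
have da (x : R) : is_derive x 1 (fun t : R => a * t + b) a.
  apply: is_derive_epsP => e e0; exists 1 => // h h0 _.
  rewrite [h *: 1]mulr1 (_ : _ - a = 0) ?normr0//.
  by field.
have dc (x : R) : is_derive x 1 (fun t => f (a * t + b)) (f^`()%classic (a * x + b) * a).
  rewrite derive1E; apply: (@is_derive1_comp _ f (fun t : R => a * t + b)).
  by apply: derivableP; exact: df.
split=> [x|]; first exact: ex_derive.
rewrite (_ : _^`()%classic = (fun t => f^`()%classic (a * t + b)) * cst a).
  by apply: D1M; [exact: IH|exact: D1_cst].
by apply/funext => x; rewrite derive1E derive_val.
Qed.

(** [flat 0] is the classical exp (-1/t), flat at the origin. The weights t^-m make the family
    stable under derivation, so that all orders are treated by one induction. *)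
Definition flat (m : nat) (t : R) : R :=
  if 0 < t then t^-1 ^+ m * expR (- t^-1) else 0.

Lemma flat_ge0 m t : 0 <= flat m t.
Proof. by rewrite /flat; case: ifP => // t0; rewrite mulr_ge0 ?expR_ge0// exprn_ge0// invr_ge0 ltW. Qed.

(** With s = 1/t, a single term s^(m+2) / (m+2)! of the exponential series is below exp s. This
    bounds the difference quotient at 0 by a multiple of t, so the derivative there is 0. *)
Lemma flat_small m (t : R) : 0 < t -> t^-1 * flat m t <= (m.+2)`!%:R * t.
Proof.
move=> t0; rewrite /flat t0; set s := t^-1.
have s0 : 0 < s by rewrite invr_gt0.
have E : s ^+ m.+2 / (m.+2)`!%:R <= expR s.
  by apply: le_trans (expR_ge1Dxn m.+1 (ltW s0)); rewrite lerDr.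
have F : s ^+ m.+2 <= (m.+2)`!%:R * expR s.
  by rewrite mulrC -ler_pdivrMr// ltr0n fact_gt0.
have -> : t = s^-1 by rewrite invrK.
rewrite ler_pdivlMr// expRN.
rewrite (_ : _ * s = s ^+ m.+2 / expR s); first by rewrite ler_pdivrMr// expR_gt0.
by rewrite !exprS; ring.
Qed.

Lemma is_derive_flat m (t : R) :
  is_derive t 1 (flat m) (flat m.+2 t - m%:R * flat m.+1 t).
Proof.
have [t0|t0|->] := ltgtP t 0.
- rewrite /flat ltNge (ltW t0) /= mulr0 subr0.
  apply: (@near_eq_is_derive _ _ _ (cst 0)) => //.
  near=> x; rewrite ifF//; apply/negbTE; rewrite -leNgt ltW//.
  by near: x; exact: lt_nbhsl.
- have tn0 : t != 0 by rewrite gt_eqF.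
  apply: (@near_eq_is_derive _ _ _ (fun t : R => t^-1 ^+ m * expR (- t^-1))) => //.
    near=> x; rewrite /flat ifT//.
    by near: x; exact: lt_nbhsr.
  have dV : is_derive t 1 (fun t : R => t^-1) (- t ^- 2).
    have := @is_deriveV _ id t 1 1 tn0 (is_derive_id _ _).
    by rewrite -[X in is_derive _ _ _ X]/(_ * _) mulr1.
  have dE : is_derive t 1 (fun t : R => expR (- t^-1)) (expR (- t^-1) * - (- t ^- 2)).
    apply: (@is_derive1_comp _ expR (fun t : R => - t^-1)).
  have EX : (GRing.inv : R -> R) ^+ m = (fun t : R => t^-1 ^+ m).
    by elim: (m) => [|k IH]; apply/funext => s; rewrite ?expr0// exprS IH exprS.
  have := is_deriveM (is_deriveX m dV) dE; rewrite EX => H.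
  rewrite [X in is_derive _ _ _ X](_ : _ = (t^-1 ^+ m) *: (expR (- t^-1) * - - t ^- 2) +
    expR (- t^-1) *: ((m%:R * t^-1 ^+ m.-1) *: (- t ^- 2))); first exact: H.
  apply/esym; rewrite /flat t0 -!exprVn.
  rewrite -[LHS]/(t^-1 ^+ m * (expR (- t^-1) * - - t^-1 ^+ 2) +
    expR (- t^-1) * (m%:R * t^-1 ^+ m.-1 * - t^-1 ^+ 2)).
  move: (t^-1) (expR _) {H EX dE dV} => s E; case: m => [|m]; first by rewrite !exprS; ring.
  by rewrite !exprS /=; ring.
- rewrite /flat ltxx mulr0 subr0; apply: is_derive_epsP => e e0.
  exists (e / (m.+2)`!%:R); first by rewrite divr_gt0// ltr0n fact_gt0.
  move=> h h0 hlt; rewrite ltxx !subr0 add0r [h *: 1]mulr1.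
  have [hp|hn] := ltP 0 h; last by rewrite mulr0 normr0.
  rewrite -[_ * expR _](_ : flat m h = _); last by rewrite /flat hp.
  rewrite ger0_norm; last by rewrite mulr_ge0 ?flat_ge0// invr_ge0 ltW.
  apply: le_lt_trans (flat_small m hp) _.
  by rewrite mulrC -ltr_pdivlMr ?ltr0n ?fact_gt0// -(gtr0_norm hp).
Unshelve. all: by end_near.
Qed.

Lemma D1_flat k m : D1 k (flat m).
Proof.
elim: k m => [//|k IH] m; apply/D1SP; split => [t|]; first by have [] := is_derive_flat m t.
rewrite (_ : _^`()%classic = flat m.+2 + cst (- m%:R) * flat m.+1).
  by apply: D1D => //; apply: D1M => //; exact: D1_cst.
apply/funext => t; rewrite derive1E (@derive_val _ _ _ _ _ _ _ (is_derive_flat m t)).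
by rewrite -mulNr.
Qed.

Definition step (t : R) : R := flat 0 t / (flat 0 t + flat 0 (1 - t)).

Lemma flat0_gt0 (t : R) : 0 < t -> 0 < flat 0 t.
Proof. by move=> t0; rewrite /flat t0 expr0 mul1r expR_gt0. Qed.

Lemma step_den (t : R) : 0 < flat 0 t + flat 0 (1 - t).
Proof.
have [t0|t0] := ltP 0 t.
  by apply: ltr_wpDr; [exact: flat_ge0|exact: flat0_gt0].
by apply: ltr_wpDl; [exact: flat_ge0|apply: flat0_gt0; rewrite subr_gt0 (le_lt_trans t0)].
Qed.

Lemma step0 (t : R) : t <= 0 -> step t = 0.
Proof. by move=> t0; rewrite /step {1}/flat ltNge t0 /= mul0r. Qed.

Lemma step1 (t : R) : 1 <= t -> step t = 1.
Proof.
move=> t1; have := step_den t; rewrite /step.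
have -> : flat 0 (1 - t) = 0 by rewrite /flat ltNge subr_le0 t1.
by rewrite addr0 => h; rewrite divff// gt_eqF.
Qed.

Lemma step_ge0 (t : R) : 0 <= step t.
Proof. by rewrite /step divr_ge0// ?flat_ge0// ltW// step_den. Qed.

Lemma step_le1 (t : R) : step t <= 1.
Proof. by rewrite /step ler_pdivrMr ?step_den// mul1r lerDl flat_ge0. Qed.

Lemma smooth1_step : smooth1 step.
Proof.
move=> k; apply: (@D1M _ (flat 0) (fun t => (flat 0 t + flat 0 (1 - t))^-1)).
  exact: D1_flat.
apply: D1V => [x|]; first by rewrite gt_eqF// step_den.
apply: (@D1D _ (flat 0) (fun t => flat 0 (1 - t))); first exact: D1_flat.
have := @D1_affine k (flat 0) (-1) 1 (D1_flat _ _).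
by congr D1; apply/funext => t; rewrite mulN1r addrC.
Qed.

(** A bump supported in [-1, 1], written as a difference so that its integer translates telescope to
    a partition of unity. *)
Definition hat (t : R) : R := step (t + 1) - step t.

Lemma hat_ge0 (t : R) : 0 <= hat t.
Proof.
rewrite /hat; have [t0|t0] := leP t 0; first by rewrite (step0 t0) subr0 step_ge0.
by rewrite (@step1 (t + 1)) ?subr_ge0 ?step_le1// lerDr ltW.
Qed.

Lemma hat_out (t : R) : 1 < `|t| -> hat t = 0.
Proof.
rewrite /hat lter_normr => /orP[t1|t1].
  by rewrite !step1 ?subrr//; lra.
by rewrite !step0 ?subrr//; lra.
Qed.

Lemma smooth1_hat : smooth1 hat.
Proof.
move=> k; rewrite (_ : hat = (fun t => step (1 * t + 1)) + cst (-1) * step); last first.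
  by apply/funext => t; rewrite /hat -[RHS]/(step _ + (-1) * step t) mul1r mulN1r.
apply: D1D; first by apply: D1_affine; exact: smooth1_step.
by apply: D1M; [exact: D1_cst|exact: smooth1_step].
Qed.

Lemma derive_hat_out (t : R) : 1 < `|t| -> hat^`()%classic t = 0.
Proof.
move=> t1; rewrite derive1E (near_eq_derive (g := cst 0)); first by rewrite derive_cst.
have : \forall s \near t, 1 < `|s|.
  apply/nbhs_ballP; exists (`|t| - 1); first by rewrite /= subr_gt0.
  move=> s; rewrite -ball_normE /= => ts.
  by have := ler_normD (t - s) s; rewrite subrK; lra.
by apply: filterS => s; exact: hat_out.
Qed.

Lemma derive_hat_bounded : exists2 C : R, 0 < C & forall t, `|hat^`()%classic t| <= C.
Proof.
have dd t : derivable (hat^`()%classic : R -> R) t 1.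
  by have [_ []] := smooth1_hat 2.
have c : {within `[(-1 : R), 1], continuous (fun t => `|hat^`()%classic t|)}.
  apply: continuous_subspaceT => t; apply: continuous_comp; last exact: norm_continuous.
  exact/differentiable_continuous/derivable1_diffP.
have [s _ hs] := EVT_max (ltac:(lra) : (-1 : R) <= 1) c.
exists (`|hat^`()%classic s| + 1); first by rewrite ltr_wpDl.
move=> t; have [t1|t1] := leP `|t| 1; last by rewrite derive_hat_out// normr0 addr_ge0.
by rewrite (le_trans (hs t _)) ?lerDl// in_itv /= -ler_norml.
Qed.

Lemma telescope_shift (G : R -> R) (M : nat) (u : R) :
  \sum_(m < M) (G (u - m%:R + 1) - G (u - m%:R)) = G (u + 1) - G (u + 1 - M%:R).
Proof.
elim: M => [|M IH]; first by rewrite big_ord0 subr0 subrr.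
rewrite big_ord_recr /= IH.
rewrite (_ : u - M%:R + 1 = u + 1 - M%:R); last by ring.
rewrite (_ : u + 1 - M.+1%:R = u - M%:R); last by rewrite -natr1; ring.
by ring.
Qed.

Lemma sum_hat (M : nat) (u : R) :
  \sum_(m < M) hat (u - m%:R) = step (u + 1) - step (u + 1 - M%:R).
Proof. exact: telescope_shift. Qed.

Lemma sum_hat_le1 (M : nat) (u : R) : \sum_(m < M) hat (u - m%:R) <= 1.
Proof. by rewrite sum_hat; have := step_le1 (u + 1); have := step_ge0 (u + 1 - M%:R); lra. Qed.

Lemma sum_hat_eq1 (M : nat) (u : R) : 0 <= u -> u + 1 <= M%:R ->
  \sum_(m < M) hat (u - m%:R) = 1.
Proof. by move=> u0 uM; rewrite sum_hat step1 ?step0 ?subr0//; lra. Qed.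

Lemma sum_derive_hat (C : R) (M : nat) (u : R) : (forall t, `|hat^`()%classic t| <= C) ->
  \sum_(m < M) `|hat^`()%classic (u - m%:R)| <= 3 * C.
Proof.
move=> hC; have C0 : 0 <= C by exact: le_trans (hC 0).
(* H (v + 1) - H v indicates -1 <= v < 0, and its translates telescope. The copies at u, u - 1 and u
   - 2 together indicate -1 <= u - m < 2, which contains the closed support of the derivative; the
   third copy is there for the endpoint u - m = 1. *)
pose H (t : R) : R := ((0 <= t)%R)%:R.
have HM v : \sum_(m < M) (H (v - m%:R + 1) - H (v - m%:R)) <= 1.
  by rewrite telescope_shift /H; case: (0 <= v + 1); case: (0 <= _); rewrite /=; lra.
apply: (@le_trans _ _ (C * (\sum_(m < M) (H (u - m%:R + 1) - H (u - m%:R)) +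
   \sum_(m < M) (H (u - 1 - m%:R + 1) - H (u - 1 - m%:R)) +
   \sum_(m < M) (H (u - 2 - m%:R + 1) - H (u - 2 - m%:R))))); last first.
  by rewrite mulrC ler_wpM2r//; have := HM u; have := HM (u - 1); have := HM (u - 2); lra.
rewrite -!big_split /= mulr_sumr; apply: ler_sum => m _.
rewrite (_ : u - 1 - m%:R + 1 = u - m%:R); last by ring.
rewrite (_ : u - 2 - m%:R + 1 = u - 1 - m%:R); last by ring.
rewrite [X in C * X](_ : _ = H (u - m%:R + 1) - H (u - 2 - m%:R)); last by ring.
have [t1|t1] := leP `|u - m%:R| 1; last first.
  rewrite derive_hat_out// normr0 mulr_ge0// /H subr_ge0 ler_nat.
  by case: (leP 0 (u - 2 - m%:R)) => // h; rewrite (_ : 0 <= _)//; lra.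
move: t1; rewrite ler_norml => /andP[h1 h2].
rewrite /H (_ : (0 <= u - m%:R + 1) = true); last by apply/idP; lra.
rewrite (_ : (0 <= u - 2 - m%:R) = false); last by apply/negP; lra.
by rewrite subr0 mulr1.
Qed.

End smooth1.

(** * Functions of one coordinate, supports and bounds *)

Section coordinates.
Context {R : realType} {n : nat}.
Local Notation Rn := 'rV[R]_n.
Implicit Types (f : Rn -> R) (h : R -> R) (x v : Rn).

Lemma derivable_coord h (j : 'I_n) x v :
  derivable (fun y : Rn => h (y ord0 j)) x v <-> derivable h (x ord0 j) (v ord0 j).
Proof.
rewrite /derivable (_ : (fun t : R => _) =
  (fun t : R => t^-1 *: ((h \o shift (x ord0 j)) (t *: v ord0 j) - h (x ord0 j))))//.
by apply/funext => t /=; rewrite !mxE.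
Qed.

Lemma derive_coord h (j : 'I_n) x v :
  'D_v (fun y : Rn => h (y ord0 j)) x = 'D_(v ord0 j) h (x ord0 j).
Proof.
rewrite /derive (_ : (fun t : R => _) =
  (fun t : R => t^-1 *: ((h \o shift (x ord0 j)) (t *: v ord0 j) - h (x ord0 j))))//.
by apply/funext => t /=; rewrite !mxE.
Qed.

Lemma continuous_coord (j : 'I_n) : continuous (fun y : Rn => y ord0 j).
Proof.
apply/continuous_epsP => x e e0; exists e => // y yx.
by apply: le_lt_trans yx; have := coord_le_norm (y - x) j; rewrite !mxE.
Qed.

Lemma smooth1_continuous h : smooth1 h -> continuous h.
Proof.
by move=> /(_ 1%N)/D1SP[dh _] t; exact/differentiable_continuous/derivable1_diffP.
Qed.

Lemma smooth1_derive1 h : smooth1 h -> smooth1 h^`()%classic.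
Proof. by move=> sh k; have /D1SP[] := sh k.+1. Qed.

Lemma partial_coord h (i j : 'I_n) : partial i (fun y : Rn => h (y ord0 j)) =
  if j == i then (fun y : Rn => h^`()%classic (y ord0 j)) else fun=> 0.
Proof.
apply/funext => x; rewrite /partial derive_coord mxE eqxx /=; case: eqP => _.
  by rewrite derive1E.
rewrite /derive (_ : (fun t : R => _) = cst 0); first exact: lim_cst.
by apply/funext => t /=; rewrite scaler0 add0r subrr scaler0.
Qed.

Lemma smooth_coord h (j : 'I_n) : smooth1 h -> smooth (fun y : Rn => h (y ord0 j)).
Proof.
move=> sh; apply: (@smooth_family _ _ (fun f => exists2 h : R -> R, smooth1 h & f = (fun y : Rn => h (y ord0 j))));
  last by exists h.
- move=> _ [{}h {}sh ->] x; apply: continuous_comp; first exact: continuous_coord.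
  exact: smooth1_continuous.
- move=> _ i x [{}h {}sh ->]; apply/derivable_coord; rewrite mxE eqxx /=.
  have [dh _] := (D1SP _ _).1 (sh 1%N).
  case: eqP => _; first exact: dh.
  rewrite /derivable (_ : (fun t : R => _) = cst 0); first exact: is_cvg_cst.
  by apply/funext => t /=; rewrite scaler0 add0r subrr scaler0.
- move=> _ i [{}h {}sh ->]; rewrite partial_coord; case: eqP => _.
    by exists h^`()%classic => //; exact: smooth1_derive1.
  by exists (cst 0) => // k; exact: D1_cst.
Qed.

Lemma partial_indep f (i : 'I_n) : (forall x (t : R), f (x + t *: delta_mx ord0 i) = f x) ->
  partial i f = fun=> 0.
Proof.
move=> fi; apply/funext => x; rewrite /partial /derive.
rewrite (_ : (fun t : R => _) = cst 0); first exact: lim_cst.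
by apply/funext => t /=; rewrite [_ + x]addrC fi subrr scaler0.
Qed.

Lemma partial_outside f (K : set Rn) i x : closed K -> (forall y, ~ K y -> f y = 0) ->
  ~ K x -> partial i f x = 0.
Proof.
move=> cK f0 Kx; rewrite /partial (@near_eq_derive _ _ _ _ (cst 0)) ?derive_cst//.
have : open_nbhs x (~` K) by split => //; exact: closed_openC.
by move=> /open_nbhs_nbhs; apply: filterS => y /f0.
Qed.

Lemma compact_supp_bounded f (K : set Rn) : continuous f -> compact K ->
  (forall y, ~ K y -> f y = 0) -> exists2 C : R, 0 <= C & forall x, `|f x| <= C.
Proof.
move=> cf cK f0; have [K0|/set0P K0] := eqVneq K set0.
  by exists 0 => // x; rewrite f0 ?K0// normr0.
have [|c _ hc] := @EVT_max_rV R n (fun x => `|f x|) K K0 cK.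
  apply: continuous_subspaceT => x; apply: continuous_comp; first exact: cf.
  exact: norm_continuous.
exists `|f c| => // x; have [Kx|Kx] := pselect (K x); first by apply: hc; rewrite inE.
by rewrite f0// normr0.
Qed.

Lemma continuous_bounded_on f (A : set Rn) : continuous f -> bounded_set A ->
  exists2 C : R, 0 <= C & forall x, A x -> `|f x| <= C.
Proof.
move=> cf bA; have [M M0 hM] : exists2 M, 0 < M & forall x, A x -> `|x| <= M.
  exact: (pinfty_ex_gt0 bA).
pose K : set Rn := [set x | `|x| <= M].
have cK : compact K.
  apply: bounded_closed_compact; first by exists M; split=> [|y My x /le_trans]; [exact: num_real|apply; exact: ltW].
  rewrite (_ : K = Num.Def.normr @^-1` [set t | t <= M])//.
  by apply: closed_comp => [x _|]; [exact: norm_continuous|exact: closed_le].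
have K0 : K !=set0 by exists 0; rewrite /K /= normr0 ltW.
have [|c _ hc] := @EVT_max_rV R n (fun x => `|f x|) K K0 cK.
  apply: continuous_subspaceT => x; apply: continuous_comp; first exact: cf.
  exact: norm_continuous.
by exists `|f c| => // x Ax; apply: hc; rewrite inE; exact: hM.
Qed.

End coordinates.

(** * Integrals of derivatives of compactly supported functions *)

Section integration_by_parts.
Context {R : realType} {n : nat}.
Local Notation Rn := 'rV[R]_n.
Local Notation leb := (lebesgue_rV R n).
Implicit Types (f : Rn -> R).

Lemma Rintegral_supp (D : set Rn) f : (forall x, ~ D x -> f x = 0) ->
  \int[leb]_(x in D) f x = \int[leb]_x f x.
Proof.
move=> f0; rewrite Rintegral_mkcond; congr Rintegral; apply/funext => x.
by rewrite patchE; case: ifPn => //; rewrite notin_setE => /f0.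
Qed.

Lemma measurable_fun_cont (D : set Rn) f : measurable D -> continuous f ->
  measurable_fun D f.
Proof. by move=> mD cf; apply: measurable_funS (continuous_measurable_rV cf). Qed.

Lemma integrable_cont (D : set Rn) f : measurable D -> bounded_set D -> continuous f ->
  leb.-integrable D (EFin \o f).
Proof.
move=> mD bD cf; apply: measurable_bounded_integrable => //.
- exact: lebesgue_rV_bounded.
- exact: measurable_fun_cont.
have [C C0 hC] := continuous_bounded_on cf bD.
exists C; split=> [|y Cy x Dx]; first exact: num_real.
by apply: (le_trans (hC _ Dx)); exact: ltW.
Qed.

(** The integral of x |-> f (x + t e_i) is constant in t by translation invariance; its derivative
    at t = 0, taken under the integral, is the integral of the partial derivative. *)
Lemma Rintegral_partial (K : set Rn) f i : smooth f -> compact K ->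
  (forall x, ~ K x -> f x = 0) -> \int[leb]_x partial i f x = 0.
Proof.
move=> sf cK f0; have cK' : closed K := compact_closed (@norm_hausdorff _ _) cK.
have [M M0 hM] : exists2 M, 0 < M & forall x, K x -> `|x| <= M.
  exact: (pinfty_ex_gt0 (compact_bounded cK)).
pose d : Rn := delta_mx ord0 i.
(* Large enough to contain the supports of all translates with |t| < 1, so the integrals run over a
   fixed bounded set. *)
pose B : set Rn := ball 0 (M + 2).
have B0 (t : R) x : `|t| < 1 -> ~ B x -> f (x + t *: d) = 0.
  move=> t1 Bx; apply: f0 => /hM; apply/negP; rewrite -ltNge.
  have : M + 2 <= `|x|.
    by rewrite leNgt; apply/negP => h; apply: Bx; rewrite /B -ball_normE /= sub0r normrN.
  have := ler_normB (x + t *: d) (t *: d); rewrite addrK.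
  have := norm_scale_delta_mx t i; rewrite -/d; move: t1 (`|x|) (`|x + t *: d|) (`|t *: d|); move: (`|t|) => e e1 a b c; lra.
have mB : measurable B by exact: measurable_rV_ball.
have bB : bounded_set B.
  exists (M + 2); split=> [|y My x]; first exact: num_real.
  by rewrite /B -ball_normE /= sub0r normrN => /ltW /le_trans; apply; exact: ltW.
have sp := smooth_continuous (smooth_partial i sf).
have [C C0 hC] := compact_supp_bounded sp cK (fun x => partial_outside i cK' f0).
pose g (t : R) (x : Rn) := f (x + t *: d).
have dg (t : R) x : is_derive t 1 (g ^~ x) (partial i f (x + t *: d)).
  by apply: is_derive_line; exact: smooth_derivable.
have I0 (t : R) : `]-1, 1[%classic t -> \int[leb]_(x in B) g t x = \int[leb]_x f x.
  rewrite /= in_itv /= -ltr_norml => t1.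
  rewrite Rintegral_supp; last by move=> x; exact: B0.
  apply: (Rintegral_shift (t *: d)).
  by apply: measurable_fun_cont => //; exact: smooth_continuous.
have pE (t : R) x : partial1of2 g t x = partial i f (x + t *: d).
  by rewrite /partial1of2 derive1E; apply: derive_val.
have a0 : `](-1 : R), 1[%classic (0 : R) by rewrite /= in_itv /=; apply/andP; split; lra.
have := @differentiation_under_integral R _ _ leb g B mB 0 (-1) 1 a0 _ _ (cst C) (fun=> C0) _ _.
rewrite (_ : _^`()%classic 0 = 0); last first.
  rewrite derive1E (near_eq_derive (g := cst (\int[leb]_x f x))) ?derive_cst//.
  by apply: filterS (near_in_itvoo a0) => t ht; exact: I0.
move=> H; rewrite -(@Rintegral_supp B).
  rewrite (_ : Rintegral _ _ _ = \int[leb]_(y in B) partial1of2 g 0 y); last first.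
    by congr Rintegral; apply/funext => x; rewrite pE scale0r addr0.
  apply/esym/H.
  - move=> t _; apply: integrable_cont => // x.
    apply: continuous_comp; last exact: smooth_continuous.
    by apply: continuousD; [exact: cvg_id|exact: cst_continuous].
  - by move=> t x _ _; exact: ex_derive.
  - by apply: integrable_cont => // x; exact: cst_continuous.
  - by move=> t x _ _; rewrite pE.
move=> x Bx; apply: (partial_outside i cK' f0) => Kx; apply: Bx.
by rewrite /B -ball_normE /= sub0r normrN (le_lt_trans (hM _ Kx))// ltrDl.
Qed.

End integration_by_parts.

Section cutoff.
Context {R : realType} {n : nat}.
Local Notation Rn := 'rV[R]_n.

Lemma rV_ball_norm (x y : Rn) (r : R) : ball x r y = (`|x - y| < r) :> Prop.
Proof. by rewrite -ball_normE. Qed.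

Lemma closed_ball_in (U : set Rn) (r : R) : closed [set x : Rn | ball x r `<=` U].
Proof.
rewrite -openC (_ : ~` _ = \bigcup_(y in ~` U) ball y r).
  by apply: bigcup_open => y _; exact: ball_open.
apply/seteqP; split => x /=; last first.
  by move=> [y Uy yx] H; apply: Uy; apply: H; exact: ball_sym.
move=> /existsNP[y /not_implyP[xy Uy]]; exists y => //; exact: ball_sym.
Qed.

(** On a grid of mesh d, tensor products of hats form a partition of unity near U, and eta sums
    those whose cell lies well inside U. The gradient bound does not see the shape of U, since
    absolute values of derivatives are summed over the whole grid. *)
Theorem cutoff : exists2 C : R, 0 < C & forall (U : set Rn) (d : R),
  bounded_set U -> 0 < d ->
  exists eta : Rn -> R, exists K : set Rn,
  [/\ smooth eta, compact K /\ K `<=` U, forall x, ~ K x -> eta x = 0,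
      (forall x, 0 <= eta x <= 1) /\ (forall i x, `|partial i eta x| <= C / d) &
      forall x, ball x (4 * d) `<=` U -> eta x = 1 /\ forall i, partial i eta x = 0].
Proof.
have [C C0 hC] := @derive_hat_bounded R.
exists (3 * C) => [|U d bU d0]; first by rewrite mulr_gt0.
have [rho rho0 hrho] : exists2 M, 0 < M & forall x, U x -> `|x| <= M.
  exact: (pinfty_ex_gt0 bU).
have [N hN] : exists N : nat, rho / d <= N%:R.
  exists (Num.truncn (rho / d)).+1.
  by rewrite ltW// truncnS_gt// divr_ge0// ltW.
(* The grid indices m - N run from -N to N, and N d >= rho, so the hats sum to 1 on every coordinate
   of a point of U. *)
pose M := (2 * N).+1; have hM : M%:R = 2 * N%:R + 1 :> R by rewrite /M -natr1 natrM.
pose th (m : 'I_M) (t : R) := hat (d^-1 * t + N%:R - m%:R).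
have sth m : smooth1 (th m).
  move=> k; rewrite /th; have := @D1_affine _ k hat d^-1 (N%:R - m%:R) (smooth1_hat k).
  by congr D1; apply/funext => t; rewrite addrA.
have dth m t : (th m)^`()%classic t = d^-1 * hat^`()%classic (d^-1 * t + N%:R - m%:R).
  have dh (s : R) : derivable hat s 1.
    by have /D1SP[] := @smooth1_hat R 1.
  have da (s : R) : is_derive s 1 (fun t : R => d^-1 * t + N%:R - m%:R) d^-1.
    apply: is_derive_epsP => e e0; exists 1 => // h h0 _.
    rewrite [h *: 1]mulr1 (_ : _ - d^-1 = 0) ?normr0//.
    by rewrite mulrDr; move: d^-1 => b; field.
  rewrite derive1E mulrC derive1E.
  apply: derive_val; apply: (@is_derive1_comp _ hat (fun t : R => d^-1 * t + N%:R - m%:R)).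
  exact: derivableP.
pose T (k : {ffun 'I_n -> 'I_M}) (x : Rn) := \prod_i th (k i) (x ord0 i).
pose c (k : {ffun 'I_n -> 'I_M}) : Rn := \row_i (d * ((k i)%:R - N%:R)).
have T0 k x : 0 <= T k x by apply: prodr_ge0 => i _; exact: hat_ge0.
have Tsupp k x : T k x != 0 -> `|x - c k| <= d.
  move=> /prodf_neq0 h; apply: norm_le_coord => [|i]; first exact: ltW.
  rewrite !mxE; have : `|d^-1 * x ord0 i + N%:R - (k i)%:R| <= 1.
    by rewrite leNgt; apply/negP => /hat_out h0; move: (h i isT); rewrite /th h0 eqxx.
  move=> h1; rewrite (_ : _ - _ = d * (d^-1 * x ord0 i + N%:R - (k i)%:R)); last first.
    by field; rewrite gt_eqF.
  by rewrite normrM gtr0_norm// ler_piMr// ltW.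
have sT k : smooth (T k).
  by apply: smooth_prod => i; exact: smooth_coord.
have sumT x : \sum_k T k x = \prod_i \sum_(m < M) th m (x ord0 i).
  by rewrite bigA_distr_bigA.
have sumth x : \sum_(m < M) th m x <= 1 by exact: sum_hat_le1.
have sumth0 x : 0 <= \sum_(m < M) th m x by apply: sumr_ge0 => m _; exact: hat_ge0.
have sumT1 x : `|x| <= rho -> \sum_k T k x = 1.
  move=> xr; rewrite sumT big1// => i _.
  have h : `|d^-1 * x ord0 i| <= N%:R.
    rewrite normrM gtr0_norm ?invr_gt0// mulrC (le_trans _ hN)// ler_pM2r ?invr_gt0//.
    exact: le_trans (coord_le_norm _ _) xr.
  move: h; rewrite ler_norml => /andP[h1 h2].
  by apply: sum_hat_eq1; rewrite ?hM; lra.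
(* [T k] lives within d of its centre. With the threshold 2d, a point where a selected bump is
   nonzero keeps a d-ball inside U, and at a point with a 3d-ball inside U every nonzero bump is
   selected. The 4d of the statement gives eta = 1 on a whole neighbourhood, hence zero
   derivatives. *)
pose S k := `[< ball (c k) (2 * d) `<=` U >].
pose eta x := \sum_(k | S k) T k x.
have seta : smooth eta by apply: smooth_sum.
have eta0 x : 0 <= eta x by apply: sumr_ge0.
have etale x : eta x <= \sum_k T k x.
  by rewrite [leRHS](bigID S) /= lerDl sumr_ge0.
have eta1 x : ball x (3 * d) `<=` U -> eta x = 1.
  move=> bx; rewrite -(sumT1 x); last first.
    by apply/hrho/bx; apply: ballxx; rewrite mulr_gt0.
  rewrite [RHS](bigID S) /= [X in _ + X]big1 ?addr0// => k Sk.
  apply/eqP; apply: contraNT Sk => /Tsupp xk; apply/asboolP => y yk; apply: bx.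
  move: yk; rewrite !rV_ball_norm => yk.
  rewrite (_ : x - y = (x - c k) + (c k - y)); last by rewrite addrA subrK.
  by rewrite (le_lt_trans (ler_normD _ _))// (_ : 3 * d = d + 2 * d) ?ler_ltD//; ring.
pose K : set Rn := [set x | `|x| <= rho] `&` [set x : Rn | ball x d `<=` U].
exists eta, K; split => //.
- split; last by move=> x [_]; apply; exact: ballxx.
  apply: bounded_closed_compact.
    exists rho; split=> [|y hy x [/= xr _]]; first exact: num_real.
    by rewrite (le_trans xr)// ltW.
  apply: closedI; last exact: closed_ball_in.
  rewrite (_ : mkset _ = (Num.Def.normr : Rn -> R) @^-1` [set t | t <= rho])//.
  by apply: closed_comp => [x _|]; [exact: norm_continuous|exact: closed_le].
- move=> x; apply: contra_notP => /eqP etax.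
  have [k Sk Tk] : exists2 k, S k & T k x != 0.
    apply: contrapT => h; move: etax; rewrite /eta big1 ?eqxx// => k Sk.
    by apply/eqP; apply: contrapT => /negP Tk; apply: h; exists k.
  have xk := Tsupp _ _ Tk.
  have bx : ball x d `<=` U.
    move=> y; rewrite rV_ball_norm => xy; move/asboolP: Sk; apply; rewrite rV_ball_norm.
    rewrite (_ : c k - y = (c k - x) + (x - y)); last by rewrite addrA subrK.
    rewrite (le_lt_trans (ler_normD _ _))// (_ : 2 * d = d + d) ?ler_ltD//; last by ring.
    by rewrite distrC.
  by split => //; apply/hrho/bx/ballxx.
- split=> [x|i x].
    rewrite eta0 /= (le_trans (etale x))// sumT.
    by apply: prodr_ile1 => i _; rewrite sumth0 sumth.
  rewrite /eta partial_sum//.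
  (* The sum over the grid of |partial i (T k)| factors into one sum per coordinate: coordinate i
     gives at most 3C / d, every other one at most 1. *)
  pose G (j : 'I_n) (m : 'I_M) := if j == i then `|(th m)^`()%classic (x ord0 j)| else th m (x ord0 j).
  have pT k : `|partial i (T k) x| = \prod_j G j (k j).
    rewrite (_ : T k = (fun x => th (k i) (x ord0 i) * \prod_(j | j != i) th (k j) (x ord0 j))); last first.
      by apply/funext => y; rewrite /T (bigD1 i).
    rewrite partialM; last 2 first.
      exact: smooth_coord.
      by apply: smooth_prod => j; exact: smooth_coord.
    rewrite [X in _ * X + _](_ : _ = 0); last first.
      rewrite partial_indep// => y t; apply: eq_bigr => j ji.
      by rewrite !mxE (negbTE ji) andbF mulr0 addr0.
    rewrite mulr0 add0r partial_coord eqxx normrM [RHS](bigD1 i)//= mulrC.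
    have -> : G i (k i) = `|(th (k i))^`()%classic (x ord0 i)| by rewrite /G eqxx.
    congr (_ * _).
    rewrite ger0_norm; last by apply: prodr_ge0 => j _; exact: hat_ge0.
    by apply: eq_bigr => j /negbTE ji; rewrite /G ji.
  apply: (le_trans (ler_norm_sum _ _ _)).
  apply: (@le_trans _ _ (\sum_k `|partial i (T k) x|)).
    by rewrite [leRHS](bigID S) /= lerDl sumr_ge0.
  under eq_bigr do rewrite pT.
  rewrite -(bigA_distr_bigA G) (bigD1 i)//=.
  rewrite -[leRHS]mulr1 ler_pM//.
  + by apply: sumr_ge0 => m _; rewrite /G eqxx.
  + by apply: prodr_ge0 => j _; apply: sumr_ge0 => m _; rewrite /G; case: ifP => // _; exact: hat_ge0.
  + rewrite /G eqxx; under eq_bigr do rewrite dth normrM gtr0_norm ?invr_gt0//.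
    rewrite -mulr_sumr mulrC ler_pM2r ?invr_gt0//.
    exact: sum_derive_hat.
  + apply: prodr_ile1 => j ji; rewrite /G (negbTE ji).
    by rewrite sumth0 sumth.
- move=> x bx; have b3 y : ball x d y -> ball y (3 * d) `<=` U.
    move=> xy z yz; apply: bx; move: xy yz; rewrite !rV_ball_norm => xy yz.
    rewrite (_ : x - z = (x - y) + (y - z)); last by rewrite addrA subrK.
    by rewrite (le_lt_trans (ler_normD _ _))// (_ : 4 * d = d + 3 * d) ?ltrD//; ring.
  split=> [|i]; first by apply/eta1/b3/ballxx.
  rewrite /partial (near_eq_derive (g := cst (1 : R))) ?derive_cst//.
  by apply/nbhs_ballP; exists d => // y xy; exact/eta1/b3.
Qed.

End cutoff.

(** * Square-integrable functions *)

Section square_integrable.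
Context {d} {T : measurableType d} {R : realType} {mu : {measure set T -> \bar R}} {D : set T}.
Hypothesis mD : measurable D.
Local Notation sqi := (square_integrable mu D).
Implicit Types (f g : T -> R).

Lemma sqi_measurable f : sqi f -> measurable_fun D f. Proof. by case. Qed.

Lemma sqi_mul f g : sqi f -> sqi g -> mu.-integrable D (fun x => (f x * g x)%:E).
Proof.
move=> [mf If] [mg Ig].
apply: (le_integrable mD _ _ (integrableD mD If Ig)).
  by apply/measurable_EFinP; exact: measurable_funM.
move=> x Dx; change (`|f x * g x|%:E <= `|f x ^+ 2 + g x ^+ 2|%:E)%E.
rewrite lee_fin normrM [leRHS]ger0_norm ?addr_ge0 ?sqr_ge0//.
rewrite -[f x ^+ 2]real_normK ?num_real// -[g x ^+ 2]real_normK ?num_real//.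
have := sqr_ge0 (`|f x| - `|g x|); have := sqr_ge0 (`|f x|); have := sqr_ge0 (`|g x|).
by move: (`|f x|) (`|g x|) => a b; rewrite !expr2; lra.
Qed.

Lemma sqi_lin (t : R) f g : sqi f -> sqi g -> sqi (fun x => f x + t * g x).
Proof.
move=> sf sg; have [mf If] := sf; have [mg Ig] := sg; split.
  by apply: measurable_funD => //; apply: measurable_funM.
apply: (eq_integrable mD (fun x => (f x ^+ 2)%:E + ((2 * t)%:E * (f x * g x)%:E +
   (t ^+ 2)%:E * (g x ^+ 2)%:E)))%E.
  by move=> x _; rewrite -!EFinM -!EFinD; congr EFin; ring.
apply: integrableD => //; apply: integrableD => //; apply: integrableZl => //.
exact: sqi_mul.
Qed.

Lemma sqi0 : sqi (fun=> 0).
Proof.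
split=> //; rewrite (_ : (fun _ => _) = cst 0%E); first exact: integrable0.
by apply/funext => x; rewrite expr0n.
Qed.

Lemma sqiB f g : sqi f -> sqi g -> sqi (fun x => f x - g x).
Proof.
move=> sf sg; have := sqi_lin (-1) sf sg.
by congr square_integrable; apply/funext => x; rewrite mulN1r.
Qed.

Lemma sqi_sum (I : Type) (r : seq I) (F : I -> T -> R) :
  (forall i, sqi (F i)) -> sqi (fun x => \sum_(i <- r) F i x).
Proof.
move=> sF; elim: r => [|i r IH]; first by under eq_fun do rewrite big_nil; exact: sqi0.
under eq_fun do rewrite big_cons; have := sqi_lin 1 (sF i) IH.
by congr square_integrable; apply/funext => x; rewrite mul1r.
Qed.

Definition ip f g : R := \int[mu]_(x in D) (f x * g x).

Lemma ipE f g : ip f g = \int[mu]_(x in D) (f x * g x). Proof. by []. Qed.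

Lemma ipC f g : ip f g = ip g f.
Proof. by congr Rintegral; apply/funext => x; rewrite mulrC. Qed.

Lemma ip_lin (t : R) f g h : sqi f -> sqi g -> sqi h ->
  ip (fun x => f x + t * g x) h = ip f h + t * ip g h.
Proof.
move=> sf sg sh; rewrite /ip -RintegralZl//; last exact: sqi_mul.
rewrite -RintegralD//; [|exact: sqi_mul|].
  by apply: eq_Rintegral => x _; ring.
exact: (integrableZl mD t (sqi_mul sg sh)).
Qed.

Lemma ip_ge0 f : 0 <= ip f f.
Proof. by apply: Rintegral_ge0 => x _; rewrite -expr2 sqr_ge0. Qed.

Lemma ip_ae f f' g : sqi f -> sqi f' -> sqi g -> ae_eq mu D f f' -> ip f g = ip f' g.
Proof.
move=> sf sf' sg ff'; congr fine; apply: ae_eq_integral => //.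
- by apply/measurable_EFinP; apply: measurable_funM; exact: sqi_measurable.
- by apply/measurable_EFinP; apply: measurable_funM; exact: sqi_measurable.
by move: ff'; apply: filterS => x h Dx; rewrite (h Dx).
Qed.

Lemma ip_eq0 f : sqi f -> ip f f = 0 -> ae_eq mu D f (fun=> 0).
Proof.
move=> sf f0; have [mf If] := sf.
have E : (\int[mu]_(x in D) `|(f x ^+ 2)%:E|)%E = 0%E.
  transitivity (ip f f)%:E; last by rewrite f0.
  rewrite /ip /Rintegral fineK; last exact: (integrable_fin_num mD (sqi_mul sf sf)).
  by apply: eq_integral => x _; rewrite gee0_abs ?lee_fin ?sqr_ge0// expr2.
have /(ae_eq_integral_abs _ mD) : measurable_fun D (fun x => (f x ^+ 2)%:E).
  by apply/measurable_EFinP; exact: measurable_funX.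
move=> /(_ mu)[/(_ E) h _]; move: h; apply: filterS => x h Dx.
by have /eqP := h Dx; rewrite eqe sqrf_eq0 => /eqP.
Qed.

Lemma ip_sumr (I : Type) (r : seq I) (F : I -> T -> R) f : sqi f -> (forall i, sqi (F i)) ->
  ip f (fun x => \sum_(i <- r) F i x) = \sum_(i <- r) ip f (F i).
Proof.
move=> sf sF; elim: r => [|i r IH].
  rewrite big_nil /ip; under eq_Rintegral do rewrite big_nil mulr0.
  by rewrite Rintegral_cst// mul0r.
rewrite big_cons -IH ipC -[ip f (F i)]ipC [ip f (fun _ => _)]ipC -[X in _ + X]mul1r.
rewrite -ip_lin//; last exact: sqi_sum.
by congr ip; apply/funext => x; rewrite big_cons mul1r.
Qed.

Lemma Rintegral_sum_mul (I : finType) (F G : I -> T -> R) : 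
  (forall i, sqi (F i)) -> (forall i, sqi (G i)) ->
  \int[mu]_(x in D) (\sum_i F i x * G i x) = \sum_i ip (F i) (G i).
Proof.
move=> sF sG; rewrite -!(big_enum _ _ _ _) /=.
under eq_Rintegral do rewrite -big_enum /=.
elim: (enum I) => [|i r IH].
  by rewrite big_nil; under eq_Rintegral do rewrite big_nil; rewrite Rintegral_cst// mul0r.
rewrite big_cons -IH /ip -RintegralD//; last 2 first.
- exact: sqi_mul.
- have -> : EFin \o (fun x : T => \sum_(j <- r) F j x * G j x) =
    (fun x => \sum_(j <- r) (F j x * G j x)%:E)%E.
    by apply/funext => x /=; rewrite sumEFin.
  by apply: (@integrable_sum _ _ _ mu D mD _ r xpredT (fun j x => (F j x * G j x)%:E)) => j _; exact: sqi_mul.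
by apply: eq_Rintegral => x _; rewrite big_cons.
Qed.

(** Evaluate at the minimiser t = - b / c; if c = 0, an affine function bounded below is constant.
    It yields Cauchy-Schwarz both in L2 and in R^n. *)
Lemma discriminant_le (a b c : R) : 0 <= c ->
  (forall t, 0 <= a + 2 * t * b + t ^+ 2 * c) -> b ^+ 2 <= a * c.
Proof.
rewrite le_eqVlt => /orP[/eqP c0|c0] H; last first.
have := H (- b / c); have -> : a + 2 * (- b / c) * b + (- b / c) ^+ 2 * c = a - b ^+ 2 / c.
    by field; rewrite gt_eqF.
  by rewrite subr_ge0 ler_pdivrMr.
rewrite -c0 mulr0; have [->|b0] := eqVneq b 0; first by rewrite expr0n.
  exfalso; have := H (- (a + 1) / (2 * b)); rewrite -c0 mulr0 addr0.
  have -> : a + 2 * (- (a + 1) / (2 * b)) * b = -1 by field.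
  by rewrite ler0N1.
Qed.

Lemma ip_CS f g : sqi f -> sqi g -> ip f g ^+ 2 <= ip f f * ip g g.
Proof.
move=> sf sg; apply: discriminant_le => [|t]; first exact: ip_ge0.
have := ip_ge0 (fun x => f x + t * g x); have sl := sqi_lin t sf sg.
rewrite ip_lin// [ip f _]ipC [ip g (fun _ => _)]ipC !ip_lin// [ip g f]ipC.
by move: (ip f f) (ip f g) (ip g g) => a b c; rewrite expr2; lra.
Qed.

Lemma ip_CS_sqrt f g : sqi f -> sqi g ->
  `|ip f g| <= Num.sqrt (ip f f) * Num.sqrt (ip g g).
Proof.
move=> sf sg; rewrite -sqrtrM ?ip_ge0// -sqrtr_sqr ler_sqrt ?sqr_ge0 ?ip_CS//.
by rewrite mulr_ge0 ?ip_ge0.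
Qed.

End square_integrable.

Opaque ip.

(** * The fundamental lemma of the calculus of variations *)

Section du_Bois_Reymond.
Context {R : realType} {n : nat}.
Local Notation Rn := 'rV[R]_n.
Local Notation leb := (lebesgue_rV R n).

(** The open sets are a pi-system, so this description of the sigma-algebra opens the way to Dynkin
    induction. *)
Lemma sigma_algebra_open_rV : rV_display.-measurable = <<s [set U : set Rn | open U] >>.
Proof.
apply/seteqP; split; last first.
  apply: smallest_sub; first exact: sigma_algebra_measurable.
  by move=> U; exact: open_measurable_rV.
pose T' := g_sigma_algebraType [set U : set Rn | open U].
have mc (i : 'I_n) : measurable_fun setT (fun x : T' => (x : Rn) ord0 i : measurableTypeR R).
  apply: (measurability _ (RGenOInfty.measurableE R)).
  move=> _ [_ [a ->] <-]; rewrite setTI; apply: sub_sigma_algebra.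
  by have /continuousP := @continuous_coord R n i; apply; exact: interval_open.
apply: smallest_sub; first exact: smallest_sigma_algebra.
move=> A; rewrite -bigcup_seq => -[i _ [B mB <-]].
exact: mc.
Qed.

Variable Om : set Rn.
Hypotheses (oOm : open Om) (bOm : bounded_set Om).

Lemma test_function_sub (U : set Rn) phi : U `<=` Om -> test_function U phi -> test_function Om phi.
Proof. by move=> UO [sp [K [cK KU K0]]]; split => //; exists K; split => //; exact: subset_trans UO. Qed.

(** When Om is open, each of its points has eta k = 1 for large k, so the sequence converges
    pointwise to the indicator function of Om. *)
Lemma cutoff_to1 : exists eta : nat -> Rn -> R, forall (k : nat),
  test_function Om (eta k) /\ (forall x, 0 <= eta k x <= 1) /\
  (forall x, ball x (4 * k.+1%:R^-1) `<=` Om -> eta k x = 1).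
Proof.
have [C C0 hC] := @cutoff R n.
suff : forall k : nat, exists eta : Rn -> R, test_function Om eta /\ (forall x, 0 <= eta x <= 1) /\
  (forall x, ball x (4 * k.+1%:R^-1) `<=` Om -> eta x = 1) by move=> /choice[eta h]; exists eta.
move=> k; have k0 : 0 < (k.+1%:R^-1 : R) by rewrite invr_gt0.
have [eta [K [se [cK KO] K0 [e01 _] e1]]] := hC Om _ bOm k0.
exists eta; split; first by split => //; exists K; split.
by split => // x /e1[].
Qed.

End du_Bois_Reymond.

Section du_Bois_Reymond2.
Context {R : realType} {n : nat}.
Local Notation Rn := 'rV[R]_n.
Local Notation leb := (lebesgue_rV R n).
Variable Om : set Rn.
Hypotheses (oOm : open Om) (bOm : bounded_set Om).
Variable w : Rn -> R.
Hypotheses (Iw : leb.-integrable Om (EFin \o w)).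
Hypothesis w0 : forall phi, test_function Om phi -> \int[leb]_(x in Om) (w x * phi x) = 0.

Let mOm : measurable Om. Proof. exact: open_measurable_rV. Qed.

(** Test w against cutoffs of U, which are also test functions on Om, and pass to the limit with |w|
    as dominating function. *)
Let int_open U : open U -> U `<=` Om -> (\int[leb]_(x in U) (w x)%:E = 0)%E.
Proof.
move=> oU UO; have bU : bounded_set U.
  by case: bOm => M [rM hM]; exists M; split => // y /hM h x /UO /h.
have [eta heta] := cutoff_to1 bU.
have mU : measurable U by exact: open_measurable_rV.
have mw : measurable_fun Om w by apply/measurable_EFinP; exact: (measurable_int leb).
have mwe k : measurable_fun Om (fun x => (w x * eta k x)%:E).
  apply/measurable_EFinP; apply: measurable_funM => //.
  by apply: measurable_fun_cont => //; apply: smooth_continuous; have [[]] := heta k.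
pose S k := (\int[leb]_(x in Om) (w x * eta k x)%:E)%E.
have H : S @ \oo --> (\int[leb]_(x in Om) (w x * \1_U x)%:E)%E.
  have := @dominated_convergence _ Rn R leb Om mOm (fun k x => (w x * eta k x)%:E)
    (fun x => (w x * \1_U x)%:E) (fun x => `|(w x)%:E|%E) mwe.
  move=> DC; refine (let: And3 _ _ h := DC _ _ _ _ in h).
  - apply/measurable_EFinP; exact: measurable_funM.
  - apply: aeW => x _; apply: cvg_EFin; first exact: nearW.
    apply: cvgMr; rewrite indicE; have [Ux|Ux] := pselect (U x); last first.
      rewrite memNset//; apply: cvg_near_cst; apply: nearW => k.
      by have [[_ [K [_ KU K0]]] _] := heta k; apply: K0 => /KU.
    rewrite mem_set//.
    have /nbhs_ballP[e /= e0 he] : nbhs x U by exact: open_nbhs_nbhs.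
    have [k _ hk] := near_infty_natSinv_lt (PosNum (divr_gt0 e0 (@ltr0Sn R 3))).
    apply: cvg_near_cst; exists k => // m /= km; have [_ [_ h]] := heta m; apply: h.
    move=> y xy; apply: he; apply: le_ball xy; rewrite mulrC -ler_pdivlMr//.
    by apply: ltW; exact: (hk m).
  - exact: integrable_abse.
  - apply: aeW => x k _ /=; rewrite lee_fin normrM ler_piMr//.
    by have [_ [/(_ x)/andP[h1 h2] _]] := heta k; rewrite ger0_norm.
have S0 : S = fun=> 0%E.
  apply/funext => k; have [tk [ek _]] := heta k; rewrite /S.
  have := w0 (test_function_sub UO tk); rewrite /Rintegral => h.
  rewrite -[LHS]fineK ?h//; apply: integrable_fin_num => //.
  apply: (le_integrable mOm (mwe k) _ Iw) => x _; rewrite /= lee_fin normrM ler_piMr//.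
  by have /andP[h1 h2] := ek x; rewrite ger0_norm.
rewrite S0 in H; have := cvg_unique (@ereal_hausdorff R) H (cvg_cst _).
rewrite (_ : (\int[leb]_(x in U) _)%E = (\int[leb]_(x in Om) (w x * \1_U x)%:E)%E) => [-> //|].
rewrite -[in LHS](setIidr UO) integral_mkcondr; apply: eq_integral => x _.
by rewrite patchE indicE; case: ifP => _; rewrite ?mulr1 ?mulr0.
Qed.

(** The sets A such that w has integral 0 on Om [&] A form a Dynkin system containing the open sets,
    hence all Borel sets; a function with zero integral on every measurable subset of Om vanishes
    almost everywhere. *)
Lemma du_Bois_Reymond : ae_eq leb Om w (fun=> 0).
Proof.
have IwS A : measurable A -> leb.-integrable (Om `&` A) (EFin \o w).
  by move=> mA; apply: integrableS Iw => //; exact: measurableI.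
have key : forall A, <<s [set U : set Rn | open U] >> A ->
    (\int[leb]_(x in Om `&` A) (w x)%:E = 0)%E.
  apply: dynkin_induction.
  - exact: sigma_algebra_open_rV.
  - by move=> A B oA oB; exact: openI.
  - by rewrite setIT; exact: int_open.
  - by move=> U oU; apply: int_open => [|x []//]; exact: openI.
  - move=> A mA A0.
    have := @integral_setU _ _ _ leb (Om `&` A) (Om `&` ~` A) (EFin \o w).
    rewrite -setIUr setUv setIT => H.
    have : (\int[leb]_(x in Om) (w x)%:E = 0)%E by exact: int_open.
    rewrite H/= ?A0 ?add0e//; [exact: measurableI|apply: measurableI => //; exact: measurableC| |].
      exact: (measurable_int leb).
    by apply/disj_setPS => x [[_ +] [_]]; exact.
  - move=> F mF tF F0; rewrite setI_bigcupr integral_bigcup//.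
    + by apply: eseries0 => k _ _; exact: F0.
    + by apply/trivIsetP => i j _ _ ij; move/trivIsetP : tF => /(_ i j I I ij) Fij;
        rewrite setIACA Fij setI0.
    + by move=> k; exact: measurableI.
    + by rewrite -setI_bigcupr; apply: IwS; exact: bigcup_measurable.
have H := @integral_ae_eq _ _ _ leb Om mOm (cst 0%E) (EFin \o w) Iw (measurable_cst _).
have {}H : ae_eq leb Om (EFin \o w) (cst 0%E).
  apply: H => E EO mE; rewrite integral0 -(setIidr EO); apply: key.
  by rewrite -sigma_algebra_open_rV.
by move: H; apply: filterS => x h Ox; have [] := h Ox.
Qed.

End du_Bois_Reymond2.

(** * Sobolev spaces *)

Section sobolev_space.
Context {R : realType} {n : nat}.
Local Notation Rn := 'rV[R]_n.
Local Notation leb := (lebesgue_rV R n).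
Variable Om : set Rn.
Hypotheses (oOm : open Om) (bOm : bounded_set Om).
Local Notation ipO := (ip (mu := leb) (D := Om)).
Local Notation wp := (wpartial Om).
Local Notation aeO := (ae_eq leb Om).
Implicit Types (u v w f g : Rn -> R).

Let mOm : measurable Om. Proof. exact: open_measurable_rV. Qed.

(** Om has finite measure and |v| <= 1 + v^2. *)
Lemma L2_integrable v : L2 Om v -> leb.-integrable Om (EFin \o v).
Proof.
move=> [mv Iv].
have I1 : leb.-integrable Om (EFin \o (fun=> 1 : R)).
  by apply: integrable_cont => // x; exact: cst_continuous.
apply: (le_integrable mOm _ _ (integrableD mOm I1 Iv)); first exact/measurable_EFinP.
move=> x Dx; change (`|v x|%:E <= `|1 + v x ^+ 2|%:E)%E.
rewrite lee_fin [leRHS]ger0_norm ?addr_ge0 ?sqr_ge0//.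
rewrite -[v x ^+ 2]real_normK ?num_real//; have := sqr_ge0 (`|v x| - 1); have := normr_ge0 (v x).
by move: (`|v x|) => a; rewrite !expr2; lra.
Qed.

Lemma continuous_L2 f : continuous f -> L2 Om f.
Proof.
move=> cf; split; first exact: measurable_fun_cont.
apply: (@integrable_cont _ _ Om (fun x => f x ^+ 2)) => // x.
by apply: continuousM; exact: cf.
Qed.

Lemma smooth_L2 f : smooth f -> L2 Om f.
Proof. by move=> /smooth_continuous; exact: continuous_L2. Qed.

Lemma test_partial phi i : test_function Om phi -> test_function Om (partial i phi).
Proof.
move=> [sp [K [cK KO K0]]]; split; first exact: smooth_partial.
exists K; split => // x; apply: partial_outside K0.
exact: compact_closed (@norm_hausdorff _ _) cK.
Qed.

Lemma wpartialP i v : H1 Om v -> L2 Om (wp i v) /\ is_weak_partial Om i v (wp i v).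
Proof.
move=> [_ /(_ i)[w Lw Ww]].
by apply: (@xgetPex _ (fun=> 0) [set w | L2 Om w /\ is_weak_partial Om i v w]); exists w.
Qed.

Lemma wpartial_L2 i v : H1 Om v -> L2 Om (wp i v).
Proof. by move=> /(wpartialP i)[]. Qed.

Lemma H1_L2 v : H1 Om v -> L2 Om v. Proof. by case. Qed.

Lemma weak_lin i (t : R) u v u' v' : L2 Om u -> L2 Om v -> L2 Om u' -> L2 Om v' ->
  is_weak_partial Om i u u' -> is_weak_partial Om i v v' ->
  is_weak_partial Om i (fun x => u x + t * v x) (fun x => u' x + t * v' x).
Proof.
move=> Lu Lv Lu' Lv' Wu Wv phi tp; have [sp _] := tp.
have Lp := smooth_L2 sp; have Ldp := smooth_L2 (smooth_partial i sp).
have := ip_lin mOm t Lu Lv Ldp; have := ip_lin mOm t Lu' Lv' Lp; rewrite !ipE => -> ->.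
by rewrite (Wu _ tp) (Wv _ tp); ring.
Qed.

(** The difference of two weak derivatives is orthogonal to all test functions. *)
Lemma weak_unique i v w w' : L2 Om w -> L2 Om w' ->
  is_weak_partial Om i v w -> is_weak_partial Om i v w' -> aeO w w'.
Proof.
move=> Lw Lw' Ww Ww'.
have LB := sqiB mOm Lw Lw'.
have H : aeO (fun x => w x - w' x) (fun=> 0).
  apply: du_Bois_Reymond => //; first exact: L2_integrable.
  move=> phi tp; have [sp _] := tp.
  have := ip_lin mOm (-1) Lw Lw' (smooth_L2 sp); rewrite !ipE => E.
  transitivity (\int[leb]_(x in Om) ((w x + -1 * w' x) * phi x)).
    by apply: eq_Rintegral => x _; rewrite mulN1r.
  rewrite E; have := Ww _ tp; rewrite (Ww' _ tp) => /oppr_inj ->.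
  by rewrite mulN1r subrr.
by move: H; apply: filterS => x h Ox; apply/eqP; rewrite -subr_eq0; apply/eqP; exact: h.
Qed.

Lemma weak_partial_eq i v w : H1 Om v -> L2 Om w -> is_weak_partial Om i v w -> aeO (wp i v) w.
Proof. by move=> /(wpartialP i)[L W] Lw Ww; exact: weak_unique W Ww. Qed.

Lemma H1_lin (t : R) u v : H1 Om u -> H1 Om v -> H1 Om (fun x => u x + t * v x).
Proof.
move=> Hu Hv; split; first exact: (sqi_lin mOm t (H1_L2 Hu) (H1_L2 Hv)).
move=> i; have [Lu Wu] := wpartialP i Hu; have [Lv Wv] := wpartialP i Hv.
exists (fun x => wp i u x + t * wp i v x); first exact: (sqi_lin mOm).
by apply: weak_lin => //; exact: H1_L2.
Qed.

Lemma H1B u v : H1 Om u -> H1 Om v -> H1 Om (u \- v).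
Proof.
move=> Hu Hv; have := H1_lin (-1) Hu Hv.
by congr (H1 Om); apply/funext => x; rewrite mulN1r.
Qed.

(** [wpartial] chooses a representative separately for each function, so linearity can only hold
    almost everywhere; inner products do not see the exceptional set. *)
Lemma wpartial_lin i (t : R) u v : H1 Om u -> H1 Om v ->
  aeO (wp i (fun x => u x + t * v x)) (fun x => wp i u x + t * wp i v x).
Proof.
move=> Hu Hv; have [Lu Wu] := wpartialP i Hu; have [Lv Wv] := wpartialP i Hv.
apply: weak_partial_eq; first exact: H1_lin.
  exact: (sqi_lin mOm).
by apply: weak_lin => //; exact: H1_L2.
Qed.

Lemma weak_smooth i f : smooth f -> is_weak_partial Om i f (partial i f).
Proof.
move=> sf phi tp; have [sp [K [cK KO K0]]] := tp.
have sfp := smoothM sf sp.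
have H : \int[leb]_(x in Om) partial i (fun x => f x * phi x) x = 0.
  have fp0 x : ~ K x -> f x * phi x = 0 by move=> /K0 ->; rewrite mulr0.
  rewrite Rintegral_supp; first exact: (Rintegral_partial _ sfp cK).
  move=> x Ox; apply: partial_outside fp0 _; last by move/KO.
  exact: compact_closed (@norm_hausdorff _ _) cK.
move: H; rewrite partialM// RintegralD//.
- move=> /eqP; rewrite addr_eq0 => /eqP ->; congr (- _).
  by apply: eq_Rintegral => x _; rewrite mulrC.
- by apply: (sqi_mul mOm); apply: smooth_L2 => //; exact: smooth_partial.
- by apply: (sqi_mul mOm); apply: smooth_L2 => //; exact: smooth_partial.
Qed.

Lemma smooth_H1 f : smooth f -> H1 Om f.
Proof.
move=> sf; split; first exact: smooth_L2.
move=> i; exists (partial i f); last exact: weak_smooth.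
by apply: smooth_L2; exact: smooth_partial.
Qed.

Lemma wpartial_smooth i f : smooth f -> aeO (wp i f) (partial i f).
Proof.
move=> sf; apply: weak_partial_eq; first exact: smooth_H1.
  by apply: smooth_L2; exact: smooth_partial.
exact: weak_smooth.
Qed.

(** The sum stands outside the integral, unlike in [dirichlet], so that bilinearity and positivity
    come term by term from [ip]. The two agree on H1 by [dirichletE]. *)
Definition dir u v : R := \sum_i ipO (wp i u) (wp i v).

Lemma dirE u v : dir u v = \sum_i ipO (wp i u) (wp i v). Proof. by []. Qed.

Lemma dirichletE u v : H1 Om u -> H1 Om v -> dirichlet Om u v = dir u v.
Proof.
by move=> Hu Hv; apply: Rintegral_sum_mul => // i; exact: wpartial_L2.
Qed.

Lemma dirC u v : dir u v = dir v u.
Proof. by apply: eq_bigr => i _; exact: ipC. Qed.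

Lemma dir_ge0 u : 0 <= dir u u.
Proof. by apply: sumr_ge0 => i _; exact: ip_ge0. Qed.

Lemma ip_wpartial_lin i (t : R) u v w : H1 Om u -> H1 Om v -> L2 Om w ->
  ipO (wp i (fun x => u x + t * v x)) w = ipO (wp i u) w + t * ipO (wp i v) w.
Proof.
move=> Hu Hv Lw; have Lu := wpartial_L2 i Hu; have Lv := wpartial_L2 i Hv.
rewrite -(ip_lin mOm t Lu Lv Lw); apply: ip_ae => //.
- by apply: wpartial_L2; exact: H1_lin.
- exact: (sqi_lin mOm).
- exact: wpartial_lin.
Qed.

Lemma dir_lin (t : R) u v w : H1 Om u -> H1 Om v -> H1 Om w ->
  dir (fun x => u x + t * v x) w = dir u w + t * dir v w.
Proof.
move=> Hu Hv Hw; rewrite /dir mulr_sumr -big_split /=; apply: eq_bigr => i _.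
by apply: ip_wpartial_lin => //; exact: wpartial_L2.
Qed.

Lemma H1norm_sq v : H1norm Om v ^+ 2 = ipO v v + dir v v.
Proof.
rewrite /H1norm sqr_sqrtr.
  by rewrite ipE; congr (_ + _); apply: eq_bigr => i _; rewrite ipE.
by apply: addr_ge0; [|apply: sumr_ge0 => i _]; apply: Rintegral_ge0 => x _; exact: sqr_ge0.
Qed.

Lemma H1norm_ge0 v : 0 <= H1norm Om v. Proof. exact: sqrtr_ge0. Qed.

Lemma ip_wpartial_le_dir i v : ipO (wp i v) (wp i v) <= dir v v.
Proof.
by rewrite /dir (bigD1 i)//= lerDl; apply: sumr_ge0 => j _; exact: ip_ge0.
Qed.

Opaque dir H1norm wpartial.

Lemma subE u v : u \- v = (fun x => u x + (-1) * v x).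
Proof. by apply/funext => x /=; rewrite mulN1r. Qed.

Lemma ipBl u v w : L2 Om u -> L2 Om v -> L2 Om w -> ipO (u \- v) w = ipO u w - ipO v w.
Proof. by move=> *; rewrite subE ip_lin// mulN1r. Qed.

Lemma ipBr u v w : L2 Om u -> L2 Om v -> L2 Om w -> ipO w (u \- v) = ipO w u - ipO w v.
Proof. by move=> *; rewrite ipC ipBl// ipC [ipO v _]ipC. Qed.

Lemma ip_wpartialBl i u v w : H1 Om u -> H1 Om v -> L2 Om w ->
  ipO (wp i (u \- v)) w = ipO (wp i u) w - ipO (wp i v) w.
Proof. by move=> *; rewrite subE ip_wpartial_lin// mulN1r. Qed.

Lemma ip_wpartialBr i u v w : H1 Om u -> H1 Om v -> L2 Om w ->
  ipO w (wp i (u \- v)) = ipO w (wp i u) - ipO w (wp i v).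
Proof. by move=> *; rewrite ipC ip_wpartialBl// ipC [ipO (wp i v) _]ipC. Qed.

Lemma dirBl u v w : H1 Om u -> H1 Om v -> H1 Om w -> dir (u \- v) w = dir u w - dir v w.
Proof. by move=> *; rewrite subE dir_lin// mulN1r. Qed.

Lemma dirBr u v w : H1 Om u -> H1 Om v -> H1 Om w -> dir w (u \- v) = dir w u - dir w v.
Proof. by move=> Hu Hv Hw; rewrite (dirC w) (dirBl Hu Hv Hw) (dirC u) (dirC v). Qed.

Lemma ip_le_H1norm v : ipO v v <= H1norm Om v ^+ 2.
Proof. by rewrite H1norm_sq lerDl dir_ge0. Qed.

Lemma dir_le_H1norm v : dir v v <= H1norm Om v ^+ 2.
Proof. by rewrite H1norm_sq lerDr ip_ge0. Qed.

Lemma sqrt_ip_le_H1norm v : Num.sqrt (ipO v v) <= H1norm Om v.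
Proof.
by rewrite -[leRHS]ger0_norm ?H1norm_ge0// -sqrtr_sqr ler_sqrt ?sqr_ge0// ip_le_H1norm.
Qed.

Lemma sqrt_ip_wpartial_le_H1norm i v : Num.sqrt (ipO (wp i v) (wp i v)) <= H1norm Om v.
Proof.
rewrite -[leRHS]ger0_norm ?H1norm_ge0// -sqrtr_sqr ler_sqrt ?sqr_ge0//.
exact: le_trans (ip_wpartial_le_dir i v) (dir_le_H1norm v).
Qed.

Lemma H1norm_sqB u v : H1 Om u -> H1 Om v ->
  H1norm Om (u \- v) ^+ 2 <= 2 * H1norm Om u ^+ 2 + 2 * H1norm Om v ^+ 2.
Proof.
suff H : H1 Om u -> H1 Om v -> ipO (u \- v) (u \- v) + dir (u \- v) (u \- v) <=
    2 * (ipO u u + dir u u) + 2 * (ipO v v + dir v v).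
  by move=> Hu Hv; have := H Hu Hv; rewrite -!H1norm_sq.
move=> Hu Hv; have HB := H1_lin 1 Hu Hv; have HD := H1B Hu Hv.
have Lu := H1_L2 Hu; have Lv := H1_L2 Hv.
have := addr_ge0 (ip_ge0 (mu := leb) (D := Om) (fun x => u x + 1 * v x))
  (dir_ge0 (fun x => u x + 1 * v x)).
have LD := H1_L2 HD; have LB := H1_L2 HB.
rewrite (ipBl Lu Lv LD) (ipBr Lu Lv Lu) (ipBr Lu Lv Lv).
rewrite (dirBl Hu Hv HD) (dirBr Hu Hv Hu) (dirBr Hu Hv Hv) (ip_lin mOm 1 Lu Lv LB).
rewrite (dir_lin 1 Hu Hv HB) (ipC u (fun x => u x + 1 * v x)) (ipC v (fun x => u x + 1 * v x)).
rewrite (ip_lin mOm 1 Lu Lv Lu) (ip_lin mOm 1 Lu Lv Lv).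
rewrite (dirC u (fun x => u x + 1 * v x)) (dirC v (fun x => u x + 1 * v x)).
rewrite (dir_lin 1 Hu Hv Hu) (dir_lin 1 Hu Hv Hv).
rewrite [ipO v u]ipC [dir v u]dirC.
by move: (ipO u u) (ipO u v) (ipO v v) (dir u u) (dir u v) (dir v v) => a b c d e f; lra.
Qed.

Lemma H1norm0 v : H1 Om v -> H1norm Om (v \- v) = 0.
Proof.
move=> Hv; apply/eqP; rewrite -sqrf_eq0 H1norm_sq; have HD := H1B Hv Hv.
have L := H1_L2 Hv; have LD := H1_L2 HD.
by rewrite (ipBl L L LD) (dirBl Hv Hv HD) !subrr addr0.
Qed.

Lemma test_H10 phi : test_function Om phi -> H10 Om phi.
Proof.
move=> tp; have [sp _] := tp; split; first exact: smooth_H1.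
by move=> e e0; exists phi => //; rewrite H1norm0//; exact: smooth_H1.
Qed.

(** Density argument: an additive functional bounded in the H1 norm is determined by its values on
    test functions. *)
Lemma H10_ind (L : (Rn -> R) -> R) (M : R) :
  (forall u v, H1 Om u -> H1 Om v -> L (u \- v) = L u - L v) ->
  (forall v, H1 Om v -> `|L v| <= M * H1norm Om v) ->
  (forall phi, test_function Om phi -> L phi = 0) ->
  forall psi, H10 Om psi -> L psi = 0.
Proof.
move=> LB LM L0 psi [Hpsi dpsi]; apply/eqP; rewrite -normr_le0.
apply/ler_addgt0Pl => e e0; rewrite addr0.
(* The sign of M is unknown and M may vanish, hence the divisor |M| + 1. *)
have M1 : 0 < `|M| + 1 by rewrite ltr_wpDl.
have [phi tp lt] := dpsi (e / (`|M| + 1)) (divr_gt0 e0 M1).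
have Hphi : H1 Om phi by apply: smooth_H1; case: tp.
have := LM _ (H1B Hpsi Hphi); rewrite LB// (L0 _ tp) subr0 => /le_trans; apply.
rewrite ltr_pdivlMr// in lt; have := H1norm_ge0 (psi \- phi).
have := ler_norm M; move: (H1norm _ _) lt => N; nra.
Qed.

Lemma ibp_H10 i v psi : H1 Om v -> H10 Om psi -> ipO v (wp i psi) = - ipO (wp i v) psi.
Proof.
move=> Hv Hpsi; apply/eqP; rewrite -addr_eq0; apply/eqP.
have [Lw Ww] := wpartialP i Hv; have Lv := H1_L2 Hv.
apply: (@H10_ind (fun psi => ipO v (wp i psi) + ipO (wp i v) psi)
  (Num.sqrt (ipO v v) + Num.sqrt (ipO (wp i v) (wp i v)))) => //.
- move=> a b Ha Hb; rewrite ip_wpartialBr// ipBr//; try exact: H1_L2.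
  by rewrite opprD addrACA.
- move=> a Ha; rewrite mulrDl (le_trans (ler_normD _ _))// lerD//.
    rewrite (le_trans (ip_CS_sqrt mOm Lv (wpartial_L2 i Ha)))// ler_wpM2l ?sqrtr_ge0//.
    exact: sqrt_ip_wpartial_le_H1norm.
  rewrite (le_trans (ip_CS_sqrt mOm Lw (H1_L2 Ha)))// ler_wpM2l ?sqrtr_ge0//.
  exact: sqrt_ip_le_H1norm.
- move=> phi tp; have [sp _] := tp; have := Ww _ tp => E.
  rewrite ipC (ip_ae mOm (wpartial_L2 i (smooth_H1 sp)) _ Lv (wpartial_smooth i sp)); last first.
    by apply: smooth_L2; exact: smooth_partial.
  by rewrite ipC !ipE E addNr.
Qed.

Lemma smooth1_id : smooth1 (@id R).
Proof.
case=> [//|k]; apply/D1SP; split=> [x|]; first exact: derivable_id.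
rewrite (_ : _^`()%classic = cst (1 : R)); first exact: D1_cst.
by apply/funext => x; rewrite derive1_id.
Qed.

(** For a test function phi, the integral of the i-th derivative of x_i phi^2 vanishes, and |x_i| <=
    M on Om; one direction suffices. Passing to H10 by approximation loses a factor 2 twice, which
    turns 4 M^2 into 16 M^2. *)
Lemma poincare (i : 'I_n) : exists2 C : R, 0 < C &
  forall psi, H10 Om psi -> ipO psi psi <= C * dir psi psi.
Proof.
have [M M0 hM] : exists2 M, 0 < M & forall x, Om x -> `|x| <= M.
  exact: (pinfty_ex_gt0 bOm).
have test phi : test_function Om phi -> ipO phi phi <= 4 * M ^+ 2 * dir phi phi.
  move=> tp; have [sp [K [cK KO K0]]] := tp.
  pose X (x : Rn) := x ord0 i.
  have sX : smooth X by exact: (smooth_coord i smooth1_id).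
  have spp := smoothM sp sp; have sXp := smoothM sX spp; have sdp := smooth_partial i sp.
  have H : \int[leb]_(x in Om) partial i (fun x => X x * (phi x * phi x)) x = 0.
    have f0 x : ~ K x -> X x * (phi x * phi x) = 0 by move=> /K0 ->; rewrite !mulr0.
    rewrite Rintegral_supp; first exact: (Rintegral_partial _ sXp cK).
    move=> x Ox; apply: partial_outside f0 _; last by move/KO.
    exact: compact_closed (@norm_hausdorff _ _) cK.
  have E x : partial i (fun x => X x * (phi x * phi x)) x =
      phi x * phi x + (2 * X x * phi x) * partial i phi x.
    rewrite partialM// partialM//.
    have -> : partial i X x = 1.
      by rewrite [partial i X](@partial_coord _ _ id i i) eqxx derive1_id.
    by ring.
  have Xle x : Om x -> X x ^+ 2 <= M ^+ 2.
    move=> /hM xM; rewrite -[leLHS]real_normK ?num_real// lerXn2r ?nnegrE ?(ltW M0)//.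
    exact: le_trans (coord_le_norm _ _) xM.
  have Lp := smooth_L2 sp; have Ldp := smooth_L2 sdp.
  have I1 := sqi_mul mOm Lp Lp; have I2 := sqi_mul mOm Ldp Ldp.
  (* Pointwise, (phi + 2 x_i d_i phi)^2 >= 0 absorbs half of phi^2 and leaves 2 x_i^2 (d_i phi)^2 <=
     2 M^2 (d_i phi)^2. *)
  have le1 : \int[leb]_(x in Om) (1 / 2 * (phi x * phi x) +
      (- (2 * M ^+ 2)) * (partial i phi x * partial i phi x)) <= 0.
    rewrite -[leRHS]H; apply: le_Rintegral => //.
    - exact: (integrableD mOm (integrableZl mOm _ I1) (integrableZl mOm _ I2)).
    - by apply: integrable_cont => //; exact: smooth_continuous (smooth_partial i sXp).
    move=> x Ox; rewrite E; have := sqr_ge0 (phi x + 2 * X x * partial i phi x).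
    have := ler_wpM2r (sqr_ge0 (partial i phi x)) (Xle x Ox).
    by move: (phi x) (X x) (partial i phi x) => p q r; rewrite !expr2; lra.
  move: le1; rewrite RintegralD//; [|exact: (integrableZl mOm _ I1)|exact: (integrableZl mOm _ I2)].
  rewrite !RintegralZl// -!ipE => le1.
  apply: (@le_trans _ _ (4 * M ^+ 2 * ipO (partial i phi) (partial i phi))).
    by move: le1; move: (ipO _ _) (ipO _ _) => p q; lra.
  apply: ler_wpM2l; first by rewrite mulr_ge0// sqr_ge0.
  apply: (le_trans _ (ip_wpartial_le_dir i phi)).
  have Lw := wpartial_L2 i (smooth_H1 sp); have Ew := wpartial_smooth i sp.
  by rewrite (ip_ae mOm Lw Ldp Lw Ew) ipC (ip_ae mOm Lw Ldp Ldp Ew).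
exists (16 * M ^+ 2); first by rewrite mulr_gt0// exprn_gt0.
move=> psi [Hpsi dpsi]; apply/ler_addgt0Pl => e e0.
(* The approximation error enters with weight 2 through the L2 norm and 16 M^2 through the
   gradient. *)
pose c := 2 + 16 * M ^+ 2.
have c0 : 0 < c by rewrite /c; have := sqr_ge0 M; lra.
have m0 : 0 < Num.min 1 (e / c) by rewrite lt_min ltr01 divr_gt0.
have [phi tp lt] := dpsi _ m0; have Hphi : H1 Om phi by apply: smooth_H1; case: tp.
have HD := H1B Hpsi Hphi.
have N0 := H1norm_ge0 (psi \- phi).
have Ne : c * H1norm Om (psi \- phi) ^+ 2 <= e.
  move: lt; rewrite lt_min => /andP[l1 l2].
  rewrite ltr_pdivlMr// in l2; rewrite expr2.
  by move: (H1norm _ _) N0 l1 l2 => N N0 l1 l2; nra.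
have e1 : ipO psi psi <= 2 * ipO phi phi + 2 * ipO (psi \- phi) (psi \- phi).
  have Lp := H1_L2 Hpsi; have Lf := H1_L2 Hphi.
  have := ip_ge0 (mu := leb) (D := Om) (fun x => psi x + (-2) * phi x).
  have sl := sqi_lin mOm (-2) Lp Lf.
  rewrite ipBl ?(ipBr Lp Lf)//; last exact: (sqiB mOm).
  rewrite ip_lin// (ipC psi (fun x => psi x + (-2) * phi x)) (ipC phi (fun x => psi x + (-2) * phi x)) !ip_lin//.
  by rewrite [ipO phi psi]ipC; move: (ipO _ _) (ipO _ _) (ipO _ _) => p q r; lra.
have e2 : dir phi phi <= 2 * dir psi psi + 2 * dir (psi \- phi) (psi \- phi).
  have := dir_ge0 (fun x => phi x + (-2) * psi x).
  have sl := H1_lin (-2) Hphi Hpsi.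
  rewrite (dirBl Hpsi Hphi HD) (dirBr Hpsi Hphi Hpsi) (dirBr Hpsi Hphi Hphi).
  rewrite (dir_lin (-2) Hphi Hpsi sl) (dirC psi (fun x => phi x + (-2) * psi x)) (dirC phi (fun x => phi x + (-2) * psi x)).
  rewrite (dir_lin (-2) Hphi Hpsi Hphi) (dir_lin (-2) Hphi Hpsi Hpsi).
  by rewrite [dir phi psi]dirC; move: (dir _ _) (dir _ _) (dir _ _) => p q r; lra.
have e3 := test _ tp; have e4 := ip_le_H1norm (psi \- phi).
have e5 := dir_le_H1norm (psi \- phi).
have M2 := sqr_ge0 M; rewrite /c in Ne.
move: (ipO psi psi) (ipO phi phi) (ipO (_ \- _) _) (dir psi psi) (dir phi phi)
  (dir (_ \- _) _) (H1norm _ _ ^+ 2) (M ^+ 2) Ne e1 e2 e3 e4 e5 M2 => a1 a2 a3 b1 b2 b3 N m.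
by move=> h0 h1 h2 h3 h4 h5 m_ge0; nra.
Qed.

End sobolev_space.

(** * Hausdorff measure and tubes *)

Section euclidean_norm.
Context {R : realType} {n : nat}.
Local Notation Rn := 'rV[R]_n.
Implicit Types (x y z : Rn).

Lemma dotpC x y : dotp x y = dotp y x.
Proof. by apply: eq_bigr => i _; rewrite mulrC. Qed.

Lemma dotp_lin (t : R) x y z : dotp (x + t *: y) z = dotp x z + t * dotp y z.
Proof. by rewrite /dotp mulr_sumr -big_split /=; apply: eq_bigr => i _; rewrite !mxE; ring. Qed.

Lemma dotpDl x y z : dotp (x + y) z = dotp x z + dotp y z.
Proof. by rewrite -[y]scale1r dotp_lin mul1r scale1r. Qed.

Lemma dotpZl (t : R) x y : dotp (t *: x) y = t * dotp x y.
Proof. by rewrite /dotp mulr_sumr; apply: eq_bigr => i _; rewrite !mxE mulrA. Qed.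

Lemma dotpBl x y z : dotp (x - y) z = dotp x z - dotp y z.
Proof. by rewrite dotpDl -scaleN1r dotpZl mulN1r. Qed.

Lemma dotp_ge0 x : 0 <= dotp x x.
Proof. by apply: sumr_ge0 => i _; rewrite -expr2 sqr_ge0. Qed.

Lemma dotp_CS x y : dotp x y ^+ 2 <= dotp x x * dotp y y.
Proof.
apply: discriminant_le => [|t]; first exact: dotp_ge0.
have := dotp_ge0 (x + t *: y).
rewrite dotp_lin [dotp x _]dotpC [dotp y (_ + _)]dotpC !dotp_lin [dotp y x]dotpC.
by move: (dotp x x) (dotp x y) (dotp y y) => a b c; rewrite expr2; lra.
Qed.

Lemma enorm_ge0 x : 0 <= enorm x. Proof. exact: sqrtr_ge0. Qed.

Lemma enorm_sq x : enorm x ^+ 2 = dotp x x.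
Proof. by rewrite sqr_sqrtr// dotp_ge0. Qed.

Lemma dotp_le_enorm x y : `|dotp x y| <= enorm x * enorm y.
Proof.
by rewrite /enorm -sqrtrM ?dotp_ge0// -sqrtr_sqr ler_sqrt ?dotp_CS// mulr_ge0 ?dotp_ge0.
Qed.

Lemma enormD x y : enorm (x + y) <= enorm x + enorm y.
Proof.
rewrite -(@ler_pXn2r _ 2) ?nnegrE ?addr_ge0 ?enorm_ge0//.
rewrite sqrrD !enorm_sq dotpDl [dotp x _]dotpC [dotp y (_ + _)]dotpC !dotpDl [dotp y x]dotpC.
have := ler_norm (dotp x y); have := dotp_le_enorm x y; rewrite mulr2n.
by move: (dotp x x) (dotp x y) (dotp y y) (enorm x * enorm y) => a b c d; move: (`|b|) => e; lra.
Qed.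

Lemma enormZ (t : R) x : enorm (t *: x) = `|t| * enorm x.
Proof.
by rewrite /enorm dotpZl dotpC dotpZl mulrA -expr2 sqrtrM ?sqr_ge0// sqrtr_sqr.
Qed.

Lemma enormN x : enorm (- x) = enorm x.
Proof. by rewrite -scaleN1r enormZ normrN1 mul1r. Qed.

Lemma enorm0 : enorm (0 : Rn) = 0.
Proof. by rewrite -(scale0r (0 : Rn)) enormZ normr0 mul0r. Qed.

Lemma enorm_triangle z x y : enorm (x - y) <= enorm (x - z) + enorm (z - y).
Proof. by have := enormD (x - z) (z - y); rewrite addrA subrK. Qed.

Lemma coord_le_enorm x i : `|x ord0 i| <= enorm x.
Proof.
rewrite -sqrtr_sqr /enorm ler_sqrt ?dotp_ge0// /dotp (bigD1 i)//= -expr2 lerDl.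
by apply: sumr_ge0 => j _; rewrite -expr2 sqr_ge0.
Qed.

Lemma norm_le_enorm x : `|x| <= enorm x.
Proof. by apply: norm_le_coord => [|i]; [exact: enorm_ge0|exact: coord_le_enorm]. Qed.

(** A crude constant instead of sqrt n: it remains invertible when n = 0. *)
Lemma enorm_le_norm x : enorm x <= n.+1%:R * `|x|.
Proof.
rewrite -[leRHS]ger0_norm ?mulr_ge0// -sqrtr_sqr ler_sqrt ?sqr_ge0//.
apply: (@le_trans _ _ (\sum_(i < n) `|x| ^+ 2)).
  apply: ler_sum => i _; rewrite -expr2 -[leLHS]real_normK ?num_real//.
  by rewrite lerXn2r ?nnegrE// coord_le_norm.
rewrite sumr_const card_ord -[leLHS]mulr_natl exprMn; apply: ler_wpM2r; first exact: sqr_ge0.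
by rewrite -natrX ler_nat (leq_trans (leqnSn n))// -[leqLHS]muln1 leq_mul.
Qed.

Lemma open_eball x (r : R) : open [set y | enorm (y - x) < r].
Proof.
rewrite openE => y /= yr; apply/nbhs_ballP.
have e0 : 0 < (r - enorm (y - x)) / n.+1%:R by rewrite divr_gt0// subr_gt0.
exists ((r - enorm (y - x)) / n.+1%:R) => //= z; rewrite -ball_normE /= => yz.
apply: (le_lt_trans (enorm_triangle y z x)); rewrite -ltrBrDr.
apply: (le_lt_trans (enorm_le_norm _)).
by rewrite distrC mulrC -ltr_pdivlMr.
Qed.

Lemma closed_eball x (r : R) : closed [set y | enorm (y - x) <= r].
Proof.
rewrite -openC (_ : ~` _ = [set y | r < enorm (y - x)]); last first.
  by apply/seteqP; split => y /=; [move=> /negP; rewrite -ltNge|rewrite ltNge => /negP].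
rewrite openE => y /= yr; apply/nbhs_ballP.
have e0 : 0 < (enorm (y - x) - r) / n.+1%:R by rewrite divr_gt0// subr_gt0.
exists ((enorm (y - x) - r) / n.+1%:R) => //= z; rewrite -ball_normE /= => yz.
have := enorm_triangle z y x; have := enorm_le_norm (y - z).
move: yz; rewrite ltr_pdivlMr// mulrC.
by move: (enorm (y - x)) (enorm (z - x)) (enorm (y - z)) (n.+1%:R * _) => a b c d; lra.
Qed.

End euclidean_norm.

Section hausdorff_metric.
Context {R : realType} {n : nat}.
Local Notation Rn := 'rV[R]_n.
Implicit Types (A B X : set Rn) (s : nat).
Local Open Scope ereal_scope.

Lemma le_hausdorff_pre_diam s (d d' : R) A : (d <= d')%R ->
  hausdorff_pre s d' A <= hausdorff_pre s d A.
Proof.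
move=> dd'; apply: ereal_inf_le_tmp => _ [F [AF dF] <-].
by exists F => //; split => // k x y Fx Fy; exact: le_trans (dF k x y Fx Fy) dd'.
Qed.

Lemma hausdorff_pre_le s (d : R) A : (0 < d)%R -> hausdorff_pre s d A <= hausdorff s A.
Proof. by move=> d0; apply: ereal_sup_ubound; exists d. Qed.

(** A covering set of diameter at most d < r cannot meet both A and B, so a cover of the union
    splits into the sets that meet A and the others, which cover B. *)
Lemma hausdorff_pre_separated s (d r : R) A B : (d < r)%R ->
  (forall x y, A x -> B y -> (r <= enorm (x - y))%R) ->
  hausdorff_pre s d A + hausdorff_pre s d B <= hausdorff_pre s d (A `|` B).
Proof.
move=> dr sep; apply: le_ereal_inf_tmp => _ [F [ABF dF] <-].
pose F1 k := if `[< F k `&` A !=set0 >] then F k else set0.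
pose F2 k := if `[< F k `&` A !=set0 >] then set0 else F k.
have g0 : hausdorff_gauge s (set0 : set Rn) = 0 by rewrite /hausdorff_gauge eqxx.
rewrite (_ : \sum_(k <oo) _ = \sum_(k <oo) hausdorff_gauge s (F1 k) +
   \sum_(k <oo) hausdorff_gauge s (F2 k)); last first.
  rewrite -nneseriesD; [|by move=> *; exact: hausdorff_gauge_ge0..].
  apply: eq_eseriesr => k _; rewrite /F1 /F2; case: ifP => _; rewrite g0 ?adde0//.
  by rewrite add0e.
apply: leeD; apply: ereal_inf_lbound.
- exists F1 => //; split.
    move=> x Ax; have [k _ Fkx] := ABF _ (or_introl Ax).
    by exists k => //; rewrite /F1 asboolT//; exists x.
  by move=> k x y; rewrite /F1; case: ifP => // _; exact: dF.
- exists F2 => //; split.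
    move=> x Bx; have [k _ Fkx] := ABF _ (or_intror Bx).
    exists k => //; rewrite /F2 asboolF// => -[y [Fky Ay]].
    have := dF k y x Fky Fkx; apply/negP; rewrite -ltNge.
    exact: lt_le_trans dr (sep _ _ Ay Bx).
  by move=> k x y; rewrite /F2; case: ifP => // _; exact: dF.
Qed.

Lemma ereal_sup_leD (S1 S2 : set (\bar R)) (c : \bar R) :
  (forall a, S1 a -> 0 <= a) -> (forall b, S2 b -> 0 <= b) -> S1 !=set0 -> S2 !=set0 ->
  (forall a b, S1 a -> S2 b -> a + b <= c) -> ereal_sup S1 + ereal_sup S2 <= c.
Proof.
move=> p1 p2 [a0 Sa0] [b0 Sb0] H.
have [->|] := eqVneq c +oo; first exact: leey.
rewrite -ltey => coo.
have c0 : 0 <= c := le_trans (adde_ge0 (p1 _ Sa0) (p2 _ Sb0)) (H _ _ Sa0 Sb0).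
have cf : c \is a fin_num by rewrite ge0_fin_numE.
have fb b : S2 b -> b \is a fin_num.
  move=> Sb; rewrite ge0_fin_numE ?p2//; apply: (le_lt_trans _ coo).
  by apply: (le_trans _ (H _ _ Sa0 Sb)); rewrite leeDr// p1.
have s1 b : S2 b -> ereal_sup S1 <= c - b.
  move=> Sb; apply: ge_ereal_sup => a Sa; rewrite leeBrDr ?fb//; exact: H.
have f1 : ereal_sup S1 \is a fin_num.
  rewrite ge0_fin_numE; last by apply: (le_trans (p1 _ Sa0)); exact: ereal_sup_ubound.
  apply: (le_lt_trans (s1 _ Sb0)); apply: (le_lt_trans _ coo).
  by rewrite leeBlDr ?fb// leeDl// p2.
rewrite addeC -leeBrDr//; apply: ge_ereal_sup => b Sb.
by rewrite leeBrDr// addeC -leeBrDr ?fb// s1.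
Qed.

(** The pre-measures grow as the scale shrinks, so two scales may be replaced by a common smaller
    one, chosen below the separation r. *)
Lemma hausdorff_separated s (r : R) A B : (0 < r)%R ->
  (forall x y, A x -> B y -> (r <= enorm (x - y))%R) ->
  hausdorff s A + hausdorff s B <= hausdorff s (A `|` B).
Proof.
move=> r0 sep; apply: ereal_sup_leD.
- by move=> _ [d _ <-]; exact: hausdorff_pre_ge0.
- by move=> _ [d _ <-]; exact: hausdorff_pre_ge0.
- by exists (hausdorff_pre s 1 A), 1%R => //=; exact: ltr01.
- by exists (hausdorff_pre s 1 B), 1%R => //=; exact: ltr01.
move=> _ _ [d1 /= d10 <-] [d2 /= d20 <-].
pose d := Num.min (Num.min d1 d2) (r / 2)%R.
have d0 : (0 < d)%R by rewrite /d !lt_min d10 d20 divr_gt0.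
have dr : (d < r)%R.
  apply: (@le_lt_trans _ _ (r / 2)%R); first by rewrite /d ge_min lexx orbT.
  by rewrite ltr_pdivrMr// ltr_pMr// ltr1n.
apply: le_trans (hausdorff_pre_le s (A `|` B) d0).
apply: le_trans (hausdorff_pre_separated s dr sep).
by apply: leeD; apply: le_hausdorff_pre_diam; rewrite /d !ge_min lexx ?orbT.
Qed.

(* Caratheodory's criterion: among the shells R_ k, those of the same parity are
   separated, so their outer measures add up to at most that of X, and the
   shells close to the hyperplane have small total measure. *)
Lemma hausdorff_halfspace s (i : 'I_n) (a : R) :
  (@hausdorff R n s).-caratheodory [set x : Rn | (x ord0 i <= a)%R].
Proof.
apply: le_caratheodory_measurable => X.
pose mu := @hausdorff R n s; set E := [set x : Rn | _].
change (mu (X `&` E) + mu (X `&` ~` E) <= mu X).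
have [->|Xoo] := eqVneq (mu X) +oo; first exact: leey.
have mu0 A : 0 <= mu A by exact: outer_measure_ge0.
have mono A B : A `<=` B -> mu A <= mu B by exact: le_outer_measure.
have muX : mu X < +oo by rewrite ltey.
pose q (k : nat) : R := (a + k.+1%:R^-1)%R.
have qlt (j k : nat) : (j < k)%N -> (q k < q j)%R.
  by move=> jk; rewrite /q ltrD2l ltf_pV2 ?posrE// ltr_nat.
have qle (j k : nat) : (j <= k)%N -> (q k <= q j)%R.
  by move=> jk; rewrite /q lerD2l lef_pV2 ?posrE// ler_nat.
pose R_ k := [set x | X x /\ (q k.+1 <= x ord0 i < q k)%R].
pose X_ k := [set x | X x /\ (q k <= x ord0 i)%R].
have sepc (x y : Rn) (u v : R) : (v <= x ord0 i)%R -> (y ord0 i <= u)%R ->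
    (v - u <= enorm (x - y))%R.
  move=> xv yu; apply: (le_trans _ (coord_le_enorm (x - y) i)); rewrite !mxE.
  by apply: (le_trans _ (ler_norm _)); rewrite lerB.
(* [b] is the parity. By induction the shells counted so far lie in [X_ (m.*2 + b)], and the skipped
   shell [R_ (m.*2 + b)] separates it from the next one. *)
have sumR b m : \sum_(j < m) mu (R_ (j.*2 + b).+1) <= mu X.
  suff : \sum_(j < m) mu (R_ (j.*2 + b).+1) <= mu (X_ (m.*2 + b)%N).
    by move/le_trans; apply; apply: mono => x [].
  elim: m => [|m IH]; first by rewrite big_ord0.
  rewrite big_ord_recr /=; apply: (@le_trans _ _ (mu (X_ (m.*2 + b)%N) + mu (R_ (m.*2 + b).+1))).
    exact: leeD2r.
  apply: (@le_trans _ _ (mu (X_ (m.*2 + b)%N `|` R_ (m.*2 + b).+1))).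
    apply: (@hausdorff_separated s (q (m.*2 + b) - q (m.*2 + b).+1)%R).
      by rewrite subr_gt0 qlt.
    by move=> x y [_ hx] [_ /andP[_ /ltW hy]]; exact: sepc.
  apply: mono => x [[Xx h]|[Xx /andP[h _]]]; split => //=.
    by apply: (le_trans _ h); apply: qle; lia.
pose f j := mu (R_ j.+1).
have sumf m : \sum_(j < m.*2) f j <= mu X + mu X.
  apply: (le_trans _ (leeD (sumR 0%N m) (sumR 1%N m))).
  elim: m => [|m IH]; first by rewrite !big_ord0 adde0.
  rewrite doubleS !big_ord_recr /= /f !addn0 addn1.
  set s1 := \sum_(_ < _) _ in IH *; set s2 := \sum_(_ < _) _ in IH *; set s3 := \sum_(_ < _) _ in IH *.
  have H (u v w x y : \bar R) : u <= v + w -> u + x + y <= (v + x) + (w + y).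
    by move=> h; rewrite -addeA [leRHS]addeACA; exact: leeD2r.
  exact: H.
have f0 j : 0 <= f j by exact: mu0.
have fin : \sum_(j <oo) f j < +oo.
  apply: (@le_lt_trans _ _ (mu X + mu X)); last by rewrite lte_add_pinfty.
  apply: lime_le; first by apply: is_cvg_nneseries => j _ _; exact: f0.
  apply: nearW => m; apply: (le_trans _ (sumf m)).
  rewrite -(big_mkord xpredT f).
  by apply: (@lee_sum_nneg_natr _ f xpredT 0) => //; rewrite -addnn leq_addr.
have tail := nneseries_tail_cvg fin (fun j _ => f0 j).
have sepE k : mu (X `&` E) + mu (X_ k) <= mu X.
  rewrite addeC; apply: (@le_trans _ _ (mu (X_ k `|` (X `&` E)))); last first.
    by apply: mono => x [[]|[]].
  apply: (@hausdorff_separated s (q k - a)%R); first by rewrite /q addrAC subrr add0r invr_gt0.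
  by move=> x y [_ hx] [_ hy]; exact: sepc.
apply/lee_addgt0Pr => e e0.
have [N hN] : exists N, \sum_(N <= j <oo) f j < e%:E.
  have : \forall N \near \oo, \sum_(N <= j <oo) f j < e%:E.
    apply: (tail [set x | x < e%:E]); apply: open_nbhs_nbhs; split; last by rewrite /= lte_fin.
    exact: open_ereal_lt_ereal.
  by move=> [N _ hN]; exists N; apply: hN => /=.
have cover : X `&` ~` E `<=` X_ N.+1 `|` \bigcup_j R_ (j + N).+1.
  move=> x [Xx /negP]; rewrite -ltNge => ax.
  have ex : exists k, (q k <= x ord0 i)%R.
    have xa : (0 < x ord0 i - a)%R by rewrite subr_gt0.
    have [k _ hk] := near_infty_natSinv_lt (PosNum xa).
    have h : (k.+1%:R^-1 < x ord0 i - a)%R := hk k (leqnn k).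
    by exists k; rewrite /q -lerBrDl ltW.
  case: (ex_minnP ex) => k hk kmin.
  have [kN|kN] := leqP k N.+1; first by left; split => //; exact: le_trans (qle _ _ kN) hk.
  right; exists (k - N.+2)%N => //; split => //.
  have -> : ((k - N.+2 + N).+1 = k.-1)%N by lia.
  have -> : (k.-1.+1 = k)%N by lia.
  rewrite hk /= ltNge; apply/negP => h; have := kmin _ h; lia.
apply: (@le_trans _ _ (mu (X `&` E) + (mu (X_ N.+1) + e%:E))); last first.
  by rewrite addeA leeD2r.
apply: leeD2l; apply: (le_trans (mono _ _ cover)).
apply: (le_trans (outer_measureU2 _ _ _)); apply: leeD2l.
apply: (le_trans (outer_measure_sigma_subadditive _ _)).
by apply: (le_trans _ (ltW hN)); rewrite -(nneseries_addn N).
Qed.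

End hausdorff_metric.

(** * Borel sets for the surface measure, and the volume of tubes *)

Section surface_measurability.
Context {R : realType} {n : nat}.
Local Notation Rn := 'rV[R]_n.
Local Notation leb := (lebesgue_rV R n).

(** Half-spaces generate the Borel sets, so their Caratheodory measurability makes every Borel set
    measurable for the surface measure. *)
Lemma measurable_surface_id : measurable_fun setT (fun x : surface_type R n => x : Rn).
Proof.
apply: measurable_fun_rVP => i; apply: (measurability _ (RGenOInfty.measurableE R)).
move=> _ [_ [a ->] <-]; rewrite setTI.
rewrite (_ : _ @^-1` _ = ~` [set x : Rn | x ord0 i <= a]).
  by apply: measurableC; exact: (@hausdorff_halfspace R n n.-1 i a).
by apply/seteqP; split => x /=; rewrite in_itv /= andbT ltNge => /negP.
Qed.

Lemma measurable_surface (A : set Rn) : measurable A ->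
  measurable (A : set (surface_type R n)).
Proof.
by move=> mA; rewrite -[X in measurable X]setTI; exact: measurable_surface_id.
Qed.

Lemma measurable_fun_surface d (T : measurableType d) (D : set Rn) (f : Rn -> T) :
  measurable D -> measurable_fun D f ->
  measurable_fun (D : set (surface_type R n)) (f : surface_type R n -> T).
Proof.
by move=> mD mf _ Y mY; apply: measurable_surface; exact: mf.
Qed.

Definition tube (e : Rn) (T : R) (A : set Rn) : set Rn :=
  [set x | exists y t, [/\ A y, 0 <= t <= T & x = y + t *: e]].

(** Cubes of side 6d are centred at y0 + m d e for m <= T / d. There are at most T / d + 1 <= 2 T /
    d of them, each of volume (6d)^n. The cover is measurable although A is arbitrary. *)
Lemma tube_cover (e : Rn) (T d : R) (A : set Rn) : enorm e = 1 -> 0 < d -> d <= T ->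
  (forall x y, A x -> A y -> enorm (x - y) <= d) ->
  exists2 B, measurable B & tube e T A `<=` B /\
    (leb B <= ((2 * 6 ^+ n) * (T * d ^+ n.-1))%:E)%E.
Proof.
move=> e1 d0 dT dA; have T0 : 0 < T := lt_le_trans d0 dT.
have [A0|/set0P[y0 Ay0]] := eqVneq A set0.
  exists set0; first exact: measurable0.
  split; first by move=> x [y [t []]]; rewrite A0.
  by rewrite measure0 lee_fin !mulr_ge0// ?exprn_ge0// ltW.
pose M := Num.truncn (T / d).
pose Bm (m : nat) : set Rn := ball (y0 + (m%:R * d) *: e) (3 * d).
pose B := \big[setU/set0]_(m < M.+1) Bm m.
have mBm m : measurable (Bm m) by exact: measurable_rV_ball.
have mB : measurable B by apply: bigsetU_measurable => m _.
exists B => //; have Td0 : 0 <= T / d by rewrite divr_ge0 ?ltW.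
split.
  move=> _ [y [t [Ay /andP[t0 tT] ->]]].
  have td0 : 0 <= t / d := divr_ge0 t0 (ltW d0).
  pose m := Num.truncn (t / d).
  have mM : (m < M.+1)%N by rewrite ltnS /m /M le_truncn// ler_pM2r ?invr_gt0.
  rewrite /B -bigcup_mkord; exists m => //=; rewrite /Bm rV_ball_norm.
  have /andP[h1 h2] := truncn_itv td0.
  rewrite ler_pdivlMr// in h1; rewrite ltr_pdivrMr// -natr1 mulrDl mul1r in h2.
  rewrite -/m in h1 h2.
  rewrite (_ : _ - _ = (y0 - y) + (m%:R * d - t) *: e); last first.
    by rewrite scalerBl opprD addrACA.
  apply: le_lt_trans (norm_le_enorm _) _; apply: le_lt_trans (enormD _ _) _.
  rewrite enormZ e1 mulr1; have := dA _ _ Ay0 Ay.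
  have : `|m%:R * d - t| <= d by rewrite ler_norml; apply/andP; split; lra.
  by move: (enorm _) (`|_ - t|) => a b; lra.
have n0 : (0 < n)%N.
  case: (posnP n) => // n0; exfalso; have := e1.
  rewrite /enorm /dotp big1 ?sqrtr0 => [/esym/eqP|i _]; first by rewrite oner_eq0.
  by have := ltn_ord i; rewrite [X in (_ < X)%N]n0.
apply: (@le_trans _ _ (\sum_(m < M.+1) (((6 * d) ^+ n)%:E))%E).
  have := @content_subadditive _ _ _ leb B Bm M.+1 (fun m _ => mBm m) mB (@subset_refl _ _).
  move/le_trans; apply.
  have bm m : (leb (Bm m) <= ((6 * d) ^+ n)%:E)%E.
    rewrite /Bm lebesgue_rV_ball ?mulr_gt0// lee_fin.
    by rewrite (_ : (3 * d) *+ 2 = 6 * d)//; ring.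
  by apply: lee_sum => m _; exact: bm.
rewrite sumEFin lee_fin sumr_const card_ord -[leLHS]mulr_natl.
have MT : M%:R <= T / d by rewrite /M truncn_le.
rewrite -(prednK n0) /= !exprMn !exprS.
have -> : 2 * (6 * 6 ^+ n.-1) * (T * d ^+ n.-1) = (2 * (T / d)) * (6 * 6 ^+ n.-1 * (d * d ^+ n.-1)).
  by field; rewrite gt_eqF.
apply: ler_wpM2r; first by rewrite !mulr_ge0 ?exprn_ge0// ltW.
have Td1 : 1 <= T / d by rewrite ler_pdivlMr// mul1r.
by rewrite -natr1; lra.
Qed.

Lemma ediam_ge (A : set Rn) (d : R) x y : (forall x y, A x -> A y -> enorm (x - y) <= d) ->
  A x -> A y -> enorm (x - y) <= ediam A.
Proof.
move=> dA Ax Ay; apply: ub_le_sup; last by exists x => //; exists y.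
by exists d => _ [u Au [v Av <-]]; exact: dA.
Qed.

Lemma ediam_le (A : set Rn) (d : R) : A !=set0 -> (forall x y, A x -> A y -> enorm (x - y) <= d) ->
  ediam A <= d.
Proof.
move=> [x Ax] dA; apply: ge_sup; first by exists (enorm (x - x)); exists x => //; exists x.
by move=> _ [u Au [v Av <-]]; exact: dA.
Qed.

(** If A has positive diameter, it serves as the scale in [tube_cover]. If A is a single point, the
    scales T / (k+1) give covers whose intersection is null; the exponent n - 1 is positive since n
    >= 2, so both sides vanish. *)
Lemma tube_cover_ediam (e : Rn) (T d : R) (A : set Rn) : (2 <= n)%N -> enorm e = 1 ->
  0 < d -> d <= T -> (forall x y, A x -> A y -> enorm (x - y) <= d) -> A !=set0 ->
  exists2 B, measurable B & tube e T A `<=` B /\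
    (leb B <= ((2 * 6 ^+ n) * (T * ediam A ^+ n.-1))%:E)%E.
Proof.
move=> n2 e1 d0 dT dA A0; have T0 : 0 < T := lt_le_trans d0 dT.
have dE x y : A x -> A y -> enorm (x - y) <= ediam A by move=> Ax Ay; exact: ediam_ge dA Ax Ay.
have E0 : 0 <= ediam A by case: A0 => x Ax; exact: le_trans (enorm_ge0 _) (dE x x Ax Ax).
have Ed := ediam_le A0 dA.
move: E0; rewrite le_eqVlt => /orP[/eqP E0|E0]; last first.
  by apply: (tube_cover e1 E0 (le_trans Ed dT)) => x y; exact: dE.
have /choice[B hB] : forall k : nat, exists B, measurable B /\ (tube e T A `<=` B /\
    (leb B <= ((2 * 6 ^+ n) * (T * (T * k.+1%:R^-1) ^+ n.-1))%:E)%E).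
  move=> k; have k0 : 0 < T * k.+1%:R^-1 by rewrite mulr_gt0// invr_gt0.
  have kT : T * k.+1%:R^-1 <= T.
    by rewrite ler_piMr ?(ltW T0)// invf_le1// ler1n.
  have [|B mB hB] := @tube_cover e T (T * k.+1%:R^-1) A e1 k0 kT.
    by move=> x y Ax Ay; apply: le_trans (dE _ _ Ax Ay) _; rewrite -E0 ltW.
  by exists B.
have mI : measurable (\bigcap_k B k) by apply: bigcapT_measurable => k; have [] := hB k.
exists (\bigcap_k B k) => //; split; first by move=> x tx k _; have [_ [h _]] := hB k; exact: h.
have -> : ((2 * 6 ^+ n) * (T * ediam A ^+ n.-1))%R = 0.
  by rewrite -E0 expr0n (_ : (n.-1 == 0)%N = false) ?mulr0//; apply/eqP; lia.
apply/lee_addgt0Pr => eps eps0; rewrite add0e.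
pose C := (2 * 6 ^+ n) * (T * T ^+ n.-1).
have C0 : 0 < C by rewrite /C !mulr_gt0// exprn_gt0.
have [k _ hk] := near_infty_natSinv_lt (PosNum (divr_gt0 eps0 C0)).
have {}hk : k.+1%:R^-1 < eps / C by exact: (hk k (leqnn k)).
have [mB [_ lB]] := hB k.
apply: (@le_trans _ _ (leb (B k))).
  by apply: le_measure; rewrite ?inE// => x; apply.
apply: le_trans lB _; rewrite lee_fin exprMn.
apply: (@le_trans _ _ (C * k.+1%:R^-1)); last first.
  by rewrite mulrC -ler_pdivlMr// ltW.
rewrite /C -!mulrA ler_wpM2l// ler_wpM2l ?exprn_ge0// ler_wpM2l ?(ltW T0)//.
rewrite ler_wpM2l ?exprn_ge0 ?(ltW T0)//.
have -> : n.-1 = n.-2.+1 by lia.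
rewrite exprS ler_piMr ?invr_ge0// exprn_ile1 ?invr_ge0//.
by rewrite invf_le1// ler1n.
Qed.

Lemma unit_ball_volume_gt0 (s : nat) : 0 < unit_ball_volume R s.
Proof.
have mB : measurable [set x : 'rV[R]_s | enorm x <= 1].
  have := @closed_eball R s 0 1; rewrite (_ : [set y | _] = [set x : 'rV[R]_s | enorm x <= 1]).
    by move=> c; rewrite -[X in measurable X]setCK; apply: measurableC;
      apply: open_measurable_rV; exact: closed_openC.
  by apply/seteqP; split => x /=; rewrite subr0.
have fin : (lebesgue_rV R s [set x | (enorm x <= 1)%R] < +oo)%E.
  apply: lebesgue_rV_bounded => //; exists 1; split=> [|y hy x /= hx]; first exact: num_real.
  by rewrite (le_trans (norm_le_enorm x))// (le_trans hx)// ltW.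
rewrite /unit_ball_volume fine_gt0// fin andbT.
have s0 : 0 < s.+1%:R^-1 :> R by rewrite invr_gt0.
apply: (@lt_le_trans _ _ (lebesgue_rV R s (ball 0 s.+1%:R^-1))).
  by rewrite lebesgue_rV_ball// lte_fin exprn_gt0// mulrn_wgt0.
apply: le_measure; rewrite ?inE//; first exact: measurable_rV_ball.
move=> x; rewrite -ball_normE /= sub0r normrN => h.
by rewrite (le_trans (enorm_le_norm x))// mulrC -ler_pdivlMr// div1r ltW.
Qed.

(* No rectification of the direction e is needed: the tube over a small set of
   diameter d is covered by about T / d cubes of side comparable to d. *)
Lemma lebesgue_tube_le : (2 <= n)%N -> exists2 C : R, 0 < C &
  forall (e : Rn) (T : R) (A P : set Rn), enorm e = 1 -> 0 < T -> measurable P ->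
    P `<=` tube e T A -> (leb P <= (C * T)%:E * hausdorff n.-1 A)%E.
Proof.
move=> n2; pose ub := unit_ball_volume R n.-1.
have ub0 : 0 < ub by exact: unit_ball_volume_gt0.
pose C := (2 * 6 ^+ n) * 2 ^+ n.-1 / ub.
have C0 : 0 < C by rewrite /C !mulr_gt0 ?exprn_gt0 ?invr_gt0.
exists C => // e T A P e1 T0 mP PA.
(* The pre-measure at scale T is enough: its covering sets have diameter at most T, as
   [tube_cover_ediam] requires. *)
apply: (@le_trans _ _ ((C * T)%:E * hausdorff_pre n.-1 T A)%E); last first.
  by apply: lee_wpmul2l; [rewrite lee_fin mulr_ge0// ltW|exact: hausdorff_pre_le].
have CT : 0 < C * T by rewrite mulr_gt0.
rewrite -lee_pdivrMl//; apply: le_ereal_inf_tmp => _ [F [AF dF] <-].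
rewrite lee_pdivrMl//.
have /choice[B hB] : forall k, exists B, measurable B /\ (tube e T (F k) `<=` B /\
    (leb B <= (C * T)%:E * hausdorff_gauge n.-1 (F k))%E).
  move=> k; have [F0|F0] := eqVneq (F k) set0.
    exists set0; split; first exact: measurable0.
    split; first by move=> x [y [t []]]; rewrite F0.
    by rewrite measure0 mule_ge0 ?lee_fin ?(ltW CT)// hausdorff_gauge_ge0.
  have /set0P F0' := F0.
  have [B mB [tB lB]] := tube_cover_ediam n2 e1 T0 (lexx T) (dF k) F0'.
  exists B; split => //; split => //; apply: le_trans lB _.
  rewrite /hausdorff_gauge (negbTE F0) -EFinM lee_fin -/ub /C expr_div_n.
  rewrite le_eqVlt; apply/orP; left; apply/eqP.
  by field; rewrite !gt_eqF// exprn_gt0.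
apply: (@le_trans _ _ (leb (\bigcup_k B k))).
  apply: le_measure; rewrite ?inE//.
    by apply: bigcupT_measurable => k; have [] := hB k.
  move=> x /PA[y [t [Ay t0T xE]]]; have [k _ Fky] := AF _ Ay.
  by exists k => //; have [_ [h _]] := hB k; apply: h; exists y, t.
have mB k : measurable (B k) by have [] := hB k.
have := @measure_sigma_subadditive _ _ _ leb _ B mB (bigcupT_measurable B mB) (@subset_refl _ _).
move/le_trans; apply.
rewrite -nneseriesZl; last by move=> k _; exact: hausdorff_gauge_ge0.
apply: lee_nneseries => [k _ _|k _]; first exact: measure_ge0.
by have [_ [_ ]] := hB k.
Qed.

End surface_measurability.

Section tube_integral.
Context {R : realType} {n : nat}.
Local Notation Rn := 'rV[R]_n.
Local Notation leb := (lebesgue_rV R n).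
Local Notation surf := (surface_measure R n).

(** For every Borel set A, the part of P above A lies in the tube over A [&] G. Hence the image
    under p of Lebesgue measure on P is bounded by C T times surface measure on G, set by set, and
    the integrals compare. *)
Lemma tube_integral : (2 <= n)%N -> exists2 C : R, 0 < C &
  forall (e : Rn) (T : R) (G P : set Rn) (p : Rn -> Rn) (f : Rn -> \bar R),
    enorm e = 1 -> 0 < T -> measurable P -> measurable G -> measurable_fun setT p ->
    (forall x, P x -> G (p x) /\ exists2 t, 0 <= t <= T & x = p x + t *: e) ->
    measurable_fun setT f -> (forall x, (0 <= f x)%E) ->
    (\int[leb]_(x in P) f (p x) <= (C * T)%:E * \int[surf]_(x in G) f (x : Rn))%E.
Proof.
move=> n2; have [C C0 hC] := @lebesgue_tube_le R n n2; exists C => //.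
move=> e T G P p f e1 T0 mP mG mp hP mf f0.
have CT0 : 0 <= C * T by rewrite mulr_ge0// ltW.
have mfp : measurable_fun setT (f \o p) by exact: measurableT_comp.
have mpG : measurable (p @^-1` G) by rewrite -[X in measurable X]setTI; exact: mp.
have PG : P `<=` p @^-1` G by move=> x /hP[].
have mS := @measurable_surface_id R n.
have mfS D : measurable_fun D f by exact: measurable_funS mf.
rewrite (@eq_measure_integral _ _ R P (mrestr leb mP)); last first.
  by move=> A mA AP; rewrite /= /mrestr; congr (leb _); rewrite setIidl.
have mfpG : measurable_fun (p @^-1` G) (f \o p) by exact: measurable_funS mfp.
apply: (le_trans (@ge0_subset_integral _ _ R (mrestr leb mP) _ _ mP mpG (f \o p) mfpG
  (fun x _ => f0 (p x)) PG)).
rewrite -(ge0_integral_pushforward mp (mrestr leb mP) mG (mfS _))//.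
rewrite -(ge0_integral_pushforward mS surf mG (mfS _))//.
rewrite -[X in (X * _)%E]/((NngNum CT0)%:num%:E) -ge0_integral_mscale//.
apply: ge0_le_measure_integral => // A mA.
rewrite /= /mscale /= /pushforward /mrestr.
apply: (@le_trans _ _ ((C * T)%:E * hausdorff n.-1 (A `&` G))%E).
  apply: (hC e) => //.
    apply: measurableI => //; rewrite -[X in measurable X]setTI; exact: mp.
  by move=> x [Ax Px]; have [Gx [t tT xE]] := hP _ Px; exists (p x), t; split.
apply: lee_wpmul2l; first by rewrite lee_fin.
by apply: le_outer_measure => x [].
Qed.

End tube_integral.

(** * The collar of a Lipschitz boundary *)

Section line_integrals.
Context {R : realType}.
Local Notation leb1 := (@lebesgue_measure R).

(* Integrate h'^2 >= 2 m h' - m^2, where m is the mean slope of h. *)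
Lemma sq_increment_le (h h' : R -> R) (s : R) : 0 <= s -> continuous h' ->
  (forall t : R, is_derive t 1 h (h' t)) ->
  ((((h s - h 0) ^+ 2)%:E) <= s%:E * \int[leb1]_(t in `[0%R, s]%classic) ((h' t ^+ 2)%:E))%E.
Proof.
rewrite le_eqVlt => /orP[/eqP <- _ _|s0 ch' dh]; first by rewrite subrr expr0n mul0e.
pose m := (h s - h 0) / s.
pose F (t : R) := (2 * m) * h t - m ^+ 2 * t.
pose f (t : R) := (2 * m) * h' t - m ^+ 2.
have dF (t : R) : is_derive t 1 F (f t).
  have d1 : is_derive t 1 ((2 * m) \*o h) (2 * m * h' t) by exact: is_deriveZ.
  have d2 : is_derive t 1 ((m ^+ 2) \*o (id : R -> R)) (m ^+ 2 * 1) by exact: is_deriveZ.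
  by have := is_deriveB d1 d2; rewrite mulr1.
have cF (t : R) : {for t, continuous F}.
  by apply: differentiable_continuous; apply/derivable1_diffP; exact: ex_derive.
have cf : continuous f.
  move=> t; apply: cvgB; last exact: cvg_cst.
  by apply: cvgM; [exact: cvg_cst|exact: ch'].
have ch2 : continuous (fun t => h' t ^+ 2).
  by under eq_fun do rewrite expr2; move=> t; apply: cvgM; exact: ch'.
have FTC : (\int[leb1]_(t in `[0%R, s]%classic) (f t)%:E = (F s)%:E - (F 0%R)%:E)%E.
  apply: continuous_FTC2 => //.
  - by apply: continuous_subspaceT.
  - split; first by move=> t _; exact: ex_derive.
    + by apply: cvg_at_right_filter; exact: cF.
    + by apply: cvg_at_left_filter; exact: cF.
  - by move=> t _; rewrite derive1E; apply: derive_val.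
have I (k : R -> R) : continuous k -> leb1.-integrable `[0%R, s]%classic (EFin \o k).
  move=> ck; apply: continuous_compact_integrable; first exact: segment_compact.
  exact: continuous_subspaceT.
have : (\int[leb1]_(t in `[0%R, s]%classic) (f t)%:E <=
        \int[leb1]_(t in `[0%R, s]%classic) (h' t ^+ 2)%:E)%E.
  apply: le_integral => //; [exact: I|exact: I|].
  move=> t _; rewrite lee_fin /f -subr_ge0.
  by rewrite (_ : _ - _ = (h' t - m) ^+ 2) ?sqr_ge0//; ring.
rewrite FTC -EFinB => H.
have := lee_wpmul2l (ltW s0 : (0 <= s%:E)%E) H; apply: le_trans.
rewrite -EFinM lee_fin /F le_eqVlt; apply/orP; left; apply/eqP; rewrite /m.
by field; rewrite gt_eqF.
Qed.

Context {n : nat}.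
Local Notation Rn := 'rV[R]_n.
Local Notation leb := (lebesgue_rV R n).

(** Tonelli, after enlarging P to the whole space: for each t in [0, T] the inner integral is that
    of a translate of H, which does not depend on t. *)
Lemma ge0_line_integral (e : Rn) (T : R) (P : set Rn) (H : Rn -> \bar R) :
  0 <= T -> measurable P -> measurable_fun setT H -> (forall x, (0 <= H x)%E) ->
  measurable_fun setT
    (fun x : Rn => \int[leb1]_(t in `[0%R, T]%classic) H (x - (t : R) *: e)%R)%E /\
  (\int[leb]_(x in P) \int[leb1]_(t in `[0%R, T]%classic) H ((x : Rn) - (t : R) *: e)%R
   <= T%:E * \int[leb]_x H x)%E.
Proof.
move=> T0 mP mH H0.
pose D : set (measurableTypeR R) := `[0, T]%classic.
have mD : measurable D by exact: measurable_itv.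
pose sh (z : Rn * measurableTypeR R) : Rn := z.1 - z.2 *: e.
have msh : measurable_fun setT sh.
  apply: measurable_fun_rVP => i.
  rewrite (_ : (fun _ => _) = (fun z : Rn * measurableTypeR R => z.1 ord0 i - z.2 * e ord0 i)); last first.
    by apply/funext => z; rewrite /sh !mxE.
  apply: measurable_funB.
    exact: (measurableT_comp (@measurable_coord R n i) (@measurable_fst _ _ _ _)).
  by apply: measurable_funM; [exact: measurable_snd|exact: measurable_cst].
pose f (z : Rn * measurableTypeR R) : \bar R := (H (sh z) * (\1_D z.2)%:E)%E.
have mf : measurable_fun setT f.
  apply: emeasurable_funM; first exact: measurableT_comp.
  apply/measurable_EFinP; apply: measurableT_comp; first exact: measurable_indic.
  exact: measurable_snd.
have f0 z : (0 <= f z)%E by rewrite mule_ge0// lee_fin.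
have inE : (fun x => \int[leb1]_(t in D) H (x - t *: e)%R)%E = (fun x => \int[leb1]_t f (x, t))%E.
  apply/funext => x; rewrite integral_mkcond; apply: eq_integral => t _.
  by rewrite epatch_indic.
rewrite inE.
have mI : measurable_fun setT (fun x => \int[leb1]_t f (x, t))%E.
  exact: (@measurable_fun_fubini_tonelli_F _ _ _ _ R leb1 f mf f0).
split => //.
apply: (@le_trans _ _ (\int[leb]_x \int[leb1]_t f (x, t))%E).
  apply: ge0_subset_integral => // x _; exact: integral_ge0.
rewrite (@fubini_tonelli _ _ _ _ R leb leb1 f mf f0).
have -> : (\int[leb1]_t \int[leb]_x f (x, t) = \int[leb1]_(t in D) (\int[leb]_x H x))%E.
  rewrite [RHS]integral_mkcond; apply: eq_integral => t _.
  rewrite epatch_indic /f /sh /=.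
  have mHt : measurable_fun setT (fun x : Rn => H (x - t *: e)).
    apply: measurableT_comp => //; apply: measurable_rV_shift.
  rewrite ge0_integralZr//.
  by rewrite (ge0_integral_shift (- (t *: e)) mH H0).
rewrite integral_cst//= lebesgue_measure_itv /= lte_fin.
have [->|] := eqVneq T 0; first by rewrite ltxx mule0 mul0e.
by move=> Tn0; rewrite lt_neqAle eq_sym Tn0 T0 /= sube0 muleC.
Qed.

End line_integrals.

Section collar.
Context {R : realType} {n : nat}.
Local Notation Rn := 'rV[R]_n.

Lemma lipschitz_continuous (M : R) (f : Rn -> R) :
  (forall x y, `|f x - f y| <= M * enorm (x - y)) -> continuous f.
Proof.
move=> fM; apply/continuous_epsP => x eps eps0.
have K0 : 0 < (`|M| + 1) * n.+1%:R by rewrite mulr_gt0// ltr_wpDl.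
exists (eps / ((`|M| + 1) * n.+1%:R)) => [|y xy]; first by rewrite divr_gt0.
apply: le_lt_trans (fM y x) _; apply: (@le_lt_trans _ _ (`|M| * (n.+1%:R * `|y - x|))).
  apply: (le_trans (ler_norm _)); rewrite normrM.
  by rewrite ler_wpM2l// ger0_norm ?enorm_ge0// enorm_le_norm.
apply: (@le_lt_trans _ _ ((`|M| + 1) * n.+1%:R * `|y - x|)).
  by rewrite mulrA ler_wpM2r// ler_wpM2r// lerDl.
by rewrite mulrC -ltr_pdivlMr.
Qed.

Definition collar (Om : set Rn) (d : R) : set Rn :=
  [set x | Om x /\ exists2 z, boundary Om z & enorm (x - z) < d].

Lemma le_collar Om d d' : d <= d' -> collar Om d `<=` collar Om d'.
Proof. by move=> dd' x [Ox [z Gz xz]]; split => //; exists z => //; exact: lt_le_trans dd'. Qed.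

Lemma collar_measurable Om d : open Om -> measurable (collar Om d).
Proof.
move=> oOm; apply: open_measurable_rV.
rewrite (_ : collar Om d = Om `&` \bigcup_(z in boundary Om) [set x | enorm (x - z) < d]).
  by apply: openI => //; apply: bigcup_open => z _; exact: open_eball.
by apply/seteqP; split => x [Ox [z Gz xz]]; split => //; exists z.
Qed.

Lemma boundary_open (Om : set Rn) : open Om -> boundary Om = closure Om `\` Om.
Proof. by move=> oOm; rewrite /boundary ((interior_id _).1 oOm). Qed.

Lemma boundary_closed (Om : set Rn) : closed (boundary Om).
Proof. by apply: closedI; [exact: closed_closure|apply: open_closedC; exact: open_interior]. Qed.

Lemma measurable_boundary (Om : set Rn) : measurable (boundary Om).
Proof.
rewrite -[X in measurable X]setCK; apply: measurableC; apply: open_measurable_rV.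
by apply: closed_openC; exact: boundary_closed.
Qed.

End collar.

Section gradient.
Context {R : realType} {n : nat}.
Local Notation Rn := 'rV[R]_n.

Definition grad_sq (f : Rn -> R) (x : Rn) : R := \sum_i partial i f x ^+ 2.

Lemma grad_sq_ge0 f x : 0 <= grad_sq f x.
Proof. by apply: sumr_ge0 => i _; exact: sqr_ge0. Qed.

Lemma continuous_grad_sq f : smooth f -> continuous (grad_sq f).
Proof.
move=> sf; apply: smooth_continuous.
rewrite (_ : grad_sq f = (fun x => \sum_i (partial i f \* partial i f) x)).
  by apply: smooth_sum => i; apply: smoothM; exact: smooth_partial.
by apply/funext => x; apply: eq_bigr => i _; rewrite expr2.
Qed.

Lemma directional_sq_le (e : Rn) f x : enorm e = 1 ->
  (\sum_i e ord0 i * partial i f x) ^+ 2 <= grad_sq f x.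
Proof.
move=> e1; have := dotp_CS e (\row_i partial i f x).
rewrite -enorm_sq e1 expr1n mul1r /dotp.
under eq_bigr do rewrite mxE.
by under [X in _ <= X -> _]eq_bigr do rewrite mxE -expr2.
Qed.

End gradient.

(** * The trace inequality in one Lipschitz chart *)

Section chart.
Context {R : realType} {n : nat}.
Local Notation Rn := 'rV[R]_n.
Local Notation leb := (lebesgue_rV R n).
Local Notation surf := (surface_measure R n).
Local Notation leb1 := (@lebesgue_measure R).

Variables (e : Rn) (g : Rn -> R) (L : R).
Hypothesis e1 : enorm e = 1.
Hypothesis gL : forall y z, `|g y - g z| <= L * enorm (y - z).

(** Signed distance to the graph measured along e, not the Euclidean one. Moving by t e adds exactly
    t to it, and its Lipschitz bound compares it with the distance to the boundary. *)
Definition height (x : Rn) : R := dotp x e - g (x - dotp x e *: e).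
Definition foot (x : Rn) : Rn := x - height x *: e.

Lemma dotp_unit : dotp e e = 1. Proof. by rewrite -enorm_sq e1 expr1n. Qed.

Lemma heightD x t : height (x + t *: e) = height x + t.
Proof.
rewrite /height dotpDl dotpZl dotp_unit mulr1.
rewrite (_ : x + t *: e - _ = x - dotp x e *: e); first by rewrite addrAC.
by apply/rowP => i; rewrite !mxE; ring.
Qed.

Lemma height_foot x : height (foot x) = 0.
Proof. by rewrite /foot -scaleNr heightD subrr. Qed.

(** The projection along e is bounded crudely as 2-Lipschitz, and |L| appears because the sign of L
    is not prescribed. *)
Lemma height_lip x y : `|height x - height y| <= (1 + 2 * `|L|) * enorm (x - y).
Proof.
have -> : height x - height y =
    dotp (x - y) e + (g (y - dotp y e *: e) - g (x - dotp x e *: e)).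
  by rewrite /height dotpBl; ring.
have h1 : `|dotp (x - y) e| <= enorm (x - y) by rewrite (le_trans (dotp_le_enorm _ _))// e1 mulr1.
apply: le_trans (ler_normD _ _) _; rewrite mulrDl mul1r lerD//.
apply: (le_trans (gL _ _)).
have h2 : enorm (y - dotp y e *: e - (x - dotp x e *: e)) <= 2 * enorm (x - y).
  rewrite (_ : _ - _ = dotp (x - y) e *: e - (x - y)); last first.
    by rewrite dotpBl; apply/rowP => i; rewrite !mxE; ring.
  apply: (le_trans (enormD _ _)); rewrite enormN enormZ e1 mulr1.
  by rewrite mulrDl mul1r lerD2r.
apply: le_trans (ler_wpM2r (enorm_ge0 _) (ler_norm L)) _.
by rewrite [2 * _]mulrC -mulrA ler_wpM2l.
Qed.

Lemma height_continuous : continuous height.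
Proof. exact: lipschitz_continuous height_lip. Qed.

Lemma measurable_foot : measurable_fun setT foot.
Proof.
apply: measurable_fun_rVP => i.
rewrite (_ : (fun _ => _) = (fun x : Rn => x ord0 i - height x * e ord0 i)); last first.
  by apply/funext => x; rewrite !mxE.
apply: (@continuous_measurable_rV R n (fun x : Rn => x ord0 i - height x * e ord0 i)) => x.
apply: (@continuousB _ _ _ (fun x : Rn => x ord0 i) (fun x => height x * e ord0 i)).
  exact: continuous_coord.
apply: (@continuousM _ _ height (fun=> e ord0 i)); last exact: cst_continuous.
exact: height_continuous.
Qed.

Variables (Om : set Rn) (x0 : Rn) (r : R).
Hypothesis oOm : open Om.
Hypothesis chart : forall y, enorm (y - x0) < r ->
  (Om y <-> g (y - dotp y e *: e) < dotp y e).

Lemma chart_height y : enorm (y - x0) < r -> Om y <-> 0 < height y.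
Proof. by move=> /chart ->; rewrite subr_gt0. Qed.

Lemma boundary_height z : enorm (z - x0) < r -> boundary Om z -> height z = 0.
Proof.
move=> zr; rewrite boundary_open// => -[cz nOz]; apply/eqP; rewrite eq_le; apply/andP; split.
  by rewrite leNgt; apply/negP => /(chart_height zr).
rewrite leNgt; apply/negP => hz.
have oB : open ([set y | enorm (y - x0) < r] `&` height @^-1` [set t | t < 0]).
  apply: openI; first exact: open_eball.
  by apply: open_comp; [move=> x _; exact: height_continuous|exact: open_lt].
have [y [Oy [yr hy]]] := cz _ (open_nbhs_nbhs (conj oB (conj zr hz))).
by have /(chart_height yr) := Oy; move: hy => /= /ltW; rewrite leNgt => /negP.
Qed.

Lemma height_boundary z : enorm (z - x0) < r -> height z = 0 -> boundary Om z.
Proof.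
move=> zr hz; rewrite boundary_open//; split; last by move/(chart_height zr); rewrite hz ltxx.
move=> B /nbhs_ballP[eps /= eps0 zB].
pose t := Num.min (eps / 2) ((r - enorm (z - x0)) / 2).
have t0 : 0 < t by rewrite lt_min !divr_gt0// subr_gt0.
exists (z + t *: e); split.
  apply/chart_height; last by rewrite heightD hz add0r.
  rewrite addrAC; apply: le_lt_trans (enormD _ _) _.
  rewrite enormZ e1 mulr1 gtr0_norm// -ltrBrDl.
  apply: (@le_lt_trans _ _ ((r - enorm (z - x0)) / 2)); first by rewrite ge_min lexx orbT.
  by rewrite ltr_pdivrMr// ltr_pMr ?subr_gt0// ltr1n.
apply: zB; rewrite -ball_normE /= opprD addNKr normrN.
apply: le_lt_trans (norm_le_enorm _) _; rewrite enormZ e1 mulr1 gtr0_norm//.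
apply: (@le_lt_trans _ _ (eps / 2)); first by rewrite ge_min lexx.
by rewrite ltr_pdivrMr// ltr_pMr// ltr1n.
Qed.

(** Extension by zero outside the collar, so that line integrals run over all of [0, T] wherever the
    segment leads, and translation invariance applies. *)
Let H (f : Rn -> R) (T : R) : Rn -> \bar R := (EFin \o grad_sq f) \_ (collar Om T).

Let H_ge0 f T x : (0 <= H f T x)%E.
Proof. by rewrite /H /patch; case: ifP => // _; rewrite lee_fin grad_sq_ge0. Qed.

Let measurable_H f T : smooth f -> measurable_fun setT (H f T).
Proof.
move=> sf; apply/(measurable_restrictT _ _).1; first exact: collar_measurable.
apply/measurable_EFinP; apply: measurable_fun_cont; first exact: collar_measurable.
exact: continuous_grad_sq.
Qed.

(** Half the chart radius: when T <= r / 2, the segment from a point of the slab down to its foot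
    stays inside the chart. *)
Definition chart_slab (T : R) : set Rn :=
  [set x | enorm (x - x0) < r / 2 /\ 0 < height x < T].

Lemma measurable_chart_slab T : measurable (chart_slab T).
Proof.
apply: open_measurable_rV; apply: openI; first exact: open_eball.
rewrite (_ : (fun _ => _) = height @^-1` [set t | 0 < t] `&` height @^-1` [set t | t < T]).
  apply: openI; (apply: open_comp => [x _|]; first exact: height_continuous).
    exact: open_gt.
  exact: open_lt.
by apply/seteqP; split => x /= => [/andP[]//|[-> ->]].
Qed.

(** Write f x as the foot value minus an increment and use a^2 <= 2 b^2 + 2 (b - a)^2. The increment
    along the segment to the foot is bounded by [sq_increment_le], and the segment lies in the
    collar since its points are less than T from the foot. *)
Let pointwise f T x : smooth f -> T <= r / 2 -> chart_slab T x ->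
  ((f x ^+ 2)%:E <= 2%:E * (f (foot x) ^+ 2)%:E +
    (2 * T)%:E * \int[leb1]_(t in `[0%R, T]%classic) H f T (x - t *: e))%E.
Proof.
move=> sf Tr [xr /andP[s0 sT]]; set s := height x in s0 sT.
pose h (t : R) := f (x + t *: - e).
pose h' (t : R) := \sum_i (- e) ord0 i * partial i f (x + t *: - e).
have dh (t : R) : is_derive t 1 h (h' t) by exact: smooth_is_derive_line.
have ch' : continuous h'.
  pose D (y : Rn) := \sum_i (- e) ord0 i * partial i f y.
  have sD : smooth D.
    by apply: smooth_sum => i; apply: smoothM; [exact: smooth_cst|exact: smooth_partial].
  move=> t; apply: differentiable_continuous; apply/derivable1_diffP.
  by have dD := smooth_is_derive_line x (- e) t sD; exact: ex_derive.
have mHx : measurable_fun setT (fun t : measurableTypeR R => H f T (x - t *: e)).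
  apply: (measurableT_comp (measurable_H T sf)).
  apply: measurable_fun_rVP => i.
  rewrite (_ : (fun _ => _) = (fun t : measurableTypeR R => x ord0 i - t * e ord0 i)).
    by apply: measurable_funB => //; apply: measurable_funM.
  by apply/funext => t; rewrite !mxE.
have close t : 0 <= t <= s -> enorm (x - t *: e - x0) < r.
  move=> /andP[t0 ts]; rewrite addrAC; apply: le_lt_trans (enormD _ _) _.
  rewrite enormN enormZ e1 mulr1 ger0_norm//.
  by move: (enorm _) xr => a xr; lra.
have in_collar t : 0 <= t < s -> collar Om T (x - t *: e).
  move=> /andP[t0 ts]; split.
    apply/chart_height; first by apply: close; rewrite t0 ltW.
    by rewrite -scaleNr heightD subr_gt0.
  exists (foot x).
    by apply: height_boundary; [apply: close; rewrite (ltW s0) lexx|exact: height_foot].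
  rewrite (_ : _ - _ = (s - t) *: e); last by apply/rowP => i; rewrite /foot !mxE -/s; ring.
  by rewrite enormZ e1 mulr1 gtr0_norm ?subr_gt0//; lra.
have := sq_increment_le (ltW s0) ch' dh.
have -> : h s = f (foot x) by rewrite /h scalerN.
have -> : h 0 = f x by rewrite /h scale0r addr0.
move=> key; apply: (@le_trans _ _ ((2 * f (foot x) ^+ 2)%:E + (2 * (f (foot x) - f x) ^+ 2)%:E)%E).
  by rewrite lee_fin -subr_ge0 (_ : _ - _ = (2 * f (foot x) - f x) ^+ 2) ?sqr_ge0//; ring.
rewrite EFinM; apply: leeD2l; rewrite !EFinM -muleA; apply: lee_wpmul2l => //.
apply: le_trans key _; apply: (@le_trans _ _
  (s%:E * \int[leb1]_(t in `[0%R, T]%classic) H f T (x - t *: e))%E); last first.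
  by apply: lee_wpmul2r; [apply: integral_ge0 => t _; exact: H_ge0|rewrite lee_fin ltW].
apply: lee_wpmul2l; first by rewrite lee_fin ltW.
have mh : measurable_fun setT (fun t => (h' t ^+ 2)%:E).
  by apply/measurable_EFinP; apply: measurable_funX; exact: continuous_measurable_fun.
(* At t = s the point is [foot x], on the boundary and so outside the collar; the endpoint has
   measure zero and is dropped. *)
rewrite -integral_itv_bndo_bndc; last exact: measurable_funS mh.
apply: (@le_trans _ _ (\int[leb1]_(t in `[0%R, s[%classic) H f T (x - t *: e))%E).
  apply: ge0_le_integral => //.
  - by move=> t _; rewrite lee_fin sqr_ge0.
  - exact: measurable_funS mh.
  - exact: measurable_funS mHx.
  - move=> t /=; rewrite in_itv /= => ts.
    rewrite /H patchT ?inE; last exact: in_collar.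
    by rewrite lee_fin /h' scalerN; apply: directional_sq_le; rewrite enormN.
apply: ge0_subset_integral => //.
- exact: measurable_funS mHx.
- by move=> t; rewrite /= !in_itv /= => /andP[-> /ltW ts] /=; exact: le_trans ts (ltW sT).
Qed.

(** Integration of [pointwise] over the slab: the foot term is a tube integral and gives 2 C T; the
    line integrals give 2 T times a further T, hence T^2 in front of the gradient. *)
Lemma chart_trace : (2 <= n)%N -> exists2 C : R, 0 < C & forall T f, smooth f -> 0 < T ->
  T <= r / 2 -> (\int[leb]_(x in chart_slab T) (f x ^+ 2)%:E <=
    (C * T)%:E * \int[surf]_(x in boundary Om) (f (x : Rn) ^+ 2)%:E +
    (C * T ^+ 2)%:E * \int[leb]_(x in collar Om T) (grad_sq f x)%:E)%E.
Proof.
move=> n2; have [C C0 hC] := @tube_integral R n n2; exists (2 * C + 2) => [|T f sf T0 Tr].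
  by rewrite addr_gt0 ?mulr_gt0.
have mS := measurable_chart_slab T.
have mf2 : measurable_fun setT (fun x => (f x ^+ 2)%:E).
  apply/measurable_EFinP; apply: measurable_funX.
  by apply: measurable_fun_cont => //; exact: smooth_continuous.
have mff : measurable_fun setT (fun x => (f (foot x) ^+ 2)%:E).
  exact: (measurableT_comp mf2 measurable_foot).
have f20 x : (0 <= (f x ^+ 2)%:E)%E by rewrite lee_fin sqr_ge0.
have [mI hI] := ge0_line_integral e (ltW T0) mS (measurable_H T sf) (H_ge0 f T).
set I := fun x : Rn => _ in mI hI.
have I0 x : (0 <= I x)%E by apply: integral_ge0 => t _; exact: H_ge0.
have mG := measurable_boundary Om.
have slab_foot x : chart_slab T x -> boundary Om (foot x) /\
    exists2 t, 0 <= t <= T & x = foot x + t *: e.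
  move=> [xr /andP[s0 sT]]; split; last first.
    by exists (height x); [rewrite !ltW|rewrite /foot subrK].
  apply: height_boundary; last exact: height_foot.
  rewrite /foot addrAC; apply: le_lt_trans (enormD _ _) _.
  by rewrite enormN enormZ e1 mulr1 gtr0_norm//; move: (enorm _) xr => a xr; lra.
have h1 := hC e T (boundary Om) (chart_slab T) foot _ e1 T0 mS mG measurable_foot slab_foot mf2 f20.
have mc (c : R) (k : Rn -> \bar R) : measurable_fun setT k ->
    measurable_fun (chart_slab T) (fun x => c%:E * k x)%E.
  by move=> mk; apply: measurable_funeM; exact: measurable_funS mk.
have T20 : 0 <= 2 * T by rewrite mulr_ge0// ltW.
have c0 (c : R) (k : Rn -> \bar R) : 0 <= c -> (forall x, 0 <= k x)%E ->
    forall x, (0 <= c%:E * k x)%E.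
  by move=> cge kge x; rewrite mule_ge0.
apply: (@le_trans _ _ (\int[leb]_(x in chart_slab T)
   (2%:E * (f (foot x) ^+ 2)%:E + (2 * T)%:E * I x))%E).
  apply: ge0_le_integral => //.
  - exact: measurable_funS mf2.
  - by apply: emeasurable_funD; [exact: mc|exact: mc].
  - by move=> x Sx; exact: pointwise.
rewrite ge0_integralD//; last 4 first.
- by move=> x _; apply: (c0 2 (fun x => (f (foot x) ^+ 2)%:E)) => // y; exact: f20.
- exact: mc.
- by move=> x _; exact: c0.
- exact: mc.
rewrite ge0_integralZl_EFin//; last exact: measurable_funS mff.
rewrite ge0_integralZl_EFin//; last exact: measurable_funS mI.
have surf0 : (0 <= \int[surf]_(x in boundary Om) (f (x : Rn) ^+ 2)%:E)%E.
  by apply: integral_ge0 => x _; exact: f20.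
apply: leeD.
  apply: (le_trans (lee_wpmul2l _ h1)); first by rewrite lee_fin.
  rewrite muleA -EFinM; apply: lee_wpmul2r => //.
  by rewrite lee_fin mulrA ler_wpM2r ?(ltW T0)// lerDl.
apply: (le_trans (lee_wpmul2l _ hI)); first by rewrite lee_fin.
rewrite muleA -EFinM (integral_mkcond (collar Om T)).
apply: lee_wpmul2r; first by apply: integral_ge0 => x _; exact: H_ge0.
rewrite lee_fin -mulrA -expr2 ler_wpM2r ?sqr_ge0// lerDr mulr_ge0 ?(ltW C0)//.
Qed.

End chart.

(** * From charts to the whole collar *)

Section collar_estimates.
Context {R : realType} {n : nat}.
Local Notation Rn := 'rV[R]_n.
Local Notation leb := (lebesgue_rV R n).
Local Notation surf := (surface_measure R n).

Lemma ge0_integral_setU_le (A B : set Rn) (f : Rn -> \bar R) : measurable A -> measurable B ->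
  measurable_fun setT f -> (forall x, (0 <= f x)%E) ->
  (\int[leb]_(x in A `|` B) f x <= \int[leb]_(x in A) f x + \int[leb]_(x in B) f x)%E.
Proof.
move=> mA mB mf f0; rewrite (_ : A `|` B = A `|` (B `\` A)); last first.
  apply/seteqP; split => x [Ax|]; [by left| |by left|by move=> [Bx _]; right].
  by have [Ax _|nAx Bx] := pselect (A x); [left|right].
have mBA : measurable (B `\` A) by exact: measurableD.
rewrite ge0_integral_setU//; last 2 first.
- exact: measurable_funS mf.
- by apply/disj_set2P; rewrite setDE setICA setICr setI0.
apply: leeD2l; apply: ge0_subset_integral => //; first exact: measurable_funS mf.
Qed.

Variable Om : set Rn.
Hypothesis oOm : open Om.

(** The segment from x to y stays at distance less than d from x, so it avoids the boundary. Its
    parameters lying in Om are then both open and closed in [0, 1], and connectedness carries Om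
    from x to y. *)
Lemma eball_sub (x : Rn) (d : R) : Om x -> (forall z, boundary Om z -> d <= enorm (x - z)) ->
  forall y, enorm (x - y) < d -> Om y.
Proof.
move=> Ox far y xy.
pose c (t : R) : Rn := x + t *: (y - x).
have cc : continuous c.
  move=> t; apply: cvgD; first exact: cvg_cst.
  by apply: cvgZr_tmp; exact: cvg_id.
have cOm (t : R) : 0 <= t <= 1 -> closure Om (c t) -> Om (c t).
  move=> /andP[t0 t1] cl; apply: contrapT => nO.
  have : boundary Om (c t) by rewrite boundary_open.
  move/far; apply/negP; rewrite -ltNge; apply: le_lt_trans xy.
  rewrite /c opprD addNKr -scalerN opprB enormZ ger0_norm//.
  by rewrite ler_piMl// enorm_ge0.
have con : connected (`[0, 1]%classic : set R) by exact: segment_connected.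
have E : `[0, 1]%classic `&` c @^-1` Om = (`[0, 1]%classic : set R).
  apply: con.
  - by exists 0; split => /=; rewrite ?in_itv/= ?lexx ?ler01// /c scale0r addr0.
  - by exists (c @^-1` Om) => //; apply: open_comp.
  - exists (c @^-1` closure Om).
      by apply: closed_comp => //; exact: closed_closure.
    apply/seteqP; split => t [t01 Ot]; split => //; first exact: subset_closure.
    by apply: cOm => //; rewrite /= in_itv in t01.
have : (`[0, 1]%classic `&` c @^-1` Om) 1 by rewrite E /= in_itv /= lexx ler01.
by move=> [_]; rewrite /= /c scale1r addrC subrK.
Qed.

(** Each point of the open set Om leaves the collars of small width, so dominated convergence
    applies along the widths 1 / (k+1). *)
Lemma collar_tail (f : Rn -> R) : leb.-integrable Om (EFin \o f) -> (forall x, 0 <= f x) ->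
  forall eps : R, 0 < eps -> exists2 d0 : R, 0 < d0 &
  forall d, d <= d0 -> (\int[leb]_(x in collar Om d) (f x)%:E < eps%:E)%E.
Proof.
move=> If f0 eps eps0; have mOm := open_measurable_rV oOm.
pose C k := collar Om k.+1%:R^-1.
have mC k : measurable (C k) by exact: collar_measurable.
pose fk (k : nat) : Rn -> \bar R := (EFin \o f) \_ (C k).
have mf : measurable_fun Om (EFin \o f) by exact: measurable_int If.
have mfk k : measurable_fun Om (fk k).
  apply/(measurable_restrict _ _ _).1 => //; apply: measurable_funS mf => //.
have fkE k : (\int[leb]_(x in Om) fk k x = \int[leb]_(x in C k) (f x)%:E)%E.
  rewrite integral_mkcond (integral_mkcond (C k)); apply: eq_integral => x _.
  rewrite /fk !patchE; case: ifPn => // xO; case: ifPn => // /set_mem[Ox].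
  by rewrite (mem_set Ox) in xO.
have cv : (\int[leb]_(x in Om) fk k x @[k --> \oo] --> \int[leb]_(x in Om) (cst 0%E x))%E.
  apply: (@dominated_cvg _ _ _ leb Om mOm fk (cst 0%E) (EFin \o f)) => //.
  - move=> x Ox.
    have /nbhs_ballP[e /= e0 xe] := open_nbhs_nbhs (conj oOm Ox).
    have [k0 _ hk0] := near_infty_natSinv_lt (PosNum e0).
    apply: cvg_near_cst.
    exists k0 => // k kk0; rewrite /fk patchE memNset// => -[_ [z Gz xz]].
    move: Gz; rewrite boundary_open// => -[_]; apply; apply: xe.
    rewrite -ball_normE /=; apply: le_lt_trans (norm_le_enorm _) _.
    by apply: lt_trans xz _; exact: (hk0 k kk0).
  - move=> k x Ox; rewrite /fk patchE; case: ifPn => _ /=; last by rewrite normr0 lee_fin.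
    by rewrite ger0_norm.
rewrite integral0 in cv.
have [N _ hN] : \forall k \near \oo, (\int[leb]_(x in Om) fk k x < eps%:E)%E.
  apply: (cv [set x | x < eps%:E]%E); apply: open_nbhs_nbhs; split; last by rewrite /= lte_fin.
  exact: open_ereal_lt_ereal.
exists N.+1%:R^-1 => [|d dN]; first by rewrite invr_gt0.
have := hN N (leqnn N); rewrite /= fkE; apply: le_lt_trans.
apply: ge0_subset_integral => //; first exact: collar_measurable.
- by apply: measurable_funS mf => // x [].
- by move=> x _; rewrite lee_fin.
- exact: le_collar.
Qed.

Definition collar_on (V : set Rn) (d : R) : set Rn :=
  [set x | Om x /\ exists2 z, boundary Om z /\ V z & enorm (x - z) < d].

(** Only the left side is localised to V; the right side keeps the whole boundary and a whole
    collar, so bounds for finitely many V add up. The dilation M accounts for height against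
    distance. *)
Definition collar_bound (V : set Rn) : Prop := exists A M d0 : R, [/\ 0 < A, 0 < M, 0 < d0 &
  forall d f, 0 < d -> d <= d0 -> smooth f ->
  (\int[leb]_(x in collar_on V d) (f x ^+ 2)%:E <=
    (A * d)%:E * \int[surf]_(x in boundary Om) (f (x : Rn) ^+ 2)%:E +
    (A * d ^+ 2)%:E * \int[leb]_(x in collar Om (M * d)) (grad_sq f x)%:E)%E].

Lemma collar_on_measurable V d : measurable (collar_on V d).
Proof.
apply: open_measurable_rV.
rewrite (_ : collar_on V d = Om `&` \bigcup_(z in boundary Om `&` V) [set x | enorm (x - z) < d]).
  by apply: openI => //; apply: bigcup_open => z _; exact: open_eball.
by apply/seteqP; split => x [Ox [z Gz xz]]; split => //; exists z.
Qed.

Let measurable_sq (f : Rn -> R) : smooth f -> measurable_fun setT (fun x => (f x ^+ 2)%:E).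
Proof.
move=> sf; apply/measurable_EFinP; apply: measurable_funX.
by apply: measurable_fun_cont => //; exact: smooth_continuous.
Qed.

Let measurable_grad_sq (f : Rn -> R) (D : set Rn) : measurable D -> smooth f -> measurable_fun D (fun x => (grad_sq f x)%:E).
Proof.
move=> mD sf; apply/measurable_EFinP; apply: measurable_fun_cont => //.
exact: continuous_grad_sq.
Qed.

Lemma collar_boundU V W : collar_bound V -> collar_bound W -> collar_bound (V `|` W).
Proof.
move=> [A1 [M1 [d1 [A10 M10 d10 h1]]]] [A2 [M2 [d2 [A20 M20 d20 h2]]]].
exists (A1 + A2), (Num.max M1 M2), (Num.min d1 d2); split => [||| d f d0].
- by rewrite addr_gt0.
- by rewrite lt_max M10.
- by rewrite lt_min d10 d20.
rewrite le_min => /andP[dd1 dd2] sf.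
have -> : collar_on (V `|` W) d = collar_on V d `|` collar_on W d.
  apply/seteqP; split => x.
    by move=> [Ox [z [Gz [Vz|Wz]] xz]]; [left|right]; split => //; exists z.
  by move=> [|] [Ox [z [Gz Vz] xz]]; split => //; exists z => //; split => //; [left|right].
apply: le_trans (ge0_integral_setU_le (collar_on_measurable V d) (collar_on_measurable W d)
  (measurable_sq sf) _) _; first by move=> x; rewrite lee_fin sqr_ge0.
apply: le_trans (leeD (h1 d f d0 dd1 sf) (h2 d f d0 dd2 sf)) _.
have S0 : (0 <= \int[surf]_(x in boundary Om) (f (x : Rn) ^+ 2)%:E)%E.
  by apply: integral_ge0 => x _; rewrite lee_fin sqr_ge0.
have mono M : M <= Num.max M1 M2 ->
  (\int[leb]_(x in collar Om (M * d)) (grad_sq f x)%:E <=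
   \int[leb]_(x in collar Om (Num.max M1 M2 * d)) (grad_sq f x)%:E)%E.
  move=> MM; apply: ge0_subset_integral => //; try exact: collar_measurable.
  - by apply: measurable_grad_sq => //; exact: collar_measurable.
  - by move=> x _; rewrite lee_fin grad_sq_ge0.
  - by apply: le_collar; rewrite ler_wpM2r// ltW.
rewrite addeACA; apply: leeD.
  by rewrite mulrDl EFinD ge0_muleDl ?lee_fin ?mulr_ge0 ?(ltW A10) ?(ltW A20) ?(ltW d0).
rewrite mulrDl EFinD ge0_muleDl ?lee_fin ?mulr_ge0 ?sqr_ge0 ?(ltW A10) ?(ltW A20) ?(ltW d0)//.
apply: leeD; apply: lee_wpmul2l; rewrite ?lee_fin ?mulr_ge0 ?sqr_ge0 ?(ltW A10) ?(ltW A20) ?(ltW d0)//.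
  by apply: mono; rewrite le_max lexx.
by apply: mono; rewrite le_max lexx orbT.
Qed.

Lemma collar_bound0 : collar_bound set0.
Proof.
exists 1, 1, 1; split => // d f d0 _ sf.
have -> : collar_on set0 d = set0 by apply/seteqP; split => x // [_ [z []]].
rewrite integral_set0 adde_ge0// mule_ge0//.
- by rewrite lee_fin mul1r ltW.
- by apply: integral_ge0 => x _; rewrite lee_fin sqr_ge0.
- by rewrite lee_fin mul1r sqr_ge0.
- by apply: integral_ge0 => x _; rewrite lee_fin grad_sq_ge0.
Qed.

(** M is the Lipschitz constant of [height], which vanishes on the boundary, so points within d of
    the boundary have height below M d. The radius r / 4 together with d <= r / 4 keeps them within
    r / 2 of x0, that is in the slab. *)
Lemma collar_bound_chart (n2 : (2 <= n)%N) (e : Rn) g (L : R) x0 (r : R) :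
  enorm e = 1 -> 0 < r -> (forall y z, `|g y - g z| <= L * enorm (y - z)) ->
  (forall y, enorm (y - x0) < r -> Om y <-> g (y - dotp y e *: e) < dotp y e) ->
  collar_bound [set z | enorm (z - x0) < r / 4].
Proof.
move=> e1 r0 gL chart; have [C C0 hC] := chart_trace e1 gL oOm chart n2.
pose M := 1 + 2 * `|L|; have M0 : 0 < M by rewrite ltr_wpDr// mulr_ge0.
pose d0 := Num.min (r / 4) (r / 2 / M).
exists (C * M + C * M ^+ 2), M, d0; split => [|//||d f dpos].
- by rewrite addr_gt0 ?mulr_gt0 ?exprn_gt0.
- by rewrite lt_min !divr_gt0.
rewrite le_min => /andP[dr dM] sf.
have T0 : 0 < M * d by rewrite mulr_gt0.
have Tr : M * d <= r / 2 by rewrite mulrC -ler_pdivlMr.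
have sub : collar_on [set z | enorm (z - x0) < r / 4] d `<=` chart_slab e g x0 r (M * d).
  move=> x [Ox [z [Gz /= zx0] xz]].
  have xr : enorm (x - x0) < r / 2.
    by apply: le_lt_trans (enorm_triangle z x x0) _; lra.
  split => //; apply/andP; split; first by apply/(chart_height chart) => //; lra.
  have hz : height e g z = 0 by apply: (boundary_height e1 gL oOm chart) => //; lra.
  have := height_lip e1 gL x z; rewrite hz subr0 => h.
  apply: le_lt_trans (ler_norm _) _; apply: le_lt_trans h _.
  by rewrite ltr_pM2l.
apply: (@le_trans _ _ (\int[leb]_(x in chart_slab e g x0 r (M * d)) (f x ^+ 2)%:E)%E).
  apply: ge0_subset_integral => //.
  - exact: collar_on_measurable.
  - exact: measurable_chart_slab gL _ _ _.
  - by apply: measurable_funS (measurable_sq sf).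
  - by move=> x _; rewrite lee_fin sqr_ge0.
apply: le_trans (hC _ _ sf T0 Tr) _; apply: leeD; apply: lee_wpmul2r.
- by apply: integral_ge0 => x _; rewrite lee_fin sqr_ge0.
- rewrite lee_fin mulrA ler_wpM2r ?(ltW dpos)// lerDl.
  by rewrite mulr_ge0 ?exprn_ge0// ltW.
- by apply: integral_ge0 => x _; rewrite lee_fin grad_sq_ge0.
- rewrite lee_fin exprMn mulrA ler_wpM2r ?sqr_ge0// lerDr.
  by rewrite mulr_ge0// ltW.
Qed.

(** The boundary is compact, so finitely many chart balls cover it and [collar_boundU] joins their
    bounds. *)
Lemma collar_trace : (2 <= n)%N -> bounded_set Om -> lipschitz_boundary Om ->
  exists A M d0 : R, [/\ 0 < A, 0 < M, 0 < d0 &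
  forall d f, 0 < d -> d <= d0 -> smooth f ->
  (\int[leb]_(x in collar Om d) (f x ^+ 2)%:E <=
    (A * d)%:E * \int[surf]_(x in boundary Om) (f (x : Rn) ^+ 2)%:E +
    (A * d ^+ 2)%:E * \int[leb]_(x in collar Om (M * d)) (grad_sq f x)%:E)%E].
Proof.
move=> n2 bOm lOm.
have /choice[r hr] : forall x, exists r : R, boundary Om x ->
    0 < r /\ collar_bound [set z | enorm (z - x) < r].
  move=> x; have [Gx|nGx] := pselect (boundary Om x); last by exists 0.
  have [e [g [L [r [e1 r0 gL chart]]]]] := lOm x Gx.
  by exists (r / 4) => _; split; [rewrite divr_gt0|exact: collar_bound_chart chart].
have cG : compact (boundary Om).
  apply: bounded_closed_compact; last exact: boundary_closed.
  have [M [Mr hM]] := bOm; exists M; split => // y My x [cx _].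
  have cl : closed [set x : Rn | `|x| <= y].
    rewrite (_ : [set x : Rn | _] = Num.Def.normr @^-1` [set t | t <= y])//.
    by apply: closed_comp => [z _|]; [exact: norm_continuous|exact: closed_le].
  have : closure [set x : Rn | `|x| <= y] x.
    by apply: (closureS _ cx) => z Oz; exact: hM Oz.
  by rewrite -(closure_id _).1.
rewrite compact_cover in cG.
have [||D sD cov] := cG Rn (boundary Om) (fun x => [set z | enorm (z - x) < r x]).
- by move=> x _; exact: open_eball.
- by move=> x Gx; exists x => //=; rewrite subrr enorm0; have [] := hr x Gx.
have fin (s : seq Rn) : {subset s <= boundary Om} ->
    collar_bound [set z | exists2 x, x \in s & enorm (z - x) < r x].
  elim: s => [_|x s IH xsG].
    rewrite (_ : [set z | _] = set0); first exact: collar_bound0.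
    by apply/seteqP; split => z // [].
  rewrite (_ : [set z | _] = [set z | enorm (z - x) < r x] `|`
    [set z | exists2 x, x \in s & enorm (z - x) < r x]); last first.
    apply/seteqP; split => z.
      by move=> [y]; rewrite inE => /orP[/eqP ->|ys] h; [left|right; exists y].
    by move=> [h|[y ys h]]; [exists x; rewrite ?mem_head|exists y; rewrite // inE ys orbT].
  apply: collar_boundU.
    by have [] := hr x (set_mem (xsG x (mem_head _ _))).
  by apply: IH => y ys; apply: xsG; rewrite inE ys orbT.
have [A [M [d0 [A0 M0 d00 h]]]] := fin _ sD.
exists A, M, d0; split => // d f dpos dd0 sf.
apply: le_trans (h d f dpos dd0 sf); apply: ge0_subset_integral.
- exact: collar_measurable.
- exact: collar_on_measurable.
- exact: measurable_funS (measurable_sq sf).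
- by move=> x _; rewrite lee_fin sqr_ge0.
move=> x [Ox [z Gz xz]]; split => //; exists z => //; split => //.
by have [y yD zy] := cov _ Gz; exists y.
Qed.

End collar_estimates.

(** * Functions with zero trace *)

Section square_integrals.
Context {d} {T : measurableType d} {R : realType} (mu : {measure set T -> \bar R}) (D : set T).
Hypothesis mD : measurable D.
Implicit Types (f g : T -> R).

Lemma integral_sqB_le f g : measurable_fun D f -> measurable_fun D g ->
  (\int[mu]_(x in D) ((f x - g x) ^+ 2)%:E <=
   2%:E * \int[mu]_(x in D) (f x ^+ 2)%:E + 2%:E * \int[mu]_(x in D) (g x ^+ 2)%:E)%E.
Proof.
move=> mf mg.
have mf2 : measurable_fun D (fun x => (f x ^+ 2)%:E).
  by apply/measurable_EFinP; exact: measurable_funX.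
have mg2 : measurable_fun D (fun x => (g x ^+ 2)%:E).
  by apply/measurable_EFinP; exact: measurable_funX.
have p f' x : (0 <= (f' x ^+ 2)%:E :> \bar R)%E by rewrite lee_fin sqr_ge0.
have q f' x : (0 <= 2%:E * (f' x ^+ 2)%:E :> \bar R)%E by apply: mule_ge0.
rewrite -(ge0_integralZl_EFin mu mD (fun x _ => p f x) mf2)// -(ge0_integralZl_EFin mu mD (fun x _ => p g x) mg2)//.
rewrite -ge0_integralD//; last 2 first.
- exact: measurable_funeM.
- exact: measurable_funeM.
apply: ge0_le_integral => //.
- by move=> x _; rewrite lee_fin sqr_ge0.
- by apply/measurable_EFinP; apply: measurable_funX; exact: measurable_funB.
- by apply: emeasurable_funD; exact: measurable_funeM.
- move=> x _; rewrite -!EFinM -EFinD lee_fin -subr_ge0.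
  by rewrite (_ : _ - _ = (f x + g x) ^+ 2) ?sqr_ge0//; ring.
Qed.

Lemma ae_integral_sqB f g : measurable_fun D f -> measurable_fun D g ->
  {ae mu, forall x, D x -> g x = 0} ->
  (\int[mu]_(x in D) (f x ^+ 2)%:E = \int[mu]_(x in D) ((f x - g x) ^+ 2)%:E)%E.
Proof.
move=> mf mg g0; apply: ge0_ae_eq_integral => //.
- by apply/measurable_EFinP; exact: measurable_funX.
- by apply/measurable_EFinP; apply: measurable_funX; exact: measurable_funB.
- by move=> x _; rewrite lee_fin sqr_ge0.
- by move=> x _; rewrite lee_fin sqr_ge0.
- by apply: filterS g0 => x g0x Dx; rewrite g0x// subr0.
Qed.

End square_integrals.

Section trace_kernel.
Context {R : realType} {n : nat}.
Local Notation Rn := 'rV[R]_n.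
Local Notation leb := (lebesgue_rV R n).
Local Notation surf := (surface_measure R n).
Variable Om : set Rn.
Hypotheses (oOm : open Om) (bOm : bounded_set Om).
Local Notation ipO := (ip (mu := leb) (D := Om)).
Local Notation wp := (wpartial Om).
Implicit Types (u v f h : Rn -> R).

Let mOm : measurable Om. Proof. exact: open_measurable_rV. Qed.

Lemma ip_integral f : L2 Om f -> (ipO f f)%:E = (\int[leb]_(x in Om) (f x ^+ 2)%:E)%E.
Proof.
move=> [mf If]; rewrite ipE /Rintegral fineK.
  by apply: eq_integral => x _; rewrite expr2.
by rewrite (eq_integral (fun x => (f x ^+ 2)%:E)) ?integrable_fin_num// => x _; rewrite expr2.
Qed.

Lemma sum_ip_integral (F : 'I_n -> Rn -> R) : (forall i, L2 Om (F i)) ->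
  (\sum_i ipO (F i) (F i))%:E = (\int[leb]_(x in Om) (\sum_i F i x ^+ 2)%:E)%E.
Proof.
move=> LF; rewrite -sumEFin.
under eq_bigr do rewrite ip_integral//.
under [RHS]eq_integral do rewrite -sumEFin.
rewrite ge0_integral_sum// => i; last by move=> x _; rewrite lee_fin sqr_ge0.
by have [mF _] := LF i; apply/measurable_EFinP; exact: measurable_funX.
Qed.

Lemma smooth_H1norm_sq f : smooth f ->
  (H1norm Om f ^+ 2)%:E =
  (\int[leb]_(x in Om) (f x ^+ 2)%:E + \int[leb]_(x in Om) (grad_sq f x)%:E)%E.
Proof.
move=> sf; rewrite H1norm_sq EFinD ip_integral; last exact: smooth_L2.
congr (_ + _)%E; rewrite dirE -sum_ip_integral; last first.
  by move=> i; apply: smooth_L2 => //; exact: smooth_partial.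
congr EFin; apply: eq_bigr => i _.
have Lp : L2 Om (partial i f) by apply: smooth_L2 => //; exact: smooth_partial.
have Lw : L2 Om (wp i f) by apply: wpartial_L2; exact: smooth_H1.
have E := wpartial_smooth oOm bOm i sf.
by rewrite (ip_ae mOm Lw Lp Lw E) ipC (ip_ae mOm Lw Lp Lp E).
Qed.

(** The smooth approximation f will be chosen after the collar width, so the smallness of its
    gradient on a collar has to be read off from the fixed function v, up to the approximation
    error. *)
Lemma grad_sq_le_weak v f (S : set Rn) : H1 Om v -> smooth f -> measurable S -> S `<=` Om ->
  (\int[leb]_(x in S) (grad_sq f x)%:E <=
   2%:E * \int[leb]_(x in S) (\sum_i wp i v x ^+ 2)%:E + (2 * H1norm Om (v \- f) ^+ 2)%:E)%E.
Proof.
move=> Hv sf mS SO; have Hf := smooth_H1 oOm bOm sf.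
pose G i x := wp i v x - partial i f x.
have Lw i := wpartial_L2 i Hv.
have Lp i : L2 Om (partial i f) by apply: smooth_L2 => //; exact: smooth_partial.
have LG i : L2 Om (G i) := sqiB mOm (Lw i) (Lp i).
have Lvf i : L2 Om (wp i (v \- f)) by apply: wpartial_L2; exact: H1B.
have aeG i : ae_eq leb Om (wp i (v \- f)) (G i).
  have h1 := wpartial_lin oOm bOm i (-1) Hv Hf; have h2 := wpartial_smooth oOm bOm i sf.
  rewrite subE; apply: filterS2 h1 h2 => x h1 h2 Ox; rewrite h1// h2//.
  by rewrite /G mulN1r.
have msq (F : 'I_n -> Rn -> R) D : measurable D -> D `<=` Om -> (forall i, L2 Om (F i)) ->
    measurable_fun D (fun x => (\sum_i F i x ^+ 2)%:E).
  move=> mD DO LF; apply/measurable_EFinP; apply: measurable_sum => i.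
  by have [mF _] := LF i; apply: measurable_funX; exact: measurable_funS mF.
have s0 (F : 'I_n -> Rn -> R) x : (0 <= (\sum_i F i x ^+ 2)%:E)%E.
  by rewrite lee_fin sumr_ge0// => i _; exact: sqr_ge0.
have mp := msq (fun i => partial i f) S mS SO Lp.
have mw := msq (fun i => wp i v) S mS SO Lw.
have mG := msq G S mS SO LG.
apply: (@le_trans _ _ (\int[leb]_(x in S)
    (2%:E * (\sum_i wp i v x ^+ 2)%:E + 2%:E * (\sum_i G i x ^+ 2)%:E))%E).
  apply: ge0_le_integral => //.
  - by move=> x _; rewrite lee_fin grad_sq_ge0.
  - by apply: emeasurable_funD; exact: measurable_funeM.
  - move=> x _; rewrite -!EFinM -EFinD lee_fin /grad_sq !mulr_sumr -big_split /=.
    apply: ler_sum => i _; rewrite /G -subr_ge0.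
    by rewrite (_ : _ - _ = (2 * wp i v x - partial i f x) ^+ 2) ?sqr_ge0//; ring.
rewrite ge0_integralD//; last 4 first.
- by move=> x _; apply: mule_ge0 => //; exact: (s0 (fun i => wp i v)).
- exact: measurable_funeM.
- by move=> x _; apply: mule_ge0 => //; exact: (s0 G).
- exact: measurable_funeM.
have Z (F : 'I_n -> Rn -> R) : (forall i, L2 Om (F i)) ->
    (\int[leb]_(x in S) (2%:E * (\sum_i F i x ^+ 2)%:E) =
     2%:E * \int[leb]_(x in S) (\sum_i F i x ^+ 2)%:E)%E.
  move=> LF; apply: ge0_integralZl_EFin => //; exact: msq.
rewrite (Z (fun i => wp i v) Lw) (Z G LG); apply: leeD2l; rewrite EFinM; apply: lee_wpmul2l => //.
apply: (@le_trans _ _ (\int[leb]_(x in Om) (\sum_i G i x ^+ 2)%:E)%E).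
  by apply: ge0_subset_integral => //; exact: msq.
rewrite -sum_ip_integral// lee_fin; apply: le_trans (dir_le_H1norm _ _).
rewrite dirE; apply: ler_sum => i _.
by rewrite (ip_ae mOm (Lvf i) (LG i) (Lvf i) (aeG i)) ipC (ip_ae mOm (Lvf i) (LG i) (LG i) (aeG i)).
Qed.

(** psi = eta f differs from f only on the collar, by (eta - 1) f, whose derivatives are (eta - 1)
    d_i f + f d_i eta with |d_i eta| <= B / d. In K, 2 n B^2 comes from the n derivatives and 1 from
    the L2 term, as 1 <= d^-2. *)
Lemma cutoff_error : exists2 K : R, 0 < K & forall d f, 0 < d -> d <= 1 -> smooth f ->
  exists2 psi, test_function Om psi &
  ((H1norm Om (psi \- f) ^+ 2)%:E <=
   (K / d ^+ 2)%:E * \int[leb]_(x in collar Om d) (f x ^+ 2)%:E +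
   2%:E * \int[leb]_(x in collar Om d) (grad_sq f x)%:E)%E.
Proof.
have [C C0 hC] := @cutoff R n.
pose B := C * (4 * n.+1%:R); have B0 : 0 < B by rewrite !mulr_gt0.
pose K := 1 + 2 * n%:R * B ^+ 2.
have K0 : 0 < K by rewrite ltr_wpDr// !mulr_ge0// ltW.
exists K => // d f d0 d1 sf.
(* [cutoff] gives eta = 1 where the sup-norm ball of radius 4 dd lies inside Om; the factor n + 1
   puts this ball inside the Euclidean ball of radius d. *)
pose dd := d / (4 * n.+1%:R); have dd0 : 0 < dd by rewrite divr_gt0// mulr_gt0.
have [eta [Kc [se [cK KO] K0' [e01 de] e1]]] := hC Om dd bOm dd0.
have Cdd : C / dd = B / d.
  by rewrite /dd /B; field; rewrite gt_eqF//= (gt_eqF (ltr0Sn R n)).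
pose psi x := eta x * f x.
exists psi.
  split; first exact: smoothM.
  by exists Kc; split => // x /K0' E; rewrite /psi E mul0r.
have spsi : smooth psi by exact: smoothM.
pose h := psi \- f.
have sh : smooth h by exact: smoothB.
have dh i x : partial i h x = (eta x - 1) * partial i f x + partial i eta x * f x.
  rewrite /h (_ : psi \- f = (fun x => psi x - f x))// partialB//.
  by rewrite /psi partialM//; ring.
have mC : measurable (collar Om d) by exact: collar_measurable.
have CO : collar Om d `<=` Om by move=> x [].
have mCD : measurable (Om `\` collar Om d) by exact: measurableD.
have off x : Om x -> ~ collar Om d x -> eta x = 1 /\ forall i, partial i eta x = 0.
  move=> Ox nC; apply: e1 => y; rewrite rV_ball_norm => xy.
  apply: (eball_sub oOm Ox (d := d)).
    by move=> z Gz; rewrite leNgt; apply/negP => xz; apply: nC; split => //; exists z.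
  apply: le_lt_trans (enorm_le_norm _) _.
  rewrite mulrC -ltr_pdivlMr//; apply: lt_le_trans xy _.
  rewrite /dd le_eqVlt; apply/orP; left; apply/eqP.
  have : n.+1%:R != 0 :> R by rewrite pnatr_eq0.
  by move: (n.+1%:R : R) => N N0; field.
have mc g D : measurable D -> continuous g -> measurable_fun D (fun x : Rn => (g x : R)%:E).
  by move=> mD cg; apply/measurable_EFinP; exact: measurable_fun_cont.
have cf2 g : smooth g -> continuous (fun x : Rn => g x ^+ 2).
  by move=> sg x; under eq_fun do rewrite expr2; apply: continuousM; exact: smooth_continuous.
have loc (g : Rn -> R) : continuous g -> (forall x, 0 <= g x) ->
    (forall x, Om x -> ~ collar Om d x -> g x = 0) ->
    (\int[leb]_(x in Om) (g x)%:E <= \int[leb]_(x in collar Om d) (g x)%:E)%E.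
  move=> cg g0 goff.
  have := @ge0_integral_setU_le R n (collar Om d) (Om `\` collar Om d) (fun x => (g x)%:E) mC mCD.
  rewrite setDUK// => /(_ _ _)/le_trans; apply.
  - exact: mc.
  - by move=> x; rewrite lee_fin.
  by rewrite [X in (_ + X)%E]integral0_eq ?adde0// => x [Ox nC]; rewrite goff.
have hoff x : Om x -> ~ collar Om d x -> h x = 0.
  by move=> Ox nC; have [E _] := off x Ox nC; rewrite /h /psi /= E mul1r subrr.
have goff x : Om x -> ~ collar Om d x -> grad_sq h x = 0.
  move=> Ox nC; have [E dE] := off x Ox nC.
  by rewrite /grad_sq big1// => i _; rewrite dh E dE subrr !mul0r addr0 expr0n.
rewrite smooth_H1norm_sq//.
apply: le_trans (leeD (loc _ (cf2 h sh) _ _) (loc _ (continuous_grad_sq sh) _ _)) _.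
- by move=> x; exact: sqr_ge0.
- by move=> x Ox nC; rewrite hoff// expr0n.
- by move=> x; exact: grad_sq_ge0.
- exact: goff.
rewrite -ge0_integralD//; last 4 first.
- by move=> x _; rewrite lee_fin sqr_ge0.
- by apply: mc => //; exact: cf2.
- by move=> x _; rewrite lee_fin grad_sq_ge0.
- by apply: mc => //; exact: continuous_grad_sq.
have mf2 : measurable_fun (collar Om d) (fun x => (f x ^+ 2)%:E) by apply: mc => //; exact: cf2.
have mg2 : measurable_fun (collar Om d) (fun x => (grad_sq f x)%:E).
  by apply: mc => //; exact: continuous_grad_sq.
have Kd0 : 0 <= K / d ^+ 2 by rewrite divr_ge0 ?sqr_ge0// ltW.
rewrite -!ge0_integralZl_EFin//; last 2 first.
- by move=> x _; rewrite lee_fin grad_sq_ge0.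
- by move=> x _; rewrite lee_fin sqr_ge0.
rewrite -ge0_integralD//; last 4 first.
- by move=> x _; rewrite mule_ge0 ?lee_fin ?sqr_ge0.
- exact: measurable_funeM.
- by move=> x _; rewrite mule_ge0 ?lee_fin ?grad_sq_ge0.
- exact: measurable_funeM.
apply: ge0_le_integral => //.
- by move=> x _; rewrite -EFinD lee_fin addr_ge0 ?sqr_ge0 ?grad_sq_ge0.
- by apply: emeasurable_funD; apply: mc => //; [exact: cf2|exact: continuous_grad_sq].
- by apply: emeasurable_funD; exact: measurable_funeM.
move=> x _; rewrite -!EFinM -!EFinD lee_fin.
have /andP[ex0 ex1] := e01 x.
have t1 : h x ^+ 2 <= f x ^+ 2.
  rewrite /h /psi /= (_ : _ - _ = (eta x - 1) * f x); last by ring.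
  rewrite exprMn ler_piMl ?sqr_ge0//.
  by rewrite (_ : _ ^+ 2 = (1 - eta x) ^+ 2); [rewrite exprn_ile1//; lra|ring].
have t2 i : partial i h x ^+ 2 <= 2 * partial i f x ^+ 2 + 2 * (B / d) ^+ 2 * f x ^+ 2.
  rewrite dh; set a := (eta x - 1) * _; set b := _ * f x.
  apply: (@le_trans _ _ (2 * a ^+ 2 + 2 * b ^+ 2)).
    by rewrite -subr_ge0 (_ : _ - _ = (a - b) ^+ 2) ?sqr_ge0//; ring.
  apply: lerD.
    rewrite ler_wpM2l// /a exprMn ler_piMl ?sqr_ge0//.
    by rewrite (_ : _ ^+ 2 = (1 - eta x) ^+ 2); [rewrite exprn_ile1//; lra|ring].
  rewrite -mulrA ler_wpM2l// /b exprMn ler_wpM2r ?sqr_ge0//.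
  rewrite -Cdd -[leLHS]real_normK ?num_real// lerXn2r ?nnegrE//.
  by rewrite divr_ge0// ltW.
apply: (@le_trans _ _ (f x ^+ 2 + \sum_i (2 * partial i f x ^+ 2 + 2 * (B / d) ^+ 2 * f x ^+ 2))).
  by apply: lerD => //; apply: ler_sum => i _; exact: t2.
rewrite big_split /= -mulr_sumr sumr_const card_ord -[_ *+ n]mulr_natl.
rewrite addrCA addrC lerD2r -[X in X + _]mul1r mulrA -mulrDl ler_wpM2r ?sqr_ge0//.
have -> : K / d ^+ 2 = (d ^+ 2)^-1 + n%:R * (2 * (B / d) ^+ 2).
  by rewrite /K; field; rewrite gt_eqF.
by rewrite lerD2r -[leLHS]invr1 lef_pV2 ?posrE ?exprn_gt0// exprn_ile1// ltW.
Qed.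

Let mG : measurable (boundary Om : set (surface_type R n)).
Proof. by apply: measurable_surface; exact: measurable_boundary. Qed.

Let measurable_trace f : smooth f ->
  measurable_fun (boundary Om : set (surface_type R n)) (f : surface_type R n -> R).
Proof.
move=> sf; apply: measurable_fun_surface; first exact: measurable_boundary.
by apply: measurable_fun_cont; [exact: measurable_boundary|exact: smooth_continuous].
Qed.

Lemma is_traceB u v g k : is_trace Om u g -> is_trace Om v k ->
  is_trace Om (u \- v) (g \- k).
Proof.
move=> [Hu Lg tu] [Hv Lk tv].
have LB : L2_boundary Om (g \- k) by exact: (sqiB mG Lg Lk).
split => //; first exact: H1B.
(* The boundary integrals are not square-rooted, so the two errors add with weight 2 each: 2 e / 4 +
   2 e / 4 = e. *)
move=> e e0; have e4 : 0 < e / 4 by rewrite divr_gt0.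
have [phi [sphi nphi iphi]] := tu _ e4; have [psi [spsi npsi ipsi]] := tv _ e4.
have sB : smooth (phi \- psi) by exact: smoothB.
exists (phi \- psi); split => //.
  have := H1norm_sqB oOm bOm (H1B oOm bOm Hu (smooth_H1 oOm bOm sphi))
    (H1B oOm bOm Hv (smooth_H1 oOm bOm spsi)).
  have -> : (u \- phi) \- (v \- psi) = (u \- v) \- (phi \- psi).
    by apply/funext => x /=; ring.
  have := H1norm_ge0 Om (u \- phi); have := H1norm_ge0 Om (v \- psi).
  move: (H1norm _ (u \- phi)) (H1norm _ (v \- psi)) nphi npsi => a b ae be a0 b0.
  set c := H1norm _ _ => h; rewrite ltNge; apply/negP => ec; nra.
have m1 := measurable_funB (measurable_trace sphi) Lg.1.
have m2 := measurable_funB (measurable_trace spsi) Lk.1.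
have := @integral_sqB_le _ _ _ surf _ mG _ _ m1 m2.
rewrite (_ : (fun x => (_ ^+ 2)%:E) =
  (fun x : surface_type R n => (((phi \- psi) x - (g \- k) x) ^+ 2)%:E)); last first.
  by apply/funext => x /=; congr ((_ ^+ 2)%:E); ring.
move/le_lt_trans; apply.
have -> : e = 2 * (e / 4) + 2 * (e / 4) by field.
by rewrite (EFinD (2 * (e / 4))) (EFinM 2 (e / 4)); apply: lteD; rewrite lte_pmul2l.
Qed.

(** The order of choices matters: the tolerance eta, then the width d from the tail of the fixed
    gradient of v, then eps in terms of d, and only then the smooth approximation f, whose boundary
    values are small because g vanishes. *)
Theorem trace0_H10 v g : (2 <= n)%N -> lipschitz_boundary Om -> is_trace Om v g ->
  {ae surf, forall x, boundary Om x -> g x = 0} -> H10 Om v.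
Proof.
move=> n2 lOm [Hv Lg tv] g0; split => // e e0.
have [A [M [d0 [A0 M0 d00 tr]]]] := collar_trace oOm n2 bOm lOm.
have [K K0 cut] := cutoff_error.
(* One collar of width M' d contains both the collar of width d of the cutoff and that of width M d
   of the trace estimate. *)
pose M' := Num.max M 1.
have M'1 : 1 <= M' by rewrite le_max lexx orbT.
have M'0 : 0 < M' by exact: lt_le_trans M'1.
(* With gradient mass at most 4 eta on the collar, the cutoff costs eta + 4 Q eta: K A from the
   trace estimate, 2 from [cutoff_error]. Adding the distance from v to f, the total 2 eta + 2 (eta
   + 4 Q eta) = 4 eta (1 + 2 Q) is at most e^2 / 2, which explains the 8 in [eta]. *)
pose Q := K * A + 2; have Q0 : 0 < Q by rewrite addr_gt0 ?mulr_gt0.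
pose eta := Num.min 1 (e ^+ 2 / (8 * (1 + 2 * Q))).
have Q8 : 0 < 8 * (1 + 2 * Q) by rewrite mulr_gt0// addr_gt0// mulr_gt0.
have eta0 : 0 < eta by rewrite lt_min ltr01 divr_gt0// exprn_gt0.
have Lw i := wpartial_L2 i Hv.
pose gw x := \sum_i wp i v x ^+ 2.
have mgw : measurable_fun Om (fun x => (gw x)%:E).
  apply/measurable_EFinP; apply: measurable_sum => i.
  by have [mF _] := Lw i; exact: measurable_funX.
have gw0 x : 0 <= gw x by apply: sumr_ge0 => i _; exact: sqr_ge0.
have Igw : leb.-integrable Om (EFin \o gw).
  apply/integrableP; split => //.
  under eq_integral do rewrite /= ger0_norm//.
  by rewrite /gw -(sum_ip_integral Lw) ltry.
have [d1 d10 tail] := collar_tail oOm Igw gw0 eta0.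
pose d := Num.min (Num.min d0 1) (d1 / M').
have dpos : 0 < d by rewrite !lt_min d00 ltr01 divr_gt0.
have dd0 : d <= d0 by rewrite !ge_min lexx.
have dd1 : d <= 1 by rewrite !ge_min lexx orbT.
have Md1 : M' * d <= d1 by rewrite mulrC -ler_pdivlMr// ge_min lexx orbT.
(* The boundary integral of f^2 is multiplied by K / d^2 and by A d, that is by K A / d, and has to
   contribute at most eta. *)
pose eps := Num.min eta (eta * d / (K * A)).
have eps0 : 0 < eps by rewrite lt_min eta0 divr_gt0 ?mulr_gt0.
have [f [sf nf intf]] := tv _ eps0.
have Hf := smooth_H1 oOm bOm sf.
set N := H1norm Om (v \- f) in nf.
have N0 : 0 <= N by exact: H1norm_ge0.
have N2 : N ^+ 2 <= eta.
  have h1 : eps <= 1 by rewrite !ge_min lexx.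
  have h2 : eps <= eta by rewrite ge_min lexx.
  by rewrite expr2; nra.
have intf' : (\int[surf]_(x in boundary Om) (f (x : Rn) ^+ 2)%:E < (eta * d / (K * A))%:E)%E.
  apply: (@lt_le_trans _ _ eps%:E); last by rewrite lee_fin ge_min lexx orbT.
  apply: le_lt_trans intf; rewrite le_eqVlt; apply/orP; left; apply/eqP.
  exact: (@ae_integral_sqB _ _ _ surf _ mG _ _ (measurable_trace sf) Lg.1 g0).
have mcol r : measurable (collar Om r) by exact: collar_measurable.
have colO r : collar Om r `<=` Om by move=> x [].
pose G := (\int[leb]_(x in collar Om (M' * d)) (grad_sq f x)%:E)%E.
have Gle r : r <= M' -> (\int[leb]_(x in collar Om (r * d)) (grad_sq f x)%:E <= G)%E.
  move=> rM; apply: ge0_subset_integral => //.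
  - apply/measurable_EFinP; apply: measurable_fun_cont => //.
    exact: continuous_grad_sq.
  - by move=> x _; rewrite lee_fin grad_sq_ge0.
  - by apply: le_collar; rewrite ler_wpM2r// ltW.
have G0 : (0 <= G)%E by apply: integral_ge0 => x _; rewrite lee_fin grad_sq_ge0.
have Gsmall : (G <= (4 * eta)%:E)%E.
  apply: (le_trans (grad_sq_le_weak Hv sf (mcol _) (@colO _))).
  have -> : 4 * eta = 2 * eta + 2 * eta by ring.
  rewrite (EFinD (2 * eta)); apply: leeD; last by rewrite lee_fin ler_wpM2l.
  by rewrite (EFinM 2 eta); apply: lee_wpmul2l => //; apply: ltW; exact: tail.
have [psi tpsi est] := cut d f dpos dd1 sf.
exists psi => //.
have spsi : smooth psi by case: tpsi.
have bound : H1norm Om (psi \- f) ^+ 2 <= eta + Q * (4 * eta).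
  rewrite -lee_fin; apply: le_trans est _.
  have Kd : 0 <= K / d ^+ 2 by rewrite divr_ge0 ?sqr_ge0// ltW.
  have MM' : M <= M' by rewrite le_max lexx.
  have GM := le_trans (Gle M MM') Gsmall; have := le_trans (Gle 1 M'1) Gsmall.
  rewrite mul1r => G1.
  have -> : (eta + Q * (4 * eta))%:E = ((K / d ^+ 2)%:E *
      ((A * d)%:E * (eta * d / (K * A))%:E + (A * d ^+ 2)%:E * (4 * eta)%:E) +
      2%:E * (4 * eta)%:E)%E.
    transitivity ((K / d ^+ 2) * ((A * d) * (eta * d / (K * A)) + (A * d ^+ 2) * (4 * eta)) +
      2 * (4 * eta))%:E; last by [].
    by congr EFin; rewrite /Q; field; rewrite !gt_eqF.
  apply: leeD; last by apply: lee_wpmul2l.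
  apply: lee_wpmul2l; first by rewrite lee_fin.
  apply: (le_trans (tr d f dpos dd0 sf)); apply: leeD.
    by apply: lee_wpmul2l; [rewrite lee_fin mulr_ge0// ltW|exact: ltW].
  by apply: lee_wpmul2l => //; rewrite lee_fin mulr_ge0// ?sqr_ge0// ltW.
have := H1norm_sqB oOm bOm (H1B oOm bOm Hv Hf) (H1B oOm bOm (smooth_H1 oOm bOm spsi) Hf).
have -> : (v \- f) \- (psi \- f) = v \- psi by apply/funext => x /=; ring.
have e2 : eta * (8 * (1 + 2 * Q)) <= e ^+ 2.
  by rewrite -ler_pdivlMr// ge_min lexx orbT.
rewrite -/N; move: (H1norm_ge0 Om (v \- psi)) bound e2.
move: (H1norm _ (psi \- f)) (H1norm _ (v \- psi)) => a b b0 ha e2 hb.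
rewrite ltNge; apply/negP => eb.
have : e ^+ 2 <= b ^+ 2 by rewrite lerXn2r ?nnegrE// ltW.
have : 0 < eta * Q by rewrite mulr_gt0.
have : eta * (8 * (1 + 2 * Q)) = 8 * eta + 16 * (eta * Q) by ring.
have : Q * (4 * eta) = 4 * (eta * Q) by ring.
move: (eta * Q) (Q * (4 * eta)) (eta * (8 * _)) (a ^+ 2) (b ^+ 2) (e ^+ 2) (N ^+ 2) N2 ha e2 hb.
by move=> p q r s t u w; lra.
Qed.

End trace_kernel.

Opaque ip dir H1norm wpartial.

(** * The pressure equations *)

Lemma cancel_common {R : zmodType} (a a1 a2 b b1 b2 c : R) : a = a1 - a2 -> b = b1 - b2 ->
  a1 + b1 = c -> a2 + b2 = c -> a = - b.
Proof.
move=> -> -> <- /eqP; rewrite -subr_eq0 => /eqP h; apply/eqP; rewrite -addr_eq0.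
by rewrite addrACA -opprD -oppr_eq0 opprB h.
Qed.

Lemma cancel_scaled {R : comPzRingType} (e d a b c' s v t : R) : a = b -> e * c' + v = e * b ->
  d = a - c' -> t = 0 -> s = v - t -> e * d = s.
Proof. by move=> -> h -> -> ->; rewrite mulrBr -h subr0 addrAC subrr add0r. Qed.

Lemma energy_balance {R : comPzRingType} (e d x y s s1 s2 w : R) : y = 0 -> d = x - y ->
  s = s1 - s2 -> w = - s1 -> e * x = s -> w + e * d = - s2.
Proof. by move=> -> -> h -> E; rewrite subr0 E h addKr. Qed.

Lemma addr_eq0_ge0 {R : realFieldType} (e a b : R) : 0 < e -> 0 <= a -> 0 <= b ->
  a + e * b = 0 -> b = 0.
Proof.
move=> e0 a0 b0 /eqP; rewrite paddr_eq0 ?mulr_ge0 ?(ltW e0)// mulf_eq0 => /andP[_].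
by rewrite (gt_eqF e0) => /eqP.
Qed.

Section pressure_equations.
Context {R : realType} {n : nat}.
Local Notation Rn := 'rV[R]_n.
Local Notation leb := (lebesgue_rV R n).
Variable Om : set Rn.
Hypotheses (oOm : open Om) (bOm : bounded_set Om).
Local Notation ipO := (ip (mu := leb) (D := Om)).
Local Notation dirO := (dir Om).
Local Notation wp := (wpartial Om).
Implicit Types (u v w f : Rn -> R).

Let mOm : measurable Om. Proof. exact: open_measurable_rV. Qed.

Lemma H10_H1 v : H10 Om v -> H1 Om v. Proof. by case. Qed.

Lemma test_L2 phi : test_function Om phi -> L2 Om phi.
Proof. by case=> sp _; exact: smooth_L2. Qed.

Lemma ip_wpartial_test i phi v : test_function Om phi -> L2 Om v ->
  ipO v (wp i phi) = ipO v (partial i phi).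
Proof.
move=> [sp _] Lv; rewrite ipC [RHS]ipC; apply: ip_ae => //.
- by apply: wpartial_L2; exact: smooth_H1.
- by apply: smooth_L2 => //; exact: smooth_partial.
- exact: wpartial_smooth.
Qed.

Lemma ibp_test i v phi : H1 Om v -> test_function Om phi ->
  ipO (wp i v) phi = - ipO v (partial i phi).
Proof.
move=> Hv tp; rewrite -ip_wpartial_test//; last exact: H1_L2.
by rewrite ibp_H10 ?opprK//; exact: test_H10.
Qed.

Lemma ip_divergence (u : 'I_n -> Rn -> R) v : (forall i, H1 Om (u i)) -> L2 Om v ->
  ipO v (divergence Om u) = \sum_i ipO v (wp i (u i)).
Proof.
by move=> Hu Lv; rewrite -ip_sumr// => i; exact: wpartial_L2.
Qed.

Lemma divergence0 (u : 'I_n -> Rn -> R) v : (forall i, H1 Om (u i)) -> L2 Om v ->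
  {ae leb, forall x, Om x -> divergence Om u x = 0} -> \sum_i ipO (wp i (u i)) v = 0.
Proof.
move=> Hu Lv du; under eq_bigr do rewrite ipC.
rewrite -ip_divergence// ipC.
have Ldu : L2 Om (divergence Om u).
  by apply: sqi_sum => // i; exact: wpartial_L2.
have L0 : L2 Om (fun=> 0) by exact: sqi0.
rewrite (ip_ae mOm Ldu L0 Lv du) ipE.
under eq_Rintegral do rewrite mul0r.
by rewrite /Rintegral integral0.
Qed.

(* Integrating by parts twice and swapping the order of the derivatives moves
   them so as to produce the divergence of u. *)
Lemma dirichlet_gradient (u : 'I_n -> Rn -> R) psi : (forall i, H1 Om (u i)) ->
  {ae leb, forall x, Om x -> divergence Om u x = 0} -> test_function Om psi ->
  \sum_i dirO (u i) (partial i psi) = 0.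
Proof.
move=> Hu du tp.
have tpp i j : test_function Om (partial i (partial j psi)) by do 2 apply: test_partial.
have E i j : ipO (wp j (u i)) (wp j (partial i psi)) =
    ipO (wp i (u i)) (partial j (partial j psi)).
  have [sp _] := tp; have spj := smooth_partial j sp.
  apply: etrans (ip_wpartial_test j (test_partial i tp) (wpartial_L2 j (Hu i))) _.
  apply: etrans (ibp_test j (Hu i) (tpp j i)) _.
  apply: esym; apply: etrans (ibp_test i (Hu i) (tpp j j)) _;
  suff -> : partial i (partial j (partial j psi)) = partial j (partial j (partial i psi)) by [].
  apply: esym.
  have -> : partial j (partial i psi) = partial i (partial j psi).
    by apply/funext => x; exact: partialC.
  by apply/funext => x; exact: partialC.
under eq_bigr do rewrite dirE.
rewrite exchange_big /=; apply: big1 => j _; under eq_bigr do rewrite E.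
by apply: divergence0 => //; exact: test_L2.
Qed.

Variables (F : 'I_n -> Rn -> R).
Hypothesis LF : forall i, L2 Om (F i).

Let intF (phi : 'I_n -> Rn -> R) : (forall i, L2 Om (phi i)) ->
  \int[leb]_(x in Om) (\sum_i F i x * phi i x) = \sum_i ipO (F i) (phi i).
Proof. by move=> Lphi; exact: Rintegral_sum_mul. Qed.

Section stokes.
Variables (ub u : 'I_n -> Rn -> R) (p : Rn -> R).
Hypothesis (hS : stokes_solution Om F ub u p) (Hp : H1 Om p).

(** The regularity of the Stokes pressure enters here: since p is in H1, the pressure term
    integrates by parts and the equation takes the form of the other two momentum equations. *)
Lemma stokes_momentum (phi : 'I_n -> Rn -> R) : (forall i, H10 Om (phi i)) ->
  \sum_i dirO (u i) (phi i) + \sum_i ipO (wp i p) (phi i) = \sum_i ipO (F i) (phi i).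
Proof.
move=> Hphi; have [[Hu _] eqn _ _] := hS.
have H1phi i := H10_H1 (Hphi i).
have := eqn _ Hphi; rewrite intF; last by move=> i; exact: H1_L2.
rewrite -(ipE p) ip_divergence//; last exact: H1_L2.
move=> <-; congr (_ + _); first by apply: eq_bigr => i _; rewrite dirichletE.
rewrite -sumrN; apply: eq_bigr => i _; rewrite ibp_H10// opprK//.
Qed.

(** For a test function psi the field grad psi is admissible in the momentum equation, and its
    Dirichlet term vanishes since u is divergence free. Both sides are continuous in the H1 norm, so
    density gives all of H10. *)
Lemma stokes_pressure psi : H10 Om psi ->
  dirO p psi = \sum_i ipO (F i) (wp i psi).
Proof.
move=> Hpsi; apply/eqP; rewrite -subr_eq0; apply/eqP; have [[Hu _] _ du _] := hS.
have Lwp i v : H1 Om v -> L2 Om (wp i v) by exact: wpartial_L2.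
apply: (@H10_ind _ _ Om oOm bOm (fun psi => dirO p psi - \sum_i ipO (F i) (wp i psi))
  (\sum_i (Num.sqrt (ipO (wp i p) (wp i p)) + Num.sqrt (ipO (F i) (F i))))) => //.
- move=> a b Ha Hb; have E1 := dirBr oOm bOm Ha Hb Hp.
  have E2 : \sum_i ipO (F i) (wp i (a \- b)) =
      \sum_i ipO (F i) (wp i a) - \sum_i ipO (F i) (wp i b).
    rewrite -sumrB; apply: eq_bigr => i _; exact: (ip_wpartialBr oOm bOm i Ha Hb (LF i)).
  have sub_sub (x y x1 x2 y1 y2 : R) : x = x1 - x2 -> y = y1 - y2 ->
      x - y = x1 - y1 - (x2 - y2) by move=> -> ->; ring.
  exact: (sub_sub _ _ _ _ _ _ E1 E2).
- move=> a Ha; rewrite dirE -sumrB mulr_suml; apply: le_trans (ler_norm_sum _ _ _) _.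
  apply: ler_sum => i _; rewrite mulrDl; apply: le_trans (ler_normB _ _) _.
  have La := Lwp i _ Ha; have h := sqrt_ip_wpartial_le_H1norm Om i a.
  apply: lerD.
    apply: (le_trans (ip_CS_sqrt mOm (Lwp i _ Hp) La)).
    by apply: ler_wpM2l h; exact: sqrtr_ge0.
  apply: (le_trans (ip_CS_sqrt mOm (LF i) La)).
  by apply: ler_wpM2l h; exact: sqrtr_ge0.
- move=> phi tp; have tpp i := test_partial i tp.
  have := stokes_momentum (fun i => test_H10 oOm bOm (tpp i)).
  rewrite dirichlet_gradient// add0r dirE => E.
  apply/eqP; rewrite subr_eq0; apply/eqP.
  transitivity (\sum_i ipO (wp i p) (partial i phi)).
    by apply: eq_bigr => i _; rewrite ip_wpartial_test//; exact: Lwp.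
  by rewrite E; apply: eq_bigr => i _; rewrite ip_wpartial_test.
Qed.

End stokes.

Section energy.
Variables (q v : Rn -> R) (w : 'I_n -> Rn -> R) (C : R).
Hypotheses (Hq : H1 Om q) (Hw : forall i, H10 Om (w i)).
Hypothesis qharm : forall psi, H10 Om psi -> dirO q psi = 0.
Hypotheses (C0 : 0 < C) (poinc : forall psi, H10 Om psi -> ipO psi psi <= C * dirO psi psi).

Lemma young (t : R) f g : 0 < t -> L2 Om f -> L2 Om g ->
  - (2 * ipO f g) <= t * ipO f f + t^-1 * ipO g g.
Proof.
move=> t0 Lf Lg; have := @ip_CS _ _ _ _ _ mOm _ _ Lf Lg.
have := ip_ge0 (mu := leb) (D := Om) f; have := ip_ge0 (mu := leb) (D := Om) g.
have := ip_ge0 (mu := leb) (D := Om) (fun x => f x + t^-1 * g x).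
have LL := sqi_lin mOm t^-1 Lf Lg.
rewrite (ip_lin mOm t^-1 Lf Lg LL) (ipC f) (ipC g (fun _ => _)).
rewrite (ip_lin mOm t^-1 Lf Lg Lf) (ip_lin mOm t^-1 Lf Lg Lg) (ipC g f).
move: (ipO f f) (ipO f g) (ipO g g) => a b c h _ _ _.
have := mulr_ge0 (ltW t0) h.
rewrite (_ : t * (a + _ + _) = t * a + 2 * b + t^-1 * c); last by field; rewrite lt0r_neq0.
by lra.
Qed.

(** q is orthogonal to q - v, so |grad v|^2 = |grad q|^2 + |grad (q - v)|^2. *)
Lemma dirichlet_principle : H1 Om v -> H10 Om (q \- v) -> dirO q q <= dirO v v.
Proof.
move=> Hv Hqv; have := qharm Hqv; rewrite (dirBr oOm bOm Hq Hv Hq) => E.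
have := dir_ge0 Om (q \- v); rewrite (dirBl oOm bOm Hq Hv (H10_H1 Hqv)).
rewrite (qharm Hqv) (dirBr oOm bOm Hq Hv Hv) (dirC _ v q).
by move: (dirO q q) (dirO q v) (dirO v v) E => a b c; lra.
Qed.

(** Young's inequality with weight C equal to the Poincare constant: the resulting |w|^2 / C is at
    most |grad w|^2 and is absorbed, leaving |grad w|^2 <= C |grad q|^2. Poincare once more adds the
    L2 part, with factor C + 1. *)
Lemma energy_estimate : \sum_i dirO (w i) (w i) <= - \sum_i ipO (wp i q) (w i) ->
  \sum_i H1norm Om (w i) ^+ 2 <= (C + 1) * C * dirO q q.
Proof.
move=> W.
have Lw i := H1_L2 (H10_H1 (Hw i)).
have Z : \sum_i ipO (w i) (w i) <= C * \sum_i dirO (w i) (w i).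
  by rewrite mulr_sumr; apply: ler_sum => i _; exact: poinc.
have Y : - (2 * \sum_i ipO (wp i q) (w i)) <= C * dirO q q + C^-1 * \sum_i ipO (w i) (w i).
  rewrite dirE !mulr_sumr -sumrN -big_split /=; apply: ler_sum => i _.
  by apply: young => //; exact: wpartial_L2.
under eq_bigr do rewrite H1norm_sq.
rewrite big_split /=.
move: (\sum_i ipO (w i) (w i)) (\sum_i dirO (w i) (w i)) (\sum_i ipO _ _) (dirO q q) W Z Y.
move=> z d s e W Z Y.
have CZ : C^-1 * z <= d by rewrite mulrC ler_pdivrMr// mulrC.
have : d <= C * e by lra.
move=> de; have C1 : 0 <= C + 1 by rewrite addr_ge0// ltW.
have := ler_wpM2l C1 de; rewrite mulrA => h; apply: le_trans h.
by rewrite mulrDl mul1r lerD2r.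
Qed.

End energy.

Definition momentum (u : 'I_n -> Rn -> R) (p : Rn -> R) : Prop :=
  forall phi : 'I_n -> Rn -> R, (forall i, H10 Om (phi i)) ->
  \sum_i dirO (u i) (phi i) + \sum_i ipO (wp i p) (phi i) = \sum_i ipO (F i) (phi i).

Lemma weak_momentum (u : 'I_n -> Rn -> R) p : (forall i, H1 Om (u i)) -> H1 Om p ->
  (forall phi : 'I_n -> Rn -> R, (forall i, H10 Om (phi i)) ->
    \sum_i dirichlet Om (u i) (phi i) + \int[leb]_(x in Om) (\sum_i wp i p x * phi i x)
    = \int[leb]_(x in Om) (\sum_i F i x * phi i x)) -> momentum u p.
Proof.
move=> Hu Hp H phi Hphi; have := H phi Hphi.
have Lphi i : L2 Om (phi i) := H1_L2 (H10_H1 (Hphi i)).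
rewrite (intF Lphi) (Rintegral_sum_mul mOm (fun i => wpartial_L2 i Hp) Lphi) => <-.
by congr (_ + _); apply: eq_bigr => i _; rewrite (dirichletE oOm (Hu i) (H10_H1 (Hphi i))).
Qed.

Lemma momentumB (u u' : 'I_n -> Rn -> R) p p' : (forall i, H1 Om (u i)) ->
  (forall i, H1 Om (u' i)) -> H1 Om p -> H1 Om p' -> momentum u p -> momentum u' p' ->
  forall phi : 'I_n -> Rn -> R, (forall i, H10 Om (phi i)) ->
  \sum_i dirO (u i \- u' i) (phi i) = - \sum_i ipO (wp i (p \- p')) (phi i).
Proof.
move=> Hu Hu' Hp Hp' h h' phi Hphi; have := h phi Hphi; have := h' phi Hphi.
have Hphi1 i := H10_H1 (Hphi i).
have E1 : \sum_i dirO (u i \- u' i) (phi i) =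
    \sum_i dirO (u i) (phi i) - \sum_i dirO (u' i) (phi i).
  rewrite -sumrB; apply: eq_bigr => i _; exact: (dirBl oOm bOm (Hu i) (Hu' i) (Hphi1 i)).
have E2 : \sum_i ipO (wp i (p \- p')) (phi i) =
    \sum_i ipO (wp i p) (phi i) - \sum_i ipO (wp i p') (phi i).
  rewrite -sumrB; apply: eq_bigr => i _.
  exact: (ip_wpartialBl oOm bOm i Hp Hp' (H1_L2 (Hphi1 i))).
move=> h2 h1; exact: (cancel_common E1 E2 h1 h2).
Qed.

(** * Differences of solutions with equal boundary values *)

Section zero_trace.
Hypotheses (n2 : (2 <= n)%N) (lOm : lipschitz_boundary Om).

Lemma same_trace_H10 u v g : is_trace Om u g -> is_trace Om v g -> H10 Om (u \- v).
Proof.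
move=> tu tv; apply: (trace0_H10 oOm bOm n2 lOm (is_traceB oOm bOm tu tv)).
by apply: aeW => x _; rewrite /= subrr.
Qed.

(** [H12norm] is an infimum over liftings v of g, and the Dirichlet principle compares q with each
    of them; C (C + 1) is rounded up to (C + 1)^2 under the root. The energy hypothesis is an
    inequality in order to serve both problems. *)
Lemma velocity_bound (C : R) (q g : Rn -> R) (w : 'I_n -> Rn -> R) : 0 < C ->
  (forall psi, H10 Om psi -> ipO psi psi <= C * dirO psi psi) ->
  (forall psi, H10 Om psi -> dirO q psi = 0) -> is_trace Om q g -> (forall i, H10 Om (w i)) ->
  \sum_i dirO (w i) (w i) <= - \sum_i ipO (wp i q) (w i) ->
  H1norm_vec Om w <= (C + 1) * H12norm Om g.
Proof.
move=> C0 poinc qharm tq Hw W; have Hq : H1 Om q by case: tq.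
have C1 : 0 < C + 1 by rewrite addr_gt0.
rewrite -ler_pdivrMl//; apply: lb_le_inf; first by exists (H1norm Om q), q.
move=> _ [v tv <-]; rewrite ler_pdivrMl//.
have Hv : H1 Om v by case: tv.
have E := energy_estimate Hq Hw C0 poinc W.
have D := dirichlet_principle Hq qharm Hv (same_trace_H10 tq tv).
have D' := le_trans D (dir_le_H1norm Om v).
have N0 := H1norm_ge0 Om v.
rewrite -(ger0_norm (mulr_ge0 (ltW C1) N0)) -sqrtr_sqr /H1norm_vec.
rewrite ler_sqrt ?sqr_ge0// exprMn; apply: le_trans E _.
move: (dirO q q) (H1norm Om v) D' N0 => e N eN N0.
have N2 : 0 <= N ^+ 2 by exact: sqr_ge0.
rewrite (_ : (C + 1) ^+ 2 * N ^+ 2 = (C + 1) * (C + 1) * N ^+ 2); last by ring.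
rewrite -!mulrA ler_wpM2l ?(ltW C1)//; apply: (@le_trans _ _ (C * N ^+ 2)).
  by rewrite ler_wpM2l// ltW.
by rewrite mulrDl mul1r lerDl.
Qed.

(** The source terms cancel, leaving the integral of (div v) z. As div u = 0, this is minus that of
    div (u - v) z, and integration by parts against z in H10 moves the derivative to z. *)
Lemma eps_pressure (eps : R) (u v : 'I_n -> Rn -> R) (p p' z : Rn -> R) : 
  (forall i, H1 Om (u i)) -> (forall i, H1 Om (v i)) -> H1 Om p -> H1 Om p' ->
  {ae leb, forall x, Om x -> divergence Om u x = 0} -> H10 Om z ->
  dirO p z = \sum_i ipO (F i) (wp i z) ->
  eps * dirichlet Om p' z + \int[leb]_(x in Om) (divergence Om v x * z x)
    = eps * \int[leb]_(x in Om) (\sum_i F i x * wp i z x) ->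
  eps * dirO (p \- p') z = \sum_i ipO (wp i z) (u i \- v i).
Proof.
move=> Hu Hv Hp Hp' du Hz; have Hz1 := H10_H1 Hz; have Lz := H1_L2 Hz1.
rewrite (intF (fun i => wpartial_L2 i Hz1)) (dirichletE oOm Hp' Hz1).
rewrite -(ipE (divergence Om v) z) => E0 E1.
have E2 : ipO (divergence Om v) z = \sum_i ipO (wp i (v i)) z.
  apply: etrans (ipC _ _) _; apply: etrans (ip_divergence Hv Lz) _.
  by apply: eq_bigr => i _; exact: ipC.
have E3 := divergence0 Hu Lz du.
have E4 := dirBl oOm bOm Hp Hp' Hz1.
have E5 : \sum_i ipO (wp i z) (u i \- v i) =
    \sum_i ipO (wp i (v i)) z - \sum_i ipO (wp i (u i)) z.
  rewrite -sumrB; apply: eq_bigr => i _.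
  have Huv := H1B oOm bOm (Hu i) (Hv i).
  apply: etrans (ipC _ _) _; apply: etrans (ibp_H10 oOm bOm i Huv Hz) _.
  by rewrite (ip_wpartialBl oOm bOm i (Hu i) (Hv i) Lz) opprB.
exact: (cancel_scaled E0 E1 E4 E3 (etrans E5 (congr1 (fun t => t - _) (esym E2)))).
Qed.

Lemma harmonic_difference p p' : H1 Om p -> H1 Om p' ->
  (forall psi, H10 Om psi -> dirO p psi = \sum_i ipO (F i) (wp i psi)) ->
  (forall psi, H10 Om psi -> dirichlet Om p' psi
    = \int[leb]_(x in Om) (\sum_i F i x * wp i psi x)) ->
  forall psi, H10 Om psi -> dirO (p \- p') psi = 0.
Proof.
move=> Hp Hp' h h' psi Hpsi; have Hpsi1 := H10_H1 Hpsi.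
apply: etrans (dirBl oOm bOm Hp Hp' Hpsi1) _.
have := h' psi Hpsi; rewrite (dirichletE oOm Hp' Hpsi1) (intF (fun i => wpartial_L2 i Hpsi1)).
by move=> E; rewrite (h psi Hpsi) E subrr.
Qed.

(** Put z = r - q. Orthogonality of q and z turns eps (grad r, grad z) into eps |grad z|^2, which
    equals the z part of the coupling in the momentum equation; only the q part stays on the
    right. *)
Lemma eps_energy (eps : R) (w : 'I_n -> Rn -> R) (q r : Rn -> R) : (forall i, H1 Om (w i)) ->
  H1 Om q -> H1 Om r -> H10 Om (r \- q) -> dirO q (r \- q) = 0 ->
  \sum_i dirO (w i) (w i) = - \sum_i ipO (wp i r) (w i) ->
  eps * dirO r (r \- q) = \sum_i ipO (wp i (r \- q)) (w i) ->
  \sum_i dirO (w i) (w i) + eps * dirO (r \- q) (r \- q) = - \sum_i ipO (wp i q) (w i).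
Proof.
move=> Hw Hq Hr Hz h0 h1 h2; have Hz1 := H10_H1 Hz.
have E1 := dirBl oOm bOm Hr Hq Hz1.
have E2 : \sum_i ipO (wp i (r \- q)) (w i) =
    \sum_i ipO (wp i r) (w i) - \sum_i ipO (wp i q) (w i).
  by rewrite -sumrB; apply: eq_bigr => i _; exact: (ip_wpartialBl oOm bOm i Hr Hq (H1_L2 (Hw i))).
exact: (energy_balance h0 E1 E2 h1 h2).
Qed.

Lemma dir0_ae (C : R) psi : (forall psi, H10 Om psi -> ipO psi psi <= C * dirO psi psi) ->
  H10 Om psi -> dirO psi psi = 0 -> {ae leb, forall x, Om x -> psi x = 0}.
Proof.
move=> poinc Hpsi d0; apply: (ip_eq0 mOm (H1_L2 (H10_H1 Hpsi))).
have := poinc psi Hpsi; rewrite d0 mulr0 => h.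
by apply/eqP; rewrite eq_le h ip_ge0.
Qed.

Lemma ip_wpartial0 q i f : H1 Om q -> L2 Om f -> dirO q q = 0 -> ipO (wp i q) f = 0.
Proof.
move=> Hq Lf d0; have Lw := wpartial_L2 i Hq; have := ip_CS mOm Lw Lf.
have h : ipO (wp i q) (wp i q) = 0.
  have := ip_wpartial_le_dir Om i q; rewrite d0 => h.
  by apply/eqP; rewrite eq_le h ip_ge0.
rewrite h mul0r => h2; apply/eqP; rewrite -sqrf_eq0 eq_le h2 sqr_ge0//.
Qed.

End zero_trace.

End pressure_equations.

(* gS stands for the trace of pS. *)
Theorem proposition2p7 (R : realType) (n : nat) (hn : (2 <= n)%N)
  (Om : set 'rV[R]_n) (hOm : lipschitz_domain Om)
  (F : 'I_n -> 'rV[R]_n -> R) (hF : forall i, L2 Om (F i))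
  (pb : 'rV[R]_n -> R) (hpb : H12 Om pb)
  (ub : 'I_n -> 'rV[R]_n -> R) (hub : forall i, H12 Om (ub i))
  (hub0 : \int[surface_measure R n]_(x in boundary Om)
            (\sum_i ub i x * outward_normal Om x ord0 i) = 0)
  (uS : 'I_n -> 'rV[R]_n -> R) (pS : 'rV[R]_n -> R)
  (hS : stokes_solution Om F ub uS pS)
  (uPP : 'I_n -> 'rV[R]_n -> R) (pPP : 'rV[R]_n -> R)
  (hPP : pressure_poisson_solution Om F ub pb uPP pPP)
  (ueps : R -> 'I_n -> 'rV[R]_n -> R) (peps : R -> 'rV[R]_n -> R)
  (hES : forall eps : R, 0 < eps ->
           eps_stokes_solution Om eps F ub pb (ueps eps) (peps eps))
  (hpS : H1 Om pS)
  (gS : 'rV[R]_n -> R) (hgS : is_trace Om pS gS) :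
  (exists2 c : R, 0 < c &
     H1norm_vec Om (fun i => uS i \- uPP i) <= c * H12norm Om (gS \- pb) /\
     forall eps : R, 0 < eps ->
       H1norm_vec Om (fun i => uS i \- ueps eps i)
       <= c * H12norm Om (gS \- pb)) /\
  ({ae surface_measure R n, forall x, boundary Om x -> gS x = pb x} ->
     {ae lebesgue_rV R n, forall x, Om x -> pPP x = pS x} /\
     forall eps : R, 0 < eps ->
       {ae lebesgue_rV R n, forall x, Om x -> peps eps x = pS x}).
Proof.
have [oOm _ _ bOm lOm] := hOm.
(* Poincare's inequality along the first coordinate, which exists since n >= 2. *)
have [C C0 poinc] := poincare oOm bOm (Ordinal (ltnW hn)).
have C1 : 0 < C + 1 by rewrite addr_gt0.
have [[HuS _] _ duS tuS] := hS.
have [[HuP HpP] eqnP prP tuP tpP] := hPP.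
have mS := stokes_momentum oOm bOm hF hS hpS.
have prS := stokes_pressure oOm bOm hF hS hpS.
have mP := weak_momentum oOm hF HuP HpP eqnP.
pose q := pS \- pPP.
have tq : is_trace Om q (gS \- pb) := is_traceB oOm bOm hgS tpP.
have Hq : H1 Om q by case: tq.
have qharm : forall psi, H10 Om psi -> dir Om q psi = 0.
  exact: (harmonic_difference oOm bOm hF hpS HpP prS prP).
have same := same_trace_H10 oOm bOm hn lOm.
have wP i : H10 Om (uS i \- uPP i) := same _ _ _ (tuS i) (tuP i).
have EP := momentumB oOm bOm HuS HuP hpS HpP mS mP wP.
have ES eps : 0 < eps -> let w := fun i => uS i \- ueps eps i in
    let z := (pS \- peps eps) \- q in
    [/\ forall i, H10 Om (w i), H10 Om z &
    \sum_i dir Om (w i) (w i) + eps * dir Om z z =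
      - \sum_i ip (mu := lebesgue_rV R n) (D := Om) (wpartial Om i q) (w i)].
  move=> eps0 w z; have [[Hue Hpe] eqne pre tue tpe] := hES eps eps0.
  have Hw i : H10 Om (w i) := same _ _ _ (tuS i) (tue i).
  have Hr : H1 Om (pS \- peps eps) := H1B oOm bOm hpS Hpe.
  (* pPP and peps share the trace pb, so pS - peps and q both have trace gS - pb. *)
  have Hz : H10 Om z := same _ _ _ (is_traceB oOm bOm hgS tpe) tq.
  have me := weak_momentum oOm hF Hue Hpe eqne.
  split => //; apply: eps_energy => //.
  - exact: (fun i => H10_H1 (Hw i)).
  - exact: qharm.
  - exact: (momentumB oOm bOm HuS Hue hpS Hpe mS me Hw).
  - exact: (eps_pressure oOm bOm hF HuS Hue hpS Hpe duS Hz (prS _ Hz) (pre _ Hz)).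
split.
  exists (C + 1) => //; split => [|eps eps0].
    by apply: (velocity_bound oOm bOm hn lOm C0 poinc qharm tq wP); rewrite EP.
  have [Hw Hz E] := ES eps eps0.
  apply: (velocity_bound oOm bOm hn lOm C0 poinc qharm tq Hw).
  (* Dropping the nonnegative eps |grad z|^2 is what frees the constant from eps. *)
  by rewrite -E lerDl mulr_ge0 ?(ltW eps0)// dir_ge0.
(* With zero trace, q is an admissible test function in its own equation, so its gradient vanishes
   and Poincare's inequality gives q = 0. *)
move=> gpb; have q0 : H10 Om q.
  apply: (trace0_H10 oOm bOm hn lOm tq).
  apply: (@filterS _ _ (ae_filter_ringOfSetsType (surface_measure R n)) _ _ _ gpb) => x h Gx.
  by rewrite /= h// subrr.
have dq := qharm q q0.
have qae := dir0_ae oOm poinc q0 dq.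
split => [|eps eps0].
  by apply: filterS qae => x h Ox; apply/esym/eqP; rewrite -subr_eq0; apply/eqP; exact: h.
have [Hw Hz E] := ES eps eps0; set z := _ \- q in Hz E.
(* As grad q = 0, the energy identity reads |grad w|^2 + eps |grad z|^2 = 0 with both terms
   nonnegative. *)
have z0 : dir Om z z = 0.
  have R0 : \sum_i ip (mu := lebesgue_rV R n) (D := Om) (wpartial Om i q) (uS i \- ueps eps i) = 0.
    by apply: big1 => i _; exact: (ip_wpartial0 oOm i Hq (H1_L2 (H10_H1 (Hw i))) dq).
  have W0 : 0 <= \sum_i dir Om (uS i \- ueps eps i) (uS i \- ueps eps i).
    by apply: sumr_ge0 => i _; exact: dir_ge0.
  exact: (addr_eq0_ge0 eps0 W0 (dir_ge0 Om z) (etrans E (etrans (congr1 -%R R0) (oppr0 R)))).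
have zae := dir0_ae oOm poinc Hz z0.
apply: filterS2 qae zae => x h1 h2 Ox; have := h2 Ox; rewrite /z /= (h1 Ox) subr0 => h.
by apply/esym/eqP; rewrite -subr_eq0 h.
Qed.
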